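(* Let $\alpha,\beta\in(0,1)$ be such that $\beta$ has degree $15$ over $\alpha$ (that is, $\alpha$ and $\beta$ have degrees $(n_1,n_2)=(1,15)$), i.e. $$15\,\frac{{}_2F_1\left(\frac12,\frac12;1;1-\alpha\right)}{{}_2F_1\left(\frac12,\frac12;1;\alpha\right)}=\frac{{}_2F_1\left(\frac12,\frac12;1;1-\beta\right)}{{}_2F_1\left(\frac12,\frac12;1;\beta\right)},$$ and let $$m=\frac{z_1}{z_{15}},\qquad z_1={}_2F_1\left(\tfrac12,\tfrac12;1;\alpha\right),\quad z_{15}={}_2F_1\left(\tfrac12,\tfrac12;1;\beta\right),$$ be the multiplier. Then: (i) $$\begin{aligned} m-\frac{15}{m}=\;&2\left((\alpha\beta)^{1/8}-\{(1-\alpha)(1-\beta)\}^{1/8}\right)\Big[1+3\left((\alpha\beta)^{1/8}+\{(1-\alpha)(1-\beta)\}^{1/8}\right)\\ &+3\left((\alpha\beta)^{1/4}+\{(1-\alpha)(1-\beta)\}^{1/4}\right)+2\left(\alpha\beta(1-\alpha)(1-\beta)\right)^{1/8}\left(3+(\alpha\beta)^{1/8}+\{(1-\alpha)(1-\beta)\}^{1/8}\right)\Big]. \end{aligned}$$ (ii) $$\begin{aligned} m-\frac{15}{m}=\;&2\left((\alpha\beta)^{1/4}-\{(1-\alpha)(1-\beta)\}^{1/4}\right)\Big[4\sqrt{\tfrac12\left(1+\sqrt{\alpha\beta}+\sqrt{(1-\alpha)(1-\beta)}\right)}\\ &+4-\left((\alpha\beta)^{1/4}+\{(1-\alpha)(1-\beta)\}^{1/4}\right)\Big].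 \end{aligned}$$ (iii) In terms of Ramanujan's theta functions $\varphi,\psi$, for $|q|<1$, $$\begin{aligned} \frac{\varphi^2(q)}{\varphi^2(q^{15})}-15\,\frac{\varphi^2(q^{15})}{\varphi^2(q)}=\;&2\left(4q^4\frac{\psi(q^2)\psi(q^{30})}{\varphi(q)\varphi(q^{15})}-\frac{\varphi(-q)\varphi(-q^{15})}{\varphi(q)\varphi(q^{15})}\right)\Big[4\left(\frac{\varphi(q^2)\varphi(q^{30})}{\varphi(q)\varphi(q^{15})}+4q^8\frac{\psi(q^4)\psi(q^{60})}{\varphi(q)\varphi(q^{15})}\right)\\ &+4-\left(4q^4\frac{\psi(q^2)\psi(q^{30})}{\varphi(q)\varphi(q^{15})}+\frac{\varphi(-q)\varphi(-q^{15})}{\varphi(q)\varphi(q^{15})}\right)\Big]. \end{aligned}$$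
   Context: ${}_2F_1(a,b;c;x)$ is the Gauss hypergeometric function. For $\alpha,\beta\in(0,1)$ and a positive rational $n$, one says $\beta$ has degree $n$ over $\alpha$ if $n\,\frac{{}_2F_1(\frac12,\frac12;1;1-\alpha)}{{}_2F_1(\frac12,\frac12;1;\alpha)}=\frac{{}_2F_1(\frac12,\frac12;1;1-\beta)}{{}_2F_1(\frac12,\frac12;1;\beta)}$. All fractional powers and square roots are the positive real ones. Ramanujan's theta functions are, for $|q|<1$, $\varphi(q)=\sum_{n=-\infty}^{\infty}q^{n^2}=(-q;q^2)_\infty^2(q^2;q^2)_\infty$ and $\psi(q)=f(q,q^3)$, where $f(a,b)=\sum_{n=-\infty}^{\infty}a^{n(n+1)/2}b^{n(n-1)/2}$ for $|ab|<1$; equivalently $\psi(q)=\sum_{n=0}^{\infty}q^{n(n+1)/2}$. Here $(a;q)_\infty=\prod_{k\ge0}(1-aq^k)$. The base attached to $\alpha$ is $q=\exp\left(-\pi\,\frac{{}_2F_1(\frac12,\frac12;1;1-\alpha)}{{}_2F_1(\frac12,\frac12;1;\alpha)}\right)$; with this $q$ and $\beta$ of degree $15$ over $\alpha$ one has $z_1=\varphi^2(q)$, $z_{15}=\varphi^2(q^{15})$, so $m=\varphi^2(q)/\varphi^2(q^{15})$. *)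

(* Defs.v *)
From Stdlib Require Import Reals ZArith Lra.
From Coquelicot Require Import Coquelicot.

Open Scope R_scope.

Fixpoint rising (a : R) (n : nat) : R :=
  match n with
  | O => 1
  | S k => rising a k * (a + INR k)
  end.

Definition hyp2F1 (a b c x : R) : R :=
  Series (fun n => rising a n * rising b n / (rising c n * INR (fact n)) * x ^ n).

Definition has_degree_over (n beta alpha : R) : Prop :=
  n * (hyp2F1 (1/2) (1/2) 1 (1 - alpha) / hyp2F1 (1/2) (1/2) 1 alpha)
  = hyp2F1 (1/2) (1/2) 1 (1 - beta) / hyp2F1 (1/2) (1/2) 1 beta.

(* Coquelicot's [Series] is real-valued only; [CSeries] is its complex analogue,
   and [is_series_CSeries] shows that it is the sum whenever the series converges. *)
Definition CSeries (a : nat -> C) : C :=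
  (Series (fun n => Re (a n)), Series (fun n => Im (a n))).

(* Bilateral sum over all n in Z, split as n >= 0 and n <= -1. *)
Definition CSeriesZ (a : Z -> C) : C :=
  (CSeries (fun n => a (Z.of_nat n)) + CSeries (fun n => a (- Z.of_nat (S n))%Z))%C.

Lemma is_series_CSeries (a : nat -> C) (l : C) :
  is_series (V := C_R_NormedModule) a l -> CSeries a = l.
Proof.
intros H.
assert (E : forall n, @sum_n C_R_NormedModule a n
  = (sum_n (fun k => Re (a k)) n, sum_n (fun k => Im (a k)) n)).
{ induction n as [|n IH].
  - rewrite !sum_O. apply surjective_pairing.
  - rewrite !sum_Sn, IH. reflexivity. }
unfold CSeries. destruct l as [x y]. f_equal; apply is_series_unique; intros P HP.
- destruct HP as [e He].
  assert (HQ : locally ((x, y) : C_R_NormedModule) (fun z => P (fst z))).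
  { exists e. intros z Hz. apply He. apply Hz. }
  destruct (H _ HQ) as [N HN]. exists N. intros n Hn.
  specialize (HN n Hn). rewrite E in HN. exact HN.
- destruct HP as [e He].
  assert (HQ : locally ((x, y) : C_R_NormedModule) (fun z => P (snd z))).
  { exists e. intros z Hz. apply He. apply Hz. }
  destruct (H _ HQ) as [N HN]. exists N. intros n Hn.
  specialize (HN n Hn). rewrite E in HN. exact HN.
Qed.

(* All exponents below are nonnegative integers, so [Z.to_nat] loses nothing. *)
Definition ramanujan_f (a b : C) : C :=
  CSeriesZ (fun n =>
    (a ^ Z.to_nat (n * (n + 1) / 2) * b ^ Z.to_nat (n * (n - 1) / 2))%C).

Definition phi (q : C) : C := CSeriesZ (fun n => (q ^ Z.to_nat (n * n))%C).

Definition psi (q : C) : C := ramanujan_f q (q ^ 3)%C.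

(* Main.v *)
Require Import Defs.
From Stdlib Require Import Reals ZArith Lra Lia Psatz List FinFun Classical Ranalysis5.
From Coquelicot Require Import Coquelicot.

(** The identities are statements about theta functions.  Put
    [modulus q = 1 - (phi(-q) / phi(q))^4] for [0 < q < 1].  By Jacobi's inversion
    theorem every [alpha] in (0, 1) is [modulus q] for some [q], with
    [2F1(1/2, 1/2; 1; alpha) = phi(q)^2], and the ratio
    [2F1(1 - alpha) / 2F1(alpha)] is a constant multiple of [- ln q].  So [beta] has
    degree 15 over [alpha] exactly when [beta = modulus (q^15)], and the multiplier is
    [m = phi(q)^2 / phi(q^15)^2] ([ell_modulus], [ell_ratio_nome], [degree_15_nome]).
    Inversion is proved through Landen's transformation ([landen]), a comparison of two
    solutions of one differential equation.  On the theta side the transformation is the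
    passage from [q] to [q^2], so that iterating it reduces everything to the behaviour
    at [q = 0].

    Let [u], [v] be the eighth roots of [alpha beta] and [(1 - alpha)(1 - beta)], and
    [s = u + v].  They satisfy the modular equation
    [4 u v s = (1 - s)^2 (1 + s)] ([modular_equation]).  It follows by elimination from
    two linear relations between products of two theta functions, which are sums over
    residue classes of the lattice with norm form [x^2 + 15 y^2]; both relations rest
    on one isometry between two sets of such classes, given by an element of norm 1 of
    Q(sqrt(-15)) ([plane_rotate]).

    The multiplier appears when the modular equation is differentiated along [q].  Since
    [q d(alpha)/dq = alpha (1 - alpha) phi(q)^4] ([is_derive_modulus]), the derivative
    is a linear relation between [phi(q)^4] and [phi(q^15)^4], so it gives [m^2] as a
    rational function of [u], [v], [alpha], [beta].  On the modular curve [(u - v)^2] is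
    rational in [s], the expression found for [m] becomes a perfect square, and the
    outcome is
    [m - 15 / m = (u - v) (3 + 5 s + 5 s^2 + s^3)] ([multiplier_of_gradient],
    [theta_multiplier]).  Parts (i) and (ii) are two ways of writing the right-hand side
    on the curve, where the radicand of (ii) is the square of
    [(1 - s + 3 s^2 + s^3) / (4 s)].

    For [0 < q < 1], part (iii) is part (ii) written with theta functions.  After
    multiplication by [phi(q)^2 phi(q^15)^2] both sides are power series in [q]
    converging on the unit disc, so the identity theorem extends the equality to complex
    [q]; division is allowed because [phi] has no zero in the disc ([phi_nonzero]). *)

Open Scope R_scope.


(** * Power series on the unit disc *)

Lemma is_series_head (a : nat -> R) (l : R) :
  (forall n, a (S n) = 0) -> a 0%nat = l -> is_series a l.
Proof.
  intros H <-. change (is_lim_seq (sum_n a) (a 0%nat)).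
  apply (is_lim_seq_ext (fun _ => a 0%nat)); [|apply is_lim_seq_const].
  induction n as [|n IH]; [now rewrite sum_O|].
  rewrite sum_Sn, <- IH, H. unfold plus; simpl. ring.
Qed.

(** Convergence of a complex series, componentwise, so that the real theory of
    series applies to each part. *)
Definition csum (a : nat -> C) (l : C) : Prop :=
  is_series (fun n => Re (a n)) (Re l) /\ is_series (fun n => Im (a n)) (Im l).

(** Power series with real coefficients converging on the open unit disc.  Only the
    existence of the coefficients is recorded: this class is closed under all the
    operations that build the theta identities, and an identity between its members
    can be checked on (0, 1) alone. *)
Definition disc_series (f : C -> C) : Prop :=
  exists a : nat -> R, forall z, Cmod z < 1 -> csum (fun n => (a n * z ^ n)%C) (f z).

Lemma csum_ext (a b : nat -> C) (l : C) :
  (forall n, a n = b n) -> csum a l -> csum b l.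
Proof.
  intros H [H1 H2]; split.
  - apply (is_series_ext _ _ _ (fun n => f_equal Re (H n)) H1).
  - apply (is_series_ext _ _ _ (fun n => f_equal Im (H n)) H2).
Qed.

Lemma Im_le_Cmod (z : C) : Rabs (Im z) <= Cmod z.
Proof.
  eapply Rle_trans; [apply Rmax_r | apply Rmax_Cmod].
Qed.

Lemma Re_le_Cmod (z : C) : Rabs (Re z) <= Cmod z.
Proof.
  eapply Rle_trans; [apply Rmax_l | apply Rmax_Cmod].
Qed.

Lemma ex_series_abs_Re (a : nat -> C) :
  ex_series (fun n => Cmod (a n)) -> ex_series (fun n => Rabs (Re (a n))).
Proof.
  apply (ex_series_le (fun n => Rabs (Re (a n)))).
  intro n. unfold norm; simpl; unfold abs; simpl. rewrite Rabs_Rabsolu. apply Re_le_Cmod.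
Qed.

Lemma ex_series_abs_Im (a : nat -> C) :
  ex_series (fun n => Cmod (a n)) -> ex_series (fun n => Rabs (Im (a n))).
Proof.
  apply (ex_series_le (fun n => Rabs (Im (a n)))).
  intro n. unfold norm; simpl; unfold abs; simpl. rewrite Rabs_Rabsolu. apply Im_le_Cmod.
Qed.

Lemma csum_ex (a : nat -> C) :
  ex_series (fun n => Cmod (a n)) -> csum a (CSeries a).
Proof.
  intro H; split; simpl; apply Series_correct, ex_series_Rabs.
  - now apply ex_series_abs_Re.
  - now apply ex_series_abs_Im.
Qed.

Definition cconv (a b : nat -> C) (n : nat) : C :=
  (sum_f_R0 (fun k => Re (a k * b (n - k)%nat)%C) n,
   sum_f_R0 (fun k => Im (a k * b (n - k)%nat)%C) n).

Lemma csum_mult (a b : nat -> C) (la lb : C) :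
  csum a la -> csum b lb ->
  ex_series (fun n => Cmod (a n)) -> ex_series (fun n => Cmod (b n)) ->
  csum (cconv a b) (la * lb)%C.
Proof.
  intros [A1 A2] [B1 B2] Ha Hb.
  pose proof (ex_series_abs_Re _ Ha) as Ra. pose proof (ex_series_abs_Im _ Ha) as Ia.
  pose proof (ex_series_abs_Re _ Hb) as Rb. pose proof (ex_series_abs_Im _ Hb) as Ib.
  split.
  - generalize (is_series_minus _ _ _ _ (is_series_mult _ _ _ _ A1 B1 Ra Rb)
                  (is_series_mult _ _ _ _ A2 B2 Ia Ib)).
    apply is_series_ext. intro n.
    change (sum_f_R0 (fun k => Re (a k) * Re (b (n - k)%nat)) n
            - sum_f_R0 (fun k => Im (a k) * Im (b (n - k)%nat)) n = Re (cconv a b n)).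
    rewrite <- minus_sum. reflexivity.
  - generalize (is_series_plus _ _ _ _ (is_series_mult _ _ _ _ A1 B2 Ra Ib)
                  (is_series_mult _ _ _ _ A2 B1 Ia Rb)).
    apply is_series_ext. intro n.
    change (sum_f_R0 (fun k => Re (a k) * Im (b (n - k)%nat)) n
            + sum_f_R0 (fun k => Im (a k) * Re (b (n - k)%nat)) n = Im (cconv a b n)).
    rewrite <- sum_plus. reflexivity.
Qed.

(** Convergence at every point of [0, 1) suffices, since beyond the radius the terms
    do not even tend to 0. *)
Lemma CV_radius_ge_1 (a : nat -> R) :
  (forall r, 0 <= r < 1 -> ex_pseries a r) -> Rbar_le 1 (CV_radius a).
Proof.
  intro H. apply Rbar_not_lt_le. intro Hlt.
  destruct (CV_radius a) as [c| |] eqn:E; simpl in Hlt; try easy.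
  - pose proof (CV_radius_ge_0 a) as H0. rewrite E in H0; simpl in H0.
    apply (CV_disk_outside a ((c + 1) / 2)).
    + rewrite E. simpl. rewrite Rabs_pos_eq; lra.
    + apply ex_series_lim_0, ex_pseries_R, H. lra.
  - pose proof (CV_radius_ge_0 a) as H0. now rewrite E in H0.
Qed.

Lemma RtoC_term (a : R) (x : R) (n : nat) : (a * RtoC x ^ n)%C = RtoC (a * x ^ n).
Proof. rewrite RtoC_mult, RtoC_pow. reflexivity. Qed.

Section Coefficients.

Variables (a : nat -> R) (f : C -> C).
Hypothesis Hf : forall z, Cmod z < 1 -> csum (fun n => (a n * z ^ n)%C) (f z).

Lemma coef_is_pseries (x : R) : Rabs x < 1 -> is_pseries a x (Re (f x)).
Proof.
  intro Hx. destruct (Hf x) as [H _]; [now rewrite Cmod_R|].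
  apply is_pseries_R. revert H. apply is_series_ext. intro n.
  now rewrite RtoC_term.
Qed.

Lemma coef_radius : Rbar_le 1 (CV_radius a).
Proof.
  apply CV_radius_ge_1. intros r Hr. exists (Re (f r)). apply coef_is_pseries.
  rewrite Rabs_pos_eq; lra.
Qed.

Lemma coef_real (x : R) : Rabs x < 1 -> f x = RtoC (PSeries a x).
Proof.
  intro Hx. rewrite (is_pseries_unique _ _ _ (coef_is_pseries x Hx)).
  destruct (Hf x) as [_ H]; [now rewrite Cmod_R|].
  assert (E : Im (f x) = 0).
  { rewrite <- (is_series_unique _ _ H). apply is_series_unique.
    assert (Z : forall n : nat, Im (a n * x ^ n)%C = 0).
    { intro n. now rewrite RtoC_term, im_RtoC. }
    apply is_series_head; [intro n; apply Z | apply Z]. }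
  destruct (f x) as [u v]. simpl in E. now subst v.
Qed.

Lemma coef_abs (z : C) : Cmod z < 1 -> ex_series (fun n => Cmod (a n * z ^ n)%C).
Proof.
  intro Hz. pose proof (CV_disk_inside a (Cmod z)) as H.
  rewrite Rabs_pos_eq in H by apply Cmod_ge_0.
  apply ex_series_ext with (2 := H (Rbar_lt_le_trans (Cmod z) 1 _ Hz coef_radius)).
  intro n. rewrite Cmod_mult, Cmod_pow, Cmod_R, Rabs_mult. f_equal.
  apply Rabs_pos_eq, pow_le, Cmod_ge_0.
Qed.

End Coefficients.

Lemma disc_series_ext (f g : C -> C) :
  (forall z, Cmod z < 1 -> f z = g z) -> disc_series f -> disc_series g.
Proof.
  intros E [a Ha]. exists a. intros z Hz. rewrite <- E by assumption. now apply Ha.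
Qed.

Lemma disc_series_const (c : R) : disc_series (fun _ => RtoC c).
Proof.
  exists (fun n => match n with O => c | S _ => 0 end). intros z _. split.
  - apply is_series_head; [intro n; simpl; ring | unfold Re, Im; simpl; ring].
  - apply is_series_head; [intro n; simpl; ring | unfold Re, Im; simpl; ring].
Qed.

Lemma disc_series_plus (f g : C -> C) :
  disc_series f -> disc_series g -> disc_series (fun z => f z + g z)%C.
Proof.
  intros [a Ha] [b Hb]. exists (fun n => a n + b n). intros z Hz.
  destruct (Ha z Hz) as [A1 A2], (Hb z Hz) as [B1 B2]. split.
  - generalize (is_series_plus _ _ _ _ A1 B1). apply is_series_ext. intro n.
    unfold plus; simpl. ring.
  - generalize (is_series_plus _ _ _ _ A2 B2). apply is_series_ext. intro n.
    unfold plus; simpl. ring.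
Qed.

(** The Cauchy product; its complex form follows from four real Cauchy products. *)
Lemma disc_series_mult (f g : C -> C) :
  disc_series f -> disc_series g -> disc_series (fun z => f z * g z)%C.
Proof.
  intros [a Ha] [b Hb]. exists (PS_mult a b). intros z Hz.
  generalize (csum_mult _ _ _ _ (Ha z Hz) (Hb z Hz)
                (coef_abs _ _ Ha z Hz) (coef_abs _ _ Hb z Hz)).
  apply csum_ext. intro n. unfold cconv.
  assert (T : forall k, (k <= n)%nat ->
    (a k * z ^ k * (b (n - k)%nat * z ^ (n - k)%nat))%C = ((a k * b (n - k)%nat)%R * z ^ n)%C).
  { intros k Hk. rewrite RtoC_mult.
    replace (z ^ n)%C with (z ^ k * z ^ (n - k))%C; [ring|].
    rewrite <- Cpow_add_r. do 2 f_equal. lia. }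
  unfold PS_mult. rewrite (surjective_pairing (RtoC _ * z ^ n)%C).
  change (fst ?x) with (Re x). change (snd ?x) with (Im x).
  rewrite re_scal_l, im_scal_l. f_equal.
  - rewrite <- (Rmult_comm (Re (z ^ n))), scal_sum. apply sum_eq. intros k Hk.
    rewrite T by assumption. now rewrite re_scal_l.
  - rewrite <- (Rmult_comm (Im (z ^ n))), scal_sum. apply sum_eq. intros k Hk.
    rewrite T by assumption. now rewrite im_scal_l.
Qed.

Lemma disc_series_opp (f : C -> C) : disc_series f -> disc_series (fun z => - f z)%C.
Proof.
  intro Hf. apply disc_series_ext with (fun z => RtoC (- (1)) * f z)%C.
  { intros z _. rewrite RtoC_opp. ring. }
  apply disc_series_mult; [apply disc_series_const | exact Hf].
Qed.

Lemma disc_series_minus (f g : C -> C) :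
  disc_series f -> disc_series g -> disc_series (fun z => f z - g z)%C.
Proof.
  intros Hf Hg. apply disc_series_plus; [exact Hf | now apply disc_series_opp].
Qed.

Lemma disc_series_pow (f : C -> C) (n : nat) :
  disc_series f -> disc_series (fun z => f z ^ n)%C.
Proof.
  intro Hf. induction n as [|n IH]; simpl.
  - apply disc_series_const.
  - now apply disc_series_mult.
Qed.

Lemma disc_series_comp_opp (f : C -> C) : disc_series f -> disc_series (fun z => f (- z)%C).
Proof.
  intros [a Ha]. exists (fun n => a n * (- (1)) ^ n). intros z Hz.
  assert (Hz' : Cmod (- z) < 1) by now rewrite Cmod_opp.
  apply csum_ext with (2 := Ha _ Hz'). intro n.
  replace (- z)%C with (RtoC (- (1)) * z)%C by (rewrite RtoC_opp; ring).
  rewrite Cpow_mult_l, RtoC_mult, RtoC_pow. ring.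
Qed.

(** ** Rearranging lacunary sums as power series *)

Fixpoint psum (a : nat -> R) (n : nat) : R :=
  match n with O => 0 | S k => psum a k + a k end.

Lemma is_series_psum (a : nat -> R) (l : R) : is_series a l <-> is_lim_seq (psum a) l.
Proof.
  assert (E : forall n, sum_n a n = psum a (S n)).
  { induction n as [|n IH]; [rewrite sum_O; simpl; ring|].
    rewrite sum_Sn, IH. reflexivity. }
  rewrite (is_lim_seq_incr_1 (psum a)). split; intro H.
  - apply is_lim_seq_ext with (2 := H). exact E.
  - change (is_lim_seq (sum_n a) l).
    apply (is_lim_seq_ext (fun n => psum a (S n))); [now intro; rewrite E|exact H].
Qed.

Section Lacunary.

Variable e : nat -> nat.
Hypothesis e_incr : forall j, (e j < e (S j))%nat.

(** To write the sum of [s j * z ^ e j] as a power series, scan the exponents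
    [n = 0, 1, 2, ...] and keep the number of indices [j] with [e j < n]: the next
    index to be used is that number itself. *)
Fixpoint gap_count (n : nat) : nat :=
  match n with
  | O => O
  | S k => if Nat.eqb (e (gap_count k)) k then S (gap_count k) else gap_count k
  end.

Definition gap_coef (s : nat -> R) (n : nat) : R :=
  if Nat.eqb (e (gap_count n)) n then s (gap_count n) else 0.

Lemma gap_count_bound (n : nat) : (n <= e (gap_count n))%nat.
Proof.
  induction n as [|n IH]; [lia|]. simpl.
  destruct (Nat.eqb_spec (e (gap_count n)) n) as [E|E]; [|lia].
  pose proof (e_incr (gap_count n)). lia.
Qed.

Lemma gap_count_unbounded (M : nat) : exists N, forall n, (N <= n)%nat -> (M <= gap_count n)%nat.
Proof.
  assert (Mono : forall n m, (n <= m)%nat -> (gap_count n <= gap_count m)%nat).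
  { intros n m H. induction H as [|m H IH]; [lia|]. simpl. destruct Nat.eqb; lia. }
  assert (Step : forall n, exists m, (S (gap_count n) <= gap_count m)%nat).
  { intro n.
    assert (A : forall d k, (e (gap_count k) - k = d)%nat ->
              exists m, (S (gap_count k) <= gap_count m)%nat).
    { induction d as [|d IH]; intros k Hk.
      - exists (S k). simpl. pose proof (gap_count_bound k).
        destruct (Nat.eqb_spec (e (gap_count k)) k); lia.
      - assert (E : gap_count (S k) = gap_count k).
        { simpl. destruct (Nat.eqb_spec (e (gap_count k)) k); [lia|reflexivity]. }
        destruct (IH (S k)) as [m Hm]; [rewrite E; lia|]. exists m. lia. }
    exact (A _ n eq_refl). }
  induction M as [|M [N HN]]; [exists 0%nat; lia|].
  destruct (Step N) as [m Hm]. exists m. intros n Hn.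
  pose proof (Mono m n Hn). pose proof (HN N (le_n N)). lia.
Qed.

Lemma gap_sum (s w : nat -> R) (n : nat) :
  psum (fun k => gap_coef s k * w k) n = psum (fun j => s j * w (e j)) (gap_count n).
Proof.
  induction n as [|n IH]; [reflexivity|]. simpl. rewrite IH. unfold gap_coef.
  destruct (Nat.eqb_spec (e (gap_count n)) n) as [E|E]; simpl; [|ring].
  now rewrite E.
Qed.

Lemma gap_series (s w : nat -> R) (l : R) :
  is_series (fun j => s j * w (e j)) l -> is_series (fun k => gap_coef s k * w k) l.
Proof.
  rewrite !is_series_psum. intro H.
  apply is_lim_seq_ext with (1 := fun n => eq_sym (gap_sum s w n)).
  apply filterlim_comp with (2 := H).
  intros P [M HM]. destruct (gap_count_unbounded M) as [N HN].
  exists N. intros n Hn. apply HM, HN, Hn.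
Qed.

(** The theta series are lacunary, and so is the series obtained from a power series
    by substituting [z ^ k] for [z]; all of them belong to the class by this lemma. *)
Lemma disc_series_lacunary (s : nat -> R) (f : C -> C) :
  (forall z, Cmod z < 1 -> csum (fun j => (s j * z ^ e j)%C) (f z)) -> disc_series f.
Proof.
  intro H. exists (gap_coef s). intros z Hz. destruct (H z Hz) as [H1 H2]. split.
  - apply is_series_ext with (fun k => gap_coef s k * Re (z ^ k)%C).
    + intro n. now rewrite re_scal_l.
    + apply (gap_series s (fun k => Re (z ^ k)%C)). revert H1. apply is_series_ext. intro n. now rewrite re_scal_l.
  - apply is_series_ext with (fun k => gap_coef s k * Im (z ^ k)%C).
    + intro n. now rewrite im_scal_l.
    + apply (gap_series s (fun k => Im (z ^ k)%C)). revert H2. apply is_series_ext. intro n. now rewrite im_scal_l.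
Qed.

Lemma gap_ge (j : nat) : (j <= e j)%nat.
Proof.
  induction j as [|j IH]; [lia|]. pose proof (e_incr j). lia.
Qed.

Lemma csum_lacunary (z : C) :
  Cmod z < 1 -> csum (fun j => z ^ e j)%C (CSeries (fun j => z ^ e j)%C).
Proof.
  intro Hz. apply csum_ex.
  apply (ex_series_le (fun j => Cmod (z ^ e j)%C) (fun n => Cmod z ^ n)).
  - intro n. unfold norm; simpl; unfold abs; simpl.
    rewrite Rabs_pos_eq by apply Cmod_ge_0. rewrite Cmod_pow.
    replace (e n) with (n + (e n - n))%nat by (pose proof (gap_ge n); lia).
    rewrite pow_add. rewrite <- (Rmult_1_r (Cmod z ^ n)) at 2.
    apply Rmult_le_compat_l; [apply pow_le, Cmod_ge_0|].
    rewrite <- (pow1 (e n - n)). apply pow_incr. split; [apply Cmod_ge_0 | lra].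
  - exists (/ (1 - Cmod z)). apply is_series_geom.
    rewrite Rabs_pos_eq; [assumption | apply Cmod_ge_0].
Qed.

Lemma disc_series_lacunary_CSeries : disc_series (fun z => CSeries (fun j => z ^ e j)%C).
Proof.
  apply (disc_series_lacunary (fun _ => 1)). intros z Hz.
  apply csum_ext with (2 := csum_lacunary z Hz). intro n. ring.
Qed.

End Lacunary.

Lemma Cmod_pow_lt_1 (z : C) (k : nat) : (0 < k)%nat -> Cmod z < 1 -> Cmod (z ^ k) < 1.
Proof.
  intros Hk Hz. rewrite Cmod_pow. apply pow_lt_1_compat; [|assumption].
  split; [apply Cmod_ge_0 | assumption].
Qed.

Lemma disc_series_comp_pow (f : C -> C) (k : nat) :
  (0 < k)%nat -> disc_series f -> disc_series (fun z => f (z ^ k)%C).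
Proof.
  intros Hk [a Ha]. apply (disc_series_lacunary (fun j => k * j)%nat) with a.
  - intro j. lia.
  - intros z Hz. apply csum_ext with (2 := Ha _ (Cmod_pow_lt_1 z k Hk Hz)).
    intro n. now rewrite Cpow_mult_r.
Qed.

Lemma disc_series_id : disc_series (fun z => z).
Proof.
  apply (disc_series_lacunary (fun j => S j) (fun j => Nat.lt_succ_diag_r (S j))
    (fun j => match j with O => 1 | _ => 0 end)).
  intros z _. split.
  - apply is_series_head; [intro n; simpl; ring | unfold Re, Im; simpl; ring].
  - apply is_series_head; [intro n; simpl; ring | unfold Re, Im; simpl; ring].
Qed.

Lemma locally_disc (x : R) (P : R -> Prop) :
  Rabs x < 1 -> (forall y, Rabs y < 1 -> P y) -> locally x P.
Proof.
  intros Hx H. assert (Hd : 0 < 1 - Rabs x) by lra. exists (mkposreal _ Hd).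
  intros y Hy. apply H.
  unfold ball in Hy; simpl in Hy; unfold AbsRing_ball in Hy; simpl in Hy.
  unfold abs, minus, plus, opp in Hy; simpl in Hy.
  pose proof (Rabs_triang_inv y x). unfold Rminus in *. lra.
Qed.

(** ** The identity theorem *)

(** Continuity at 0 is all that is used, so vanishing on one side of 0 suffices. *)
Lemma PSeries_zero_coef (a : nat -> R) :
  Rbar_lt 0 (CV_radius a) ->
  (forall x, 0 < x < 1 -> PSeries a x = 0) -> a 0%nat = 0.
Proof.
  intros Hr Hz.
  assert (Hc : continuity_pt (PSeries a) 0).
  { apply PSeries_continuity. now rewrite Rabs_R0. }
  destruct (Req_dec (a 0%nat) 0) as [E|E]; [assumption|exfalso].
  destruct (Hc (Rabs (a 0%nat))) as [d [Hd Hx]]; [now apply Rabs_pos_lt|].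
  set (x := Rmin (d / 2) (1 / 2)).
  assert (Hx0 : 0 < x) by (unfold x; apply Rmin_pos; lra).
  assert (Hx1 : x <= d / 2) by apply Rmin_l.
  assert (Hx2 : x <= 1 / 2) by apply Rmin_r.
  specialize (Hx x). rewrite (Hz x), PSeries_0 in Hx by lra.
  assert (Hl : R_dist 0 (a 0%nat) < Rabs (a 0%nat)).
  { apply Hx. split.
    - split; [exact I | lra].
    - simpl. unfold R_dist. rewrite Rminus_0_r, Rabs_pos_eq; lra. }
  unfold R_dist in Hl. rewrite Rminus_0_l, Rabs_Ropp in Hl. lra.
Qed.

Lemma PSeries_identity (a : nat -> R) :
  Rbar_le 1 (CV_radius a) ->
  (forall x, 0 < x < 1 -> PSeries a x = 0) -> forall n, a n = 0.
Proof.
  intros Hr Hz n. revert a Hr Hz. induction n as [|n IH]; intros a Hr Hz.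
  - apply PSeries_zero_coef; [|assumption].
    apply Rbar_lt_le_trans with 1; [simpl; lra | assumption].
  - change (a (S n)) with (PS_decr_1 a n). apply IH.
    + now rewrite CV_radius_decr_1.
    + assert (H0 : a 0%nat = 0).
      { apply PSeries_zero_coef; [|assumption].
        apply Rbar_lt_le_trans with 1; [simpl; lra | assumption]. }
      intros x Hx. pose proof (PSeries_decr_1_aux a x H0) as E.
      rewrite Hz in E by assumption. symmetry in E.
      destruct (Rmult_integral _ _ E); lra.
Qed.

(** Identity theorem: this is how every theta identity is moved from (0, 1) to
    negative and complex arguments. *)
Lemma disc_series_identity (f : C -> C) :
  disc_series f -> (forall x : R, 0 < x < 1 -> f x = 0) ->
  forall z, Cmod z < 1 -> f z = 0.
Proof.
  intros [a Ha] H z Hz.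
  assert (Z : forall n, a n = 0).
  { apply PSeries_identity; [now apply (coef_radius a f)|].
    intros x Hx. apply RtoC_inj. rewrite <- (coef_real a f Ha), H; auto.
    rewrite Rabs_pos_eq; lra. }
  destruct (Ha z Hz) as [H1 H2].
  assert (T : forall w : nat -> R, (forall n, w n = 0) -> Series w = 0).
  { intros w Hw. rewrite (Series_ext w (fun n => 0 * w n)).
    - rewrite Series_scal_l. ring.
    - intro n. rewrite Hw. ring. }
  rewrite (surjective_pairing (f z)).
  change (fst (f z)) with (Re (f z)). change (snd (f z)) with (Im (f z)).
  rewrite <- (is_series_unique _ _ H1), <- (is_series_unique _ _ H2), !T; [reflexivity| |].
  - intro n. rewrite Z. simpl. ring.
  - intro n. rewrite Z. simpl. ring.
Qed.


(** * Unordered sums of nonnegative terms *)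

Definition lsum {A : Type} (f : A -> R) (L : list A) : R :=
  fold_right (fun x s => f x + s) 0 L.

(** For nonnegative terms the sum over an arbitrary index type is the least upper
    bound of the finite subsums; no order of summation is involved, so lattice sums can
    be reindexed and regrouped freely. *)
Definition has_sum {A : Type} (f : A -> R) (l : R) : Prop :=
  is_lub (fun r => exists L, NoDup L /\ r = lsum f L) l.

Section Lsum.

Context {A : Type}.
Implicit Types (f g : A -> R) (L M : list A).

Lemma lsum_app f L M : lsum f (L ++ M) = lsum f L + lsum f M.
Proof. induction L as [|x L IH]; simpl; [ring | rewrite IH; ring]. Qed.

Lemma lsum_plus f g L : lsum (fun x => f x + g x) L = lsum f L + lsum g L.
Proof. induction L as [|x L IH]; simpl; [ring | rewrite IH; ring]. Qed.

Lemma lsum_ge_0 f L : (forall x, 0 <= f x) -> 0 <= lsum f L.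
Proof.
  intro H. induction L as [|x L IH]; simpl; [lra|]. specialize (H x). lra.
Qed.

Lemma lsum_le f g L : (forall x, f x <= g x) -> lsum f L <= lsum g L.
Proof.
  intro H. induction L as [|x L IH]; simpl; [lra|]. specialize (H x). lra.
Qed.

Lemma lsum_incl f L M :
  (forall x, 0 <= f x) -> NoDup L -> incl L M -> lsum f L <= lsum f M.
Proof.
  intros Hf HL. revert M. induction HL as [|x L Hx HL IH]; intros M HM; simpl.
  - now apply lsum_ge_0.
  - destruct (in_split x M) as [M1 [M2 E]]; [apply HM; now left|]. subst M.
    rewrite lsum_app. simpl.
    assert (H : lsum f L <= lsum f (M1 ++ M2)).
    { apply IH. intros y Hy.
      assert (Hy' : In y (M1 ++ x :: M2)) by (apply HM; now right).
      apply in_app_or in Hy'. apply in_or_app.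
      destruct Hy' as [?|[E|?]]; [now left | | now right].
      subst y. contradiction. }
    rewrite lsum_app in H. lra.
Qed.

Lemma NoDup_support L : exists M, NoDup M /\ forall x, In x M <-> In x L.
Proof.
  induction L as [|x L [M [HM E]]].
  - exists nil. split; [constructor | reflexivity].
  - destruct (classic (In x L)) as [H|H].
    + exists M. split; [assumption|]. intro y. rewrite E. simpl. split; [now right|].
      intros [<-|?]; assumption.
    + exists (x :: M). split; [constructor; [now rewrite E | assumption]|].
      intro y. simpl. now rewrite E.
Qed.

End Lsum.

Section HasSum.

Context {A : Type}.
Implicit Types (f g : A -> R).

Lemma has_sum_ext f g l : (forall x, f x = g x) -> has_sum f l -> has_sum g l.
Proof.
  intros E H.
  assert (T : forall L, lsum f L = lsum g L).
  { induction L as [|x L IH]; simpl; [reflexivity | now rewrite E, IH]. }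
  destruct H as [H1 H2]. split.
  - intros r [L [HL ->]]. apply H1. exists L. now rewrite T.
  - intros b Hb. apply H2. intros r [L [HL ->]]. apply Hb. exists L. now rewrite T.
Qed.

Lemma has_sum_unique f a b : has_sum f a -> has_sum f b -> a = b.
Proof. apply is_lub_u. Qed.

Lemma has_sum_bound f l L : has_sum f l -> NoDup L -> lsum f L <= l.
Proof. intros [H _] HL. apply H. now exists L. Qed.

Lemma has_sum_least f l b :
  has_sum f l -> (forall L, NoDup L -> lsum f L <= b) -> l <= b.
Proof. intros [_ H] Hb. apply H. intros r [L [HL ->]]. now apply Hb. Qed.

Lemma has_sum_intro f l :
  (forall L, NoDup L -> lsum f L <= l) ->
  (forall b, (forall L, NoDup L -> lsum f L <= b) -> l <= b) -> has_sum f l.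
Proof.
  intros H1 H2. split.
  - intros r [L [HL ->]]. now apply H1.
  - intros b Hb. apply H2. intros L HL. apply Hb. now exists L.
Qed.

Lemma has_sum_plus f g a b :
  (forall x, 0 <= f x) -> (forall x, 0 <= g x) ->
  has_sum f a -> has_sum g b -> has_sum (fun x => f x + g x) (a + b).
Proof.
  intros Hf Hg Ha Hb. apply has_sum_intro.
  - intros L HL. rewrite lsum_plus.
    pose proof (has_sum_bound _ _ _ Ha HL). pose proof (has_sum_bound _ _ _ Hb HL). lra.
  - intros c Hc.
    assert (T : forall L M, NoDup L -> NoDup M -> lsum f L + lsum g M <= c).
    { intros L M HL HM. destruct (NoDup_support (L ++ M)) as [N [HN E]].
      specialize (Hc N HN). rewrite lsum_plus in Hc.
      assert (lsum f L <= lsum f N).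
      { apply lsum_incl; auto. intros x Hx. apply E, in_or_app. now left. }
      assert (lsum g M <= lsum g N).
      { apply lsum_incl; auto. intros x Hx. apply E, in_or_app. now right. }
      lra. }
    assert (a <= c - b); [|lra].
    apply (has_sum_least _ _ _ Ha). intros L HL.
    assert (b <= c - lsum f L); [|lra].
    apply (has_sum_least _ _ _ Hb). intros M HM. specialize (T L M HL HM). lra.
Qed.

Lemma has_sum_exists f g l :
  (forall x, 0 <= g x <= f x) -> has_sum f l -> exists l', has_sum g l'.
Proof.
  intros H Hf. destruct (completeness (fun r => exists L, NoDup L /\ r = lsum g L)) as [l' Hl'].
  - exists l. intros r [L [HL ->]]. apply Rle_trans with (lsum f L).
    + apply lsum_le. intro x. apply H.
    + now apply has_sum_bound.
  - exists 0. exists nil. split; [constructor | reflexivity].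
  - now exists l'.
Qed.

End HasSum.

Lemma has_sum_dominate {A B : Type} (f : A -> R) (g : B -> R) (l : R) :
  (forall L, NoDup L -> exists M, NoDup M /\ lsum f L <= lsum g M) ->
  (forall M, NoDup M -> exists L, NoDup L /\ lsum g M <= lsum f L) ->
  has_sum f l -> has_sum g l.
Proof.
  intros H1 H2 Hf. apply has_sum_intro.
  - intros M HM. destruct (H2 M HM) as [L [HL E]].
    apply Rle_trans with (1 := E). now apply has_sum_bound.
  - intros b Hb. apply (has_sum_least _ _ _ Hf). intros L HL.
    destruct (H1 L HL) as [M [HM E]]. apply Rle_trans with (1 := E). now apply Hb.
Qed.

Lemma lsum_map {A B : Type} (i : A -> B) (f : B -> R) (L : list A) :
  lsum f (map i L) = lsum (fun a => f (i a)) L.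
Proof. induction L as [|x L IH]; simpl; [reflexivity | now rewrite IH]. Qed.

Definition nonzero (r : R) : bool := if Req_EM_T r 0 then false else true.

Lemma nonzero_spec (r : R) : nonzero r = true <-> r <> 0.
Proof. unfold nonzero. destruct (Req_EM_T r 0); split; try easy. Qed.

Lemma lsum_filter {A : Type} (f : A -> R) (L : list A) :
  lsum f (filter (fun x => nonzero (f x)) L) = lsum f L.
Proof.
  induction L as [|x L IH]; simpl; [reflexivity|].
  unfold nonzero at 1. destruct (Req_EM_T (f x) 0) as [E|E]; simpl; rewrite IH; lra.
Qed.

(** Reindexing along an injection [i] with left inverse [j] that need only reach the
    support of [f]: lattice sums over a sublattice, or over a union of residue classes,
    are sums over the whole lattice of a function that vanishes elsewhere. *)
Lemma has_sum_reindex {A B : Type} (i : A -> B) (j : B -> A) (f : B -> R) (l : R) :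
  (forall a, j (i a) = a) -> (forall b, f b <> 0 -> i (j b) = b) ->
  has_sum (fun a => f (i a)) l <-> has_sum f l.
Proof.
  intros Hji Hij.
  assert (T1 : forall L, NoDup L -> exists M, NoDup M /\ lsum (fun a => f (i a)) L <= lsum f M).
  { intros L HL. exists (map i L). split.
    - apply FinFun.Injective_map_NoDup; [|assumption].
      intros x y E. now rewrite <- (Hji x), <- (Hji y), E.
    - rewrite lsum_map. lra. }
  assert (T2 : forall M, NoDup M -> exists L, NoDup L /\ lsum f M <= lsum (fun a => f (i a)) L).
  { intros M HM. set (N := filter (fun x => nonzero (f x)) M).
    assert (HN : forall x, In x N -> i (j x) = x).
    { intros x Hx. apply filter_In in Hx. now apply Hij, nonzero_spec. }
    assert (DN : NoDup N) by now apply NoDup_filter.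
    exists (map j N). split.
    - apply NoDup_map_NoDup_ForallPairs; [|assumption].
      intros x y Hx Hy E. rewrite <- (HN x Hx), <- (HN y Hy), E. reflexivity.
    - rewrite <- (lsum_filter f M). fold N. rewrite lsum_map. apply Req_le.
      clear DN. induction N as [|x N IH]; simpl; [reflexivity|].
      rewrite (HN x (or_introl eq_refl)), IH; [reflexivity|].
      intros y Hy. apply HN. now right. }
  split; apply has_sum_dominate; assumption.
Qed.

Lemma lsum_list_prod {A B : Type} (f : A -> R) (g : B -> R) (L : list A) (M : list B) :
  lsum (fun p => f (fst p) * g (snd p)) (list_prod L M) = lsum f L * lsum g M.
Proof.
  induction L as [|x L IH]; simpl; [ring|].
  rewrite lsum_app, IH, lsum_map. simpl.
  replace (lsum (fun b => f x * g b) M) with (f x * lsum g M); [ring|].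
  clear IH. induction M as [|y M IHM]; simpl; [ring|]. rewrite <- IHM. ring.
Qed.

Lemma NoDup_list_prod {A B : Type} (L : list A) (M : list B) :
  NoDup L -> NoDup M -> NoDup (list_prod L M).
Proof.
  intros HL HM. induction HL as [|x L Hx HL IH]; simpl; [constructor|].
  apply NoDup_app; [| assumption |].
  - apply FinFun.Injective_map_NoDup; [|assumption]. intros y z E. now injection E.
  - intros [a b] Ha Hb. apply in_map_iff in Ha. destruct Ha as [y [E _]].
    apply in_prod_iff in Hb. injection E as <- <-. now apply Hx.
Qed.

(** Lower bound from the products of finite sets; upper bound because every finite
    set of pairs lies in such a product. *)
Lemma has_sum_prod {A B : Type} (f : A -> R) (g : B -> R) (a b : R) :
  (forall x, 0 <= f x) -> (forall x, 0 <= g x) ->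
  has_sum f a -> has_sum g b -> has_sum (fun p => f (fst p) * g (snd p)) (a * b).
Proof.
  intros Hf Hg Ha Hb.
  assert (a0 : 0 <= a) by (apply (has_sum_bound _ _ nil Ha); constructor).
  assert (b0 : 0 <= b) by (apply (has_sum_bound _ _ nil Hb); constructor).
  apply has_sum_intro.
  - intros L HL.
    destruct (NoDup_support (map fst L)) as [L1 [D1 E1]].
    destruct (NoDup_support (map snd L)) as [L2 [D2 E2]].
    apply Rle_trans with (lsum (fun p => f (fst p) * g (snd p)) (list_prod L1 L2)).
    + apply lsum_incl; [intro; now apply Rmult_le_pos | assumption |].
      intros [x y] Hxy. apply in_prod.
      * apply E1. now apply (in_map fst L (x, y)).
      * apply E2. now apply (in_map snd L (x, y)).
    + rewrite lsum_list_prod.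
      apply Rmult_le_compat; try (now apply lsum_ge_0); now apply has_sum_bound.
  - intros c Hc.
    assert (T : forall L M, NoDup L -> NoDup M -> lsum f L * lsum g M <= c).
    { intros L M HL HM. rewrite <- lsum_list_prod. apply Hc. now apply NoDup_list_prod. }
    assert (T1 : forall L, NoDup L -> lsum f L * b <= c).
    { intros L HL. destruct (Rle_lt_or_eq_dec 0 (lsum f L)) as [P|P].
      - now apply lsum_ge_0.
      - assert (b <= c / lsum f L).
        { apply (has_sum_least _ _ _ Hb). intros M HM.
          apply Rle_div_r; [assumption|]. rewrite Rmult_comm. now apply T. }
        apply Rle_div_r in H; [|assumption]. lra.
      - rewrite <- P. rewrite Rmult_0_l.
        specialize (Hc nil (NoDup_nil _)). simpl in Hc. lra. }
    destruct (Rle_lt_or_eq_dec 0 b b0) as [P|P].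
    + apply Rle_div_r; [assumption|]. apply (has_sum_least _ _ _ Ha).
      intros L HL. apply Rle_div_r; [assumption|]. now apply T1.
    + rewrite <- P, Rmult_0_r. specialize (Hc nil (NoDup_nil _)). simpl in Hc. lra.
Qed.

Lemma has_sum_scal {A : Type} (f : A -> R) (k l : R) :
  0 < k -> has_sum f l -> has_sum (fun x => k * f x) (k * l).
Proof.
  intros Hk Hl.
  assert (T : forall L, lsum (fun x => k * f x) L = k * lsum f L).
  { induction L as [|x L IH]; simpl; [ring | rewrite IH; ring]. }
  apply has_sum_intro.
  - intros L HL. rewrite T. apply Rmult_le_compat_l; [lra|]. now apply has_sum_bound.
  - intros b Hb. rewrite Rmult_comm. apply Rle_div_r; [assumption|].
    apply (has_sum_least _ _ _ Hl). intros L HL. apply Rle_div_r; [assumption|].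
    rewrite Rmult_comm, <- T. now apply Hb.
Qed.

(** ** Series as unordered sums *)

Lemma has_sum_nat (a : nat -> R) (l : R) :
  (forall n, 0 <= a n) -> is_series a l -> has_sum a l.
Proof.
  intros Ha Hl. rewrite is_series_psum in Hl.
  assert (E : forall n, psum a n = lsum a (seq 0 n)).
  { induction n as [|n IH]; [reflexivity|].
    rewrite seq_S, lsum_app, <- IH. simpl. ring. }
  assert (Hinc : forall n, psum a n <= psum a (S n)).
  { intro n. simpl. specialize (Ha n). lra. }
  apply has_sum_intro.
  - intros L HL. apply Rle_trans with (psum a (S (list_max L))).
    + rewrite E. apply lsum_incl; auto. intros x Hx. apply in_seq.
      assert (x <= list_max L)%nat; [|lia].
      pose proof (proj1 (list_max_le L (list_max L)) (le_n _)) as F.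
      rewrite Forall_forall in F. now apply F.
    + apply (is_lim_seq_incr_compare _ _ Hl Hinc).
  - intros b Hb. apply (is_lim_seq_le (psum a) (fun _ => b) l b); auto.
    + intro n. rewrite E. apply Hb, seq_NoDup.
    + apply is_lim_seq_const.
Qed.

Lemma has_sum_Z (a : Z -> R) (l1 l2 : R) :
  (forall n, 0 <= a n) ->
  is_series (fun n => a (Z.of_nat n)) l1 ->
  is_series (fun n => a (- Z.of_nat (S n))%Z) l2 -> has_sum a (l1 + l2).
Proof.
  intros Ha H1 H2.
  set (p := fun n => if (0 <=? n)%Z then a n else 0).
  set (m := fun n => if (0 <=? n)%Z then 0 else a n).
  apply has_sum_ext with (fun n => p n + m n).
  { intro n. unfold p, m. destruct (0 <=? n)%Z; ring. }
  apply has_sum_plus.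
  - intro n. unfold p. destruct (0 <=? n)%Z; [apply Ha | lra].
  - intro n. unfold m. destruct (0 <=? n)%Z; [lra | apply Ha].
  - apply (has_sum_reindex Z.of_nat Z.to_nat).
    + intro n. lia.
    + intros n. unfold p. destruct (Z.leb_spec 0 n); [lia | easy].
    + apply has_sum_ext with (fun n => a (Z.of_nat n)).
      { intro n. unfold p. destruct (Z.leb_spec 0 (Z.of_nat n)); [easy | lia]. }
      now apply has_sum_nat.
  - apply (has_sum_reindex (fun n => (- Z.of_nat (S n))%Z) (fun z => Z.to_nat (- z - 1))).
    + intro n. lia.
    + intros n. unfold m. destruct (Z.leb_spec 0 n); [easy | lia].
    + apply has_sum_ext with (fun n => a (- Z.of_nat (S n))%Z).
      { intro n. unfold m. destruct (Z.leb_spec 0 (- Z.of_nat (S n))); [lia | easy]. }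
      now apply has_sum_nat.
Qed.


(** * The theta functions as power series and as lattice sums *)

Definition rphi (x : R) : R := Re (phi x).
Definition rpsi (x : R) : R := Re (psi x).

Lemma CSeries_ext (a b : nat -> C) : (forall n, a n = b n) -> CSeries a = CSeries b.
Proof.
  intro H. unfold CSeries. f_equal; apply Series_ext; intro n; now rewrite H.
Qed.

Lemma phi_halves (z : C) :
  phi z = (CSeries (fun n => z ^ (n * n)) + CSeries (fun n => z ^ (S n * S n)))%C.
Proof.
  unfold phi, CSeriesZ. f_equal; apply CSeries_ext; intro n; f_equal; lia.
Qed.

(** The bilateral series of [psi] runs over the triangular numbers
    [n (2 n - 1)], each taken once. *)
Lemma psi_exponent (z : C) (n : Z) :
  (z ^ Z.to_nat (n * (n + 1) / 2) * (z ^ 3) ^ Z.to_nat (n * (n - 1) / 2))%C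
  = (z ^ Z.to_nat (2 * n * n - n))%C.
Proof.
  rewrite <- Cpow_mult_r, <- Cpow_add_r. f_equal.
  destruct (Z.Even_or_Odd n) as [[k ->]|[k ->]].
  - replace (2 * k * (2 * k + 1))%Z with ((k * (2 * k + 1)) * 2)%Z by ring.
    replace (2 * k * (2 * k - 1))%Z with ((k * (2 * k - 1)) * 2)%Z by ring.
    rewrite !Z_div_mult by lia. nia.
  - replace ((2 * k + 1) * (2 * k + 1 + 1))%Z with (((2 * k + 1) * (k + 1)) * 2)%Z by ring.
    replace ((2 * k + 1) * (2 * k + 1 - 1))%Z with (((2 * k + 1) * k) * 2)%Z by ring.
    rewrite !Z_div_mult by lia. nia.
Qed.

Lemma psi_halves (z : C) :
  psi z = (CSeries (fun n => z ^ Z.to_nat (2 * Z.of_nat n * Z.of_nat n - Z.of_nat n))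
           + CSeries (fun n => z ^ Z.to_nat (2 * Z.of_nat (S n) * Z.of_nat (S n)
                                             + Z.of_nat (S n))))%C.
Proof.
  unfold psi, ramanujan_f, CSeriesZ. f_equal; apply CSeries_ext; intro n;
    rewrite psi_exponent; f_equal; lia.
Qed.

Lemma disc_series_phi : disc_series phi.
Proof.
  eapply disc_series_ext; [intros z _; symmetry; apply phi_halves|].
  apply disc_series_plus; apply disc_series_lacunary_CSeries; intro j; lia.
Qed.

Lemma psi_exponent_incr (j : nat) :
  (Z.to_nat (2 * Z.of_nat (S j) * Z.of_nat (S j) + Z.of_nat (S j))
   < Z.to_nat (2 * Z.of_nat (S (S j)) * Z.of_nat (S (S j)) + Z.of_nat (S (S j))))%nat.
Proof.
  rewrite !Nat2Z.inj_succ. pose proof (Nat2Z.is_nonneg j). apply Z2Nat.inj_lt; nia.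
Qed.

Lemma disc_series_psi : disc_series psi.
Proof.
  eapply disc_series_ext; [intros z _; symmetry; apply psi_halves|].
  apply disc_series_plus;
    apply (disc_series_lacunary_CSeries (fun n => Z.to_nat _)); intro j;
    [nia | apply psi_exponent_incr].
Qed.

Lemma disc_series_real (f : C -> C) (x : R) :
  disc_series f -> Rabs x < 1 -> f x = RtoC (Re (f x)).
Proof.
  intros [a Ha] Hx. now rewrite (coef_real a f Ha x Hx).
Qed.

Lemma phi_real (x : R) : Rabs x < 1 -> phi x = RtoC (rphi x).
Proof. apply disc_series_real, disc_series_phi. Qed.

Lemma psi_real (x : R) : Rabs x < 1 -> psi x = RtoC (rpsi x).
Proof. apply disc_series_real, disc_series_psi. Qed.

Lemma is_series_lacunary (e : nat -> nat) (x : R) :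
  (forall j, (e j < e (S j))%nat) -> Rabs x < 1 ->
  is_series (fun j => x ^ e j) (Re (CSeries (fun j => RtoC x ^ e j)%C)).
Proof.
  intros He Hx. rewrite <- Cmod_R in Hx.
  destruct (csum_lacunary e He _ Hx) as [H _].
  revert H. apply is_series_ext. intro n. now rewrite <- RtoC_pow.
Qed.

Lemma phi_series (x : R) : Rabs x < 1 ->
  exists l1 l2, rphi x = l1 + l2
    /\ is_series (fun n => x ^ Z.to_nat (Z.of_nat n * Z.of_nat n)) l1
    /\ is_series (fun n => x ^ Z.to_nat (- Z.of_nat (S n) * - Z.of_nat (S n))) l2.
Proof.
  intro Hx.
  exists (Re (CSeries (fun n => RtoC x ^ (n * n))%C)),
    (Re (CSeries (fun n => RtoC x ^ (S n * S n))%C)).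
  split; [unfold rphi; now rewrite phi_halves|]. split.
  - eapply is_series_ext; [|apply (is_series_lacunary (fun n => (n * n)%nat)); [|exact Hx]].
    + intro n. simpl. f_equal. lia.
    + intro j. lia.
  - eapply is_series_ext; [|apply (is_series_lacunary (fun n => (S n * S n)%nat)); [|exact Hx]].
    + intro n. cbv beta. f_equal. lia.
    + intro j. lia.
Qed.

Lemma phi_has_sum (t : R) : 0 < t < 1 -> has_sum (fun n => t ^ Z.to_nat (n * n)) (rphi t).
Proof.
  intro Ht. destruct (phi_series t) as [l1 [l2 [-> [H1 H2]]]].
  { rewrite Rabs_pos_eq; lra. }
  apply has_sum_Z; auto. intro n. apply pow_le. lra.
Qed.

Lemma psi_has_sum (t : R) :
  0 < t < 1 -> has_sum (fun n => t ^ Z.to_nat (2 * n * n - n)) (rpsi t).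
Proof.
  intro Ht. assert (Ha : Rabs t < 1) by (rewrite Rabs_pos_eq; lra).
  unfold rpsi. rewrite psi_halves, re_plus.
  apply (has_sum_Z (fun n => t ^ Z.to_nat (2 * n * n - n))).
  - intro n. apply pow_le. lra.
  - apply (is_series_lacunary (fun n => Z.to_nat (2 * Z.of_nat n * Z.of_nat n - Z.of_nat n)));
      [|assumption]. intro j. nia.
  - pose proof (is_series_lacunary (fun n => Z.to_nat (2 * Z.of_nat (S n) * Z.of_nat (S n)
                                                       + Z.of_nat (S n))) t) as H.
    apply is_series_ext with (2 := H psi_exponent_incr Ha).
    reflexivity.
Qed.

Definition zpow (t : R) (n : Z) : R := t ^ Z.to_nat n.

Lemma zpow_add (t : R) (m n : Z) :
  (0 <= m)%Z -> (0 <= n)%Z -> zpow t (m + n) = zpow t m * zpow t n.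
Proof. intros Hm Hn. unfold zpow. rewrite Z2Nat.inj_add by assumption. apply pow_add. Qed.

Lemma zpow_pow (t : R) (c : nat) (n : Z) :
  (0 <= n)%Z -> (t ^ c) ^ Z.to_nat n = zpow t (Z.of_nat c * n).
Proof.
  intro Hn. unfold zpow. rewrite <- pow_mult. f_equal. lia.
Qed.

Lemma pow_in_01 (t : R) (n : nat) : (0 < n)%nat -> 0 < t < 1 -> 0 < t ^ n < 1.
Proof.
  intros Hn Ht. split; [apply pow_lt; lra|]. apply pow_lt_1_compat; [lra | assumption].
Qed.

Section Lattice.

Variable t : R.
Hypothesis Ht : 0 < t < 1.

Lemma zpow_ge_0 (n : Z) : 0 <= zpow t n.
Proof. apply pow_le. lra. Qed.

Lemma ite_ge_0 (b : bool) (n : Z) : 0 <= (if b then zpow t n else 0).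
Proof. destruct b; [apply zpow_ge_0 | lra]. Qed.

(** ** One-dimensional sums over residue classes modulo 8 *)

(** Substituting [t ^ 8] or [t ^ 4] for the nome turns every product of two theta
    functions below into a sum of [t ^ (x ^ 2 + 15 y ^ 2)] over residue classes of
    [(x, y)] modulo 8.  Linear relations between such sums are then checked on the
    finitely many residues. *)

Definition line (c : nat) (P : Z -> bool) (x : Z) : R :=
  if P (x mod 8)%Z then zpow t (Z.of_nat c * (x * x)) else 0.

Lemma line_ge_0 (c : nat) (P : Z -> bool) (x : Z) : 0 <= line c P x.
Proof. apply ite_ge_0. Qed.

Definition residues : list Z := (0 :: 1 :: 2 :: 3 :: 4 :: 5 :: 6 :: 7 :: nil)%Z.

Lemma residues_in (x : Z) : In (x mod 8)%Z residues.
Proof.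
  pose proof (Z.mod_pos_bound x 8 eq_refl). simpl. lia.
Qed.

(** Pointwise form of a disjoint union of two residue sets. *)
Definition one_of_two (p q r : bool) : bool :=
  (Bool.eqb p (q || r) && negb (q && r))%bool.

Lemma one_of_two_sum (p q r : bool) (v : R) : one_of_two p q r = true ->
  (if q then v else 0) + (if r then v else 0) = (if p then v else 0).
Proof. destruct p, q, r; simpl; intro H; try discriminate; ring. Qed.

Lemma line_split (c : nat) (P Q N : Z -> bool) (b d : R) :
  forallb (fun x => one_of_two (P x) (Q x) (N x)) residues = true ->
  has_sum (line c Q) b -> has_sum (line c N) d -> has_sum (line c P) (b + d).
Proof.
  intros H Hb Hd. rewrite forallb_forall in H.
  apply has_sum_ext with (fun x => line c Q x + line c N x).
  - intro x. apply one_of_two_sum, H, residues_in.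
  - apply has_sum_plus; auto using line_ge_0.
Qed.

Lemma line_multiple (c : nat) (k : Z) (P : Z -> bool) :
  (0 < c)%nat -> (0 < k)%Z ->
  (forall x, P (x mod 8)%Z = (x mod k =? 0)%Z) ->
  has_sum (line c P) (rphi (t ^ (Z.to_nat (k * k) * c))).
Proof.
  intros Hc Hk HP.
  assert (Hq : 0 < t ^ (Z.to_nat (k * k) * c) < 1) by (apply pow_in_01; nia || assumption).
  apply (has_sum_reindex (fun a => k * a)%Z (fun x => x / k)%Z).
  - intro a. rewrite Z.mul_comm. apply Z_div_mult. lia.
  - intros x Hx. unfold line in Hx. rewrite HP in Hx.
    destruct (Z.eqb_spec (x mod k) 0) as [E|E]; [|easy].
    symmetry. apply Z_div_exact_2; lia.
  - apply has_sum_ext with (2 := phi_has_sum _ Hq). intro n.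
    unfold line. rewrite HP.
    replace ((k * n) mod k)%Z with 0%Z by (rewrite Z.mul_comm, Z_mod_mult; reflexivity). simpl.
    rewrite zpow_pow by nia. f_equal. rewrite Nat2Z.inj_mul, Z2Nat.id by nia. ring.
Qed.

(** Every odd number is [4 n - 1] or [1 - 4 n], and
    [(4 n - 1) ^ 2 = 8 (2 n ^ 2 - n) + 1]. *)
Lemma line_odd (c : nat) : (0 < c)%nat ->
  has_sum (line c Z.odd) (2 * t ^ c * rpsi (t ^ (8 * c))).
Proof.
  intro Hc.
  assert (Hq : 0 < t ^ (8 * c) < 1) by (apply pow_in_01; lia || assumption).
  assert (V : forall n, t ^ c * (t ^ (8 * c)) ^ Z.to_nat (2 * n * n - n)
                        = zpow t (Z.of_nat c * ((4 * n - 1) * (4 * n - 1)))).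
  { intro n. assert (N : (0 <= 2 * n * n - n)%Z) by nia. rewrite zpow_pow by assumption.
    replace (t ^ c) with (zpow t (Z.of_nat c)) by (unfold zpow; now rewrite Nat2Z.id).
    rewrite <- zpow_add by (try apply Z.mul_nonneg_nonneg; lia). f_equal. nia. }
  replace (2 * t ^ c * rpsi (t ^ (8 * c)))
    with (t ^ c * rpsi (t ^ (8 * c)) + t ^ c * rpsi (t ^ (8 * c))) by ring.
  assert (M : forall x, ((x mod 8) mod 4 = x mod 4)%Z).
  { intro x. Z.div_mod_to_equations. lia. }
  apply (line_split c Z.odd (fun x => x mod 4 =? 3)%Z (fun x => x mod 4 =? 1)%Z);
    [reflexivity | |].
  - apply (has_sum_reindex (fun n => 4 * n - 1)%Z (fun x => (x + 1) / 4)%Z).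
    + intro n. replace (4 * n - 1 + 1)%Z with (n * 4)%Z by ring. apply Z_div_mult. lia.
    + intros x Hx. unfold line in Hx. rewrite M in Hx.
      destruct (Z.eqb_spec (x mod 4) 3) as [E|E]; [|easy].
      pose proof (Z.div_mod x 4). pose proof (Z.div_mod (x + 1) 4).
      pose proof (Z.mod_pos_bound (x + 1) 4). lia.
    + apply has_sum_ext with (fun n => t ^ c * (t ^ (8 * c)) ^ Z.to_nat (2 * n * n - n)).
      * intro n. unfold line. rewrite M.
        replace ((4 * n - 1) mod 4)%Z with 3%Z; [apply V|].
        replace (4 * n - 1)%Z with (3 + (n - 1) * 4)%Z by ring. now rewrite Z_mod_plus.
      * apply has_sum_scal; [apply pow_lt; lra | now apply psi_has_sum].
  - apply (has_sum_reindex (fun n => 1 - 4 * n)%Z (fun x => (1 - x) / 4)%Z).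
    + intro n. replace (1 - (1 - 4 * n))%Z with (n * 4)%Z by ring. apply Z_div_mult. lia.
    + intros x Hx. unfold line in Hx. rewrite M in Hx.
      destruct (Z.eqb_spec (x mod 4) 1) as [E|E]; [|easy].
      pose proof (Z.div_mod x 4). pose proof (Z.div_mod (1 - x) 4).
      pose proof (Z.mod_pos_bound (1 - x) 4). lia.
    + apply has_sum_ext with (fun n => t ^ c * (t ^ (8 * c)) ^ Z.to_nat (2 * n * n - n)).
      * intro n. unfold line. rewrite M.
        replace ((1 - 4 * n) mod 4)%Z with 1%Z.
        -- change (1 =? 1)%Z with true. cbv iota. rewrite V. f_equal. ring.
        -- replace (1 - 4 * n)%Z with (1 + (- n) * 4)%Z by ring. now rewrite Z_mod_plus.
      * apply has_sum_scal; [apply pow_lt; lra | now apply psi_has_sum].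
Qed.

(** ** Two-dimensional sums over residue classes modulo 8 *)

Definition plane (D : nat) (P : Z -> Z -> bool) (p : Z * Z) : R :=
  if P (fst p mod 8)%Z (snd p mod 8)%Z
  then zpow t (fst p * fst p + Z.of_nat D * (snd p * snd p)) else 0.

Lemma plane_ge_0 (D : nat) (P : Z -> Z -> bool) (p : Z * Z) : 0 <= plane D P p.
Proof. apply ite_ge_0. Qed.

Lemma plane_prod (D : nat) (P Q : Z -> bool) (a b : R) :
  has_sum (line 1 P) a -> has_sum (line D Q) b ->
  has_sum (plane D (fun x y => P x && Q y)%bool) (a * b).
Proof.
  intros Ha Hb.
  apply has_sum_ext with (fun p => line 1 P (fst p) * line D Q (snd p)).
  - intros [x y]. unfold line, plane; cbn [fst snd].
    destruct (P _), (Q _); simpl andb; cbv iota; try ring.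
    rewrite <- zpow_add by nia. f_equal. lia.
  - apply has_sum_prod; auto using line_ge_0.
Qed.

Lemma plane_split (D : nat) (P Q N : Z -> Z -> bool) (b d : R) :
  forallb (fun x => forallb (fun y => one_of_two (P x y) (Q x y) (N x y)) residues)
    residues = true ->
  has_sum (plane D Q) b -> has_sum (plane D N) d -> has_sum (plane D P) (b + d).
Proof.
  intros H Hb Hd. rewrite forallb_forall in H.
  apply has_sum_ext with (fun p => plane D Q p + plane D N p).
  - intros [x y]. apply one_of_two_sum.
    specialize (H _ (residues_in x)). rewrite forallb_forall in H. apply H, residues_in.
  - apply has_sum_plus; auto using plane_ge_0.
Qed.

Lemma plane_exists (D : nat) (P : Z -> Z -> bool) :
  (0 < D)%nat -> exists l, has_sum (plane D P) l.
Proof.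
  intro HD.
  apply (has_sum_exists (plane D (fun _ _ => true))) with (rphi (t ^ (1 * 1)) * rphi (t ^ (1 * D))).
  - intros [x y]. split; [apply plane_ge_0|]. unfold plane. destruct (P _ _); [lra|].
    apply zpow_ge_0.
  - apply (plane_prod D (fun _ => true) (fun _ => true)).
    + apply (line_multiple 1 1); try lia. intro x. now rewrite Z.mod_1_r.
    + apply (line_multiple D 1); try lia. intro x. now rewrite Z.mod_1_r.
Qed.

Lemma plane_flip (D : nat) (P Q : Z -> Z -> bool) (l : R) :
  forallb (fun x => forallb (fun y => Bool.eqb (Q x y) (P ((8 - x) mod 8)%Z y)) residues)
    residues = true ->
  has_sum (plane D P) l -> has_sum (plane D Q) l.
Proof.
  intros H Hl.
  apply (has_sum_reindex (fun p => (- fst p, snd p)%Z) (fun p => (- fst p, snd p)%Z)).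
  - intros [x y]. simpl. now rewrite Z.opp_involutive.
  - intros [x y] _. simpl. now rewrite Z.opp_involutive.
  - apply has_sum_ext with (2 := Hl). intros [x y]. unfold plane. cbn [fst snd].
    rewrite forallb_forall in H. specialize (H _ (residues_in (- x)%Z)).
    rewrite forallb_forall in H. specialize (H _ (residues_in y)).
    apply Bool.eqb_prop in H.
    assert (E : ((8 - - x mod 8) mod 8 = x mod 8)%Z) by (Z.div_mod_to_equations; lia).
    rewrite E in H. rewrite H. destruct (P (x mod 8)%Z (y mod 8)%Z); [|reflexivity].
    f_equal. ring.
Qed.


(** The sum over a complement, which is how a theta function at a negative nome is
    reached with nonnegative terms only. *)
Lemma line_diff (c : nat) (P Q N : Z -> bool) (a b : R) :
  forallb (fun x => one_of_two (P x) (Q x) (N x)) residues = true ->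
  has_sum (line c P) a -> has_sum (line c Q) b -> has_sum (line c N) (a - b).
Proof.
  intros H Ha Hb.
  destruct (has_sum_exists (line c P) (line c N) a) as [d Hd]; [|assumption|].
  - intro x. split; [apply line_ge_0|]. pose proof H as H'. rewrite forallb_forall in H'.
    unfold line. rewrite <- (one_of_two_sum _ _ _ _ (H' _ (residues_in x))).
    pose proof (ite_ge_0 (Q (x mod 8)%Z) (Z.of_nat c * (x * x))). lra.
  - replace (a - b) with d; [assumption|].
    rewrite (has_sum_unique _ _ _ Ha (line_split c P Q N b d H Hb Hd)). ring.
Qed.

(** ** Lattice isometries *)

(** The pair [(x, y)] stands for [x + y sqrt(-15)], of norm [x ^ 2 + 15 y ^ 2].
    Multiplication by [(1 - sqrt(-15)) / 4], an element of norm 1, preserves that norm;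
    it does not preserve the lattice, but it sends the odd pairs with [x = y] modulo 8
    onto the even pairs with [x + y = 4] modulo 8.  Both theta identities below rest
    on this coincidence.  The proof parametrizes the two sets by the same pair
    [(m, k)], with [y = 2 m + 1] and [x = y + 8 k] on the first one. *)
Lemma plane_rotate (l : R) :
  has_sum (plane 15 (fun x y => Z.odd x && Z.odd y && (x =? y)%Z)%bool) l ->
  has_sum (plane 15 (fun x y => Z.even x && Z.even y && ((x + y) mod 8 =? 4)%Z)%bool) l.
Proof.
  intro H.
  apply (has_sum_reindex (fun p => (2 * fst p + 1 + 8 * snd p, 2 * fst p + 1)%Z)
           (fun p => ((snd p - 1) / 2, (fst p - snd p) / 8)%Z)) in H.
  2: { intros [m k]. cbn [fst snd]. f_equal; Z.div_mod_to_equations; lia. }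
  2: { intros [x y]. unfold plane. cbn [fst snd]. intro N.
       assert (C : ((x mod 8) mod 2 = 1 /\ x mod 8 = y mod 8)%Z).
       { destruct (Z.odd (x mod 8)) eqn:E; [|easy]. destruct (Z.odd (y mod 8)); [|easy].
         destruct (Z.eqb_spec (x mod 8) (y mod 8)); [|easy].
         now rewrite Zmod_odd, E. }
       f_equal; Z.div_mod_to_equations; lia. }
  apply (has_sum_reindex (fun p => (8 * fst p + 4 + 2 * snd p, - (2 * snd p))%Z)
           (fun p => ((fst p + snd p - 4) / 8, - snd p / 2)%Z)).
  { intros [m k]. cbn [fst snd]. f_equal; Z.div_mod_to_equations; lia. }
  { intros [x y]. unfold plane. cbn [fst snd]. intro N.
    assert (C : ((y mod 8) mod 2 = 0 /\ (x mod 8 + y mod 8) mod 8 = 4)%Z).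
    { destruct (Z.even (x mod 8)); [|easy]. destruct (Z.even (y mod 8)) eqn:E; [|easy].
      destruct (Z.eqb_spec ((x mod 8 + y mod 8) mod 8) 4); [|easy].
      now rewrite Zmod_even, E. }
    f_equal; Z.div_mod_to_equations; lia. }
  apply has_sum_ext with (2 := H). intros [m k]. unfold plane. cbn [fst snd].
  assert (E1 : ((2 * m + 1 + 8 * k) mod 8 = (2 * m + 1) mod 8)%Z)
    by (Z.div_mod_to_equations; lia).
  assert (E2 : Z.odd ((2 * m + 1) mod 8) = true).
  { rewrite Zodd_mod. apply Z.eqb_eq.
    Z.div_mod_to_equations; lia. }
  assert (E3 : Z.even ((8 * m + 4 + 2 * k) mod 8) = true).
  { rewrite Zeven_mod. apply Z.eqb_eq.
    Z.div_mod_to_equations; lia. }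
  assert (E4 : Z.even ((- (2 * k)) mod 8) = true).
  { rewrite Zeven_mod. apply Z.eqb_eq.
    Z.div_mod_to_equations; lia. }
  assert (E5 : (((8 * m + 4 + 2 * k) mod 8 + (- (2 * k)) mod 8) mod 8 = 4)%Z)
    by (Z.div_mod_to_equations; lia).
  rewrite E1, E2, E3, E4, E5, Z.eqb_refl. simpl andb. cbv iota. f_equal. ring.
Qed.

(** The form [3 m ^ 2 + 5 n ^ 2] lies in the same genus as [x ^ 2 + 15 y ^ 2]:
    [(3 m + 5 n) ^ 2 + 15 (m - n) ^ 2 = 8 (3 m ^ 2 + 5 n ^ 2)]. *)
Lemma plane_3_5 (N : Z -> bool) (l : R) :
  has_sum (fun p => if N ((fst p - snd p) mod 8)%Z
                    then zpow t (24 * (fst p * fst p) + 40 * (snd p * snd p)) else 0) l ->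
  has_sum (plane 15 (fun x y => ((x - 3 * y) mod 8 =? 0)%Z && N y)%bool) l.
Proof.
  intro H.
  apply (has_sum_reindex (fun p => (3 * fst p + 5 * snd p, fst p - snd p)%Z)
           (fun p => ((fst p + 5 * snd p) / 8, (fst p - 3 * snd p) / 8)%Z)).
  { intros [m n]. cbn [fst snd]. f_equal; Z.div_mod_to_equations; lia. }
  { intros [x y]. unfold plane. cbn [fst snd]. intro P.
    assert (C : ((x mod 8 - 3 * (y mod 8)) mod 8 = 0)%Z).
    { destruct (Z.eqb_spec ((x mod 8 - 3 * (y mod 8)) mod 8) 0); [assumption|easy]. }
    f_equal; Z.div_mod_to_equations; lia. }
  apply has_sum_ext with (2 := H). intros [m n]. unfold plane. cbn [fst snd].
  assert (E : (((3 * m + 5 * n) mod 8 - 3 * ((m - n) mod 8)) mod 8 = 0)%Z)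
    by (Z.div_mod_to_equations; lia).
  rewrite E, Z.eqb_refl. simpl andb. destruct (N _); [|reflexivity]. f_equal. ring.
Qed.

Lemma square_rotate (l : R) :
  has_sum (fun p => zpow t (2 * (fst p * fst p) + 2 * (snd p * snd p))) l ->
  has_sum (plane 1 (fun x y => (x - y) mod 2 =? 0)%Z) l.
Proof.
  intro H.
  apply (has_sum_reindex (fun p => (fst p + snd p, fst p - snd p)%Z)
           (fun p => ((fst p + snd p) / 2, (fst p - snd p) / 2)%Z)).
  { intros [m n]. cbn [fst snd]. f_equal; Z.div_mod_to_equations; lia. }
  { intros [x y]. unfold plane. cbn [fst snd]. intro P.
    assert (C : ((x mod 8 - y mod 8) mod 2 = 0)%Z).
    { destruct (Z.eqb_spec ((x mod 8 - y mod 8) mod 2) 0); [assumption|easy]. }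
    f_equal; Z.div_mod_to_equations; lia. }
  apply has_sum_ext with (2 := H). intros [m n]. unfold plane. cbn [fst snd].
  assert (E : (((m + n) mod 8 - (m - n) mod 8) mod 2 = 0)%Z)
    by (Z.div_mod_to_equations; lia).
  rewrite E, Z.eqb_refl. cbv iota. f_equal. ring.
Qed.

(** ** Dissection of one theta function *)

Lemma line_even (c : nat) : (0 < c)%nat -> has_sum (line c Z.even) (rphi (t ^ (4 * c))).
Proof.
  intro Hc. apply (line_multiple c 2); try lia. intro x. rewrite Zeven_mod.
  replace ((x mod 8) mod 2)%Z with (x mod 2)%Z by (Z.div_mod_to_equations; lia).
  reflexivity.
Qed.

Lemma line_all (c : nat) : (0 < c)%nat -> has_sum (line c (fun _ => true)) (rphi (t ^ c)).
Proof.
  intro Hc. replace c with (Z.to_nat (1 * 1) * c)%nat at 2 by lia.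
  apply line_multiple; try lia. intro x. now rewrite Z.mod_1_r.
Qed.

Lemma phi_dissect_pos (c : nat) : (0 < c)%nat ->
  rphi (t ^ c) = rphi (t ^ (4 * c)) + 2 * t ^ c * rpsi (t ^ (8 * c)).
Proof.
  intro Hc. apply (has_sum_unique _ _ _ (line_all c Hc)).
  apply (line_split c _ Z.even Z.odd); [reflexivity | now apply line_even | now apply line_odd].
Qed.

(** Changing the sign of the nome changes the sign of the odd terms: the sum of
    both theta functions is twice the even part. *)
Lemma phi_dissect_neg (c : nat) : (0 < c)%nat ->
  rphi (- t ^ c) = rphi (t ^ (4 * c)) - 2 * t ^ c * rpsi (t ^ (8 * c)).
Proof.
  intro Hc. pose proof (pow_in_01 t c Hc Ht) as Hq. set (q := t ^ c) in *.
  assert (S : rphi q + rphi (- q) = rphi (t ^ (4 * c)) + rphi (t ^ (4 * c))).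
  2: { pose proof (phi_dissect_pos c Hc) as D. fold q in D. lra. }
  destruct (phi_series q) as [l1 [l2 [E [H1 H2]]]]; [rewrite Rabs_pos_eq; lra|].
  destruct (phi_series (- q)) as [k1 [k2 [E' [K1 K2]]]]; [rewrite Rabs_Ropp, Rabs_pos_eq; lra|].
  assert (T : forall n, q ^ Z.to_nat (n * n) + (- q) ^ Z.to_nat (n * n)
                        = line c Z.even n + line c Z.even n).
  { intro n. replace (- q) with (-1 * q) by ring. rewrite Rpow_mult_distr.
    unfold line, q. rewrite !zpow_pow by nia.
    replace (Z.even (n mod 8)) with (Z.even n).
    2: { rewrite !Zeven_mod.
         replace ((n mod 8) mod 2)%Z with (n mod 2)%Z by (Z.div_mod_to_equations; lia).
         reflexivity. }
    destruct (Z.even n) eqn:P.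
    - apply Z.even_spec in P. destruct P as [k ->].
      replace (Z.to_nat (2 * k * (2 * k))) with (2 * Z.to_nat (2 * k * k))%nat by nia.
      rewrite pow_1_even. ring.
    - assert (O : Z.Odd n) by (apply Z.odd_spec; now rewrite <- Z.negb_even, P).
      destruct O as [k ->].
      replace (Z.to_nat ((2 * k + 1) * (2 * k + 1)))
        with (S (2 * Z.to_nat (2 * k * k + 2 * k)))%nat by nia.
      rewrite pow_1_odd. ring. }
  apply (has_sum_unique (fun n => line c Z.even n + line c Z.even n)).
  - apply has_sum_ext with (1 := T). rewrite E, E'.
    replace (l1 + l2 + (k1 + k2)) with ((l1 + k1) + (l2 + k2)) by ring.
    apply has_sum_Z.
    + intro n. rewrite T. pose proof (line_ge_0 c Z.even n). lra.
    + apply (is_series_plus (fun n => q ^ Z.to_nat (Z.of_nat n * Z.of_nat n))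
               (fun n => (- q) ^ Z.to_nat (Z.of_nat n * Z.of_nat n))); assumption.
    + apply (is_series_plus (fun n => q ^ Z.to_nat (- Z.of_nat (S n) * - Z.of_nat (S n)))
               (fun n => (- q) ^ Z.to_nat (- Z.of_nat (S n) * - Z.of_nat (S n)))); assumption.
  - apply has_sum_plus; auto using line_ge_0; now apply line_even.
Qed.

(** ** Bilinear theta identities *)

(** [m ^ 2 + n ^ 2] in the coordinates [m + n], [m - n], which are both even or both
    odd. *)
Lemma square_identity :
  rphi (t ^ 2) ^ 2 = rphi (t ^ 4) ^ 2 + 4 * t ^ 2 * rpsi (t ^ 8) ^ 2.
Proof.
  replace (4 * t ^ 2 * rpsi (t ^ 8) ^ 2)
    with ((2 * t ^ 1 * rpsi (t ^ (8 * 1))) * (2 * t ^ 1 * rpsi (t ^ (8 * 1))))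
    by (simpl; ring).
  replace (rphi (t ^ 4) ^ 2) with (rphi (t ^ (4 * 1)) * rphi (t ^ (4 * 1))) by (simpl; ring).
  apply (has_sum_unique (plane 1 (fun x y => (x - y) mod 2 =? 0)%Z)).
  - apply square_rotate.
    replace (rphi (t ^ 2) ^ 2) with (rphi (t ^ 2) * rphi (t ^ 2)) by (simpl; ring).
    eapply has_sum_ext; [|apply (has_sum_prod (line 2 (fun _ => true)) (line 2 (fun _ => true)));
      auto using line_ge_0; apply line_all; lia].
    intros [m n]. unfold line. cbn [fst snd]. rewrite zpow_add by nia. reflexivity.
  - apply (plane_split 1 _ (fun x y => Z.even x && Z.even y)%bool (fun x y => Z.odd x && Z.odd y)%bool);
      [reflexivity | |].
    + apply plane_prod; apply line_even; lia.
    + apply plane_prod; apply line_odd; lia.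
Qed.


Lemma parity_mod8 (x : Z) : Z.even (x mod 8) = Z.even x /\ Z.odd (x mod 8) = Z.odd x.
Proof.
  rewrite !Zeven_mod, !Zodd_mod.
  replace ((x mod 8) mod 2)%Z with (x mod 2)%Z by (Z.div_mod_to_equations; lia).
  now split.
Qed.

Section ThreeFive.

Let E3 := rphi (t ^ (4 * 24)).
Let O3 := 2 * t ^ 24 * rpsi (t ^ (8 * 24)).
Let E5 := rphi (t ^ (4 * 40)).
Let O5 := 2 * t ^ 40 * rpsi (t ^ (8 * 40)).

Lemma plane_3_5_even :
  has_sum (plane 15 (fun x y => ((x - 3 * y) mod 8 =? 0)%Z && Z.even y)%bool)
    (E3 * E5 + O3 * O5).
Proof.
  apply plane_3_5.
  apply has_sum_ext with (fun p => line 24 Z.even (fst p) * line 40 Z.even (snd p)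
                                   + line 24 Z.odd (fst p) * line 40 Z.odd (snd p)).
  - intros [m n]. unfold line. cbn [fst snd].
    rewrite !(proj1 (parity_mod8 _)), !(proj2 (parity_mod8 _)), Z.even_sub.
    rewrite <- !Z.negb_even. rewrite zpow_add by nia.
    change (Z.of_nat 24) with 24%Z. change (Z.of_nat 40) with 40%Z.
    destruct (Z.even m), (Z.even n); simpl negb; simpl Bool.eqb; cbv iota; ring.
  - apply has_sum_plus; try (intros [m n]; apply Rmult_le_pos; apply line_ge_0);
      apply has_sum_prod; auto using line_ge_0; first [apply line_even | apply line_odd]; lia.
Qed.

Lemma plane_3_5_odd :
  has_sum (plane 15 (fun x y => ((x - 3 * y) mod 8 =? 0)%Z && Z.odd y)%bool)
    (E3 * O5 + O3 * E5).
Proof.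
  apply plane_3_5.
  apply has_sum_ext with (fun p => line 24 Z.even (fst p) * line 40 Z.odd (snd p)
                                   + line 24 Z.odd (fst p) * line 40 Z.even (snd p)).
  - intros [m n]. unfold line. cbn [fst snd].
    rewrite !(proj1 (parity_mod8 _)), !(proj2 (parity_mod8 _)), Z.odd_sub.
    rewrite <- !Z.negb_even. rewrite zpow_add by nia.
    change (Z.of_nat 24) with 24%Z. change (Z.of_nat 40) with 40%Z.
    destruct (Z.even m), (Z.even n); simpl negb; simpl xorb; cbv iota; ring.
  - apply has_sum_plus; try (intros [m n]; apply Rmult_le_pos; apply line_ge_0);
      apply has_sum_prod; auto using line_ge_0; first [apply line_even | apply line_odd]; lia.
Qed.

Lemma phi_3_5_pos : rphi (t ^ 24) * rphi (t ^ 40) = (E3 * E5 + O3 * O5) + (E3 * O5 + O3 * E5).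
Proof.
  rewrite (phi_dissect_pos 24), (phi_dissect_pos 40) by lia. fold E3 O3 E5 O5. ring.
Qed.

Lemma phi_3_5_neg : rphi (- t ^ 24) * rphi (- t ^ 40) = (E3 * E5 + O3 * O5) - (E3 * O5 + O3 * E5).
Proof.
  rewrite (phi_dissect_neg 24), (phi_dissect_neg 40) by lia. fold E3 O3 E5 O5. ring.
Qed.

End ThreeFive.

(** An odd pair satisfies exactly one of [x = 3 y], [x = - 3 y], [x = y], [x = - y]
    modulo 8, and [x -> - x] exchanges the classes two by two. *)
Lemma plane_odd_classes (a k : R) :
  has_sum (plane 15 (fun x y => ((x - 3 * y) mod 8 =? 0)%Z && Z.odd y)%bool) a ->
  has_sum (plane 15 (fun x y => Z.odd x && Z.odd y && (x =? y)%Z)%bool) k ->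
  4 * t ^ 16 * rpsi (t ^ 8) * rpsi (t ^ 120) = 2 * a + 2 * k.
Proof.
  intros Ha Hk.
  replace (4 * t ^ 16 * rpsi (t ^ 8) * rpsi (t ^ 120))
    with ((2 * t ^ 1 * rpsi (t ^ (8 * 1))) * (2 * t ^ 15 * rpsi (t ^ (8 * 15)))).
  2: { change (8 * 1)%nat with 8%nat. change (8 * 15)%nat with 120%nat. ring. }
  apply (has_sum_unique (plane 15 (fun x y => Z.odd x && Z.odd y)%bool)).
  { apply plane_prod; apply line_odd; lia. }
  replace (2 * a + 2 * k) with ((a + a) + (k + k)) by ring.
  apply (plane_split 15 _
    (fun x y => Z.odd x && Z.odd y
                && (((x - 3 * y) mod 8 =? 0)%Z || ((x + 3 * y) mod 8 =? 0)%Z))%bool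
    (fun x y => Z.odd x && Z.odd y && ((x =? y)%Z || ((x + y) mod 8 =? 0)%Z))%bool);
    [reflexivity | |].
  - apply (plane_split 15 _
      (fun x y => ((x - 3 * y) mod 8 =? 0)%Z && Z.odd y)%bool
      (fun x y => ((x + 3 * y) mod 8 =? 0)%Z && Z.odd y)%bool); [reflexivity | assumption |].
    apply plane_flip with (2 := Ha). reflexivity.
  - apply (plane_split 15 _
      (fun x y => Z.odd x && Z.odd y && (x =? y)%Z)%bool
      (fun x y => Z.odd x && Z.odd y && ((x + y) mod 8 =? 0)%Z)%bool);
      [reflexivity | assumption |].
    apply plane_flip with (2 := Hk). reflexivity.
Qed.

Lemma line_multiple_4 (c : nat) :
  (0 < c)%nat -> has_sum (line c (fun x => x mod 4 =? 0)%Z) (rphi (t ^ (16 * c))).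
Proof.
  intro Hc. apply (line_multiple c 4); try lia. intro x. f_equal.
  Z.div_mod_to_equations; lia.
Qed.

Lemma line_multiple_8 (c : nat) :
  (0 < c)%nat -> has_sum (line c (fun x => x =? 0)%Z) (rphi (t ^ (64 * c))).
Proof. intro Hc. now apply (line_multiple c 8). Qed.

(** With [q = t ^ 8]:
    [phi(q^3) phi(q^5) = 2 q^2 psi(q) psi(q^15) + phi(-q^2) phi(-q^30)].
    The left side is the sum over [x = 3 y] modulo 8.  The odd part of that class
    occurs on both sides; the rotation turns the other odd pairs into even ones. *)
Lemma lattice_identity_3_5 :
  rphi (t ^ 24) * rphi (t ^ 40)
  = 2 * t ^ 16 * rpsi (t ^ 8) * rpsi (t ^ 120) + rphi (- t ^ 16) * rphi (- t ^ 240).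
Proof.
  assert (C : forall c, (0 < c)%nat -> exists E O,
    rphi (- t ^ (16 * c)) = E - O
    /\ has_sum (line c (fun x => x =? 0)%Z) E
    /\ has_sum (line c (fun x => x =? 4)%Z) O).
  { intros c Hc. exists (rphi (t ^ (64 * c))), (rphi (t ^ (16 * c)) - rphi (t ^ (64 * c))).
    split; [|split].
    - rewrite phi_dissect_neg, (phi_dissect_pos (16 * c)) by lia.
      replace (4 * (16 * c))%nat with (64 * c)%nat by lia. ring.
    - now apply line_multiple_8.
    - apply (line_diff c (fun x => x mod 4 =? 0)%Z (fun x => x =? 0)%Z);
        [reflexivity | now apply line_multiple_4 | now apply line_multiple_8]. }
  destruct (C 1%nat) as [E [O [EO [HE HO]]]]; [lia|].
  destruct (C 15%nat) as [E' [O' [EO' [HE' HO']]]]; [lia|]. clear C.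
  change (16 * 1)%nat with 16%nat in EO. change (16 * 15)%nat with 240%nat in EO'.
  rewrite EO, EO', phi_3_5_pos. clear EO EO'.
  pose proof plane_3_5_even as He. pose proof plane_3_5_odd as Ho.
  set (e := _ + _) in He |- *. set (o := _ + _) in Ho |- *. clearbody e o.
  destruct (plane_exists 15 (fun x y => Z.odd x && Z.odd y && (x =? y)%Z)%bool) as [k Hk]; [lia|].
  pose proof (plane_odd_classes o k Ho Hk) as HU.
  destruct (plane_exists 15 (fun x y => (x mod 4 =? 2)%Z && ((x - 3 * y) mod 8 =? 0)%Z)%bool)
    as [a Ha]; [lia|].
  assert (H1 : e = a + (E * E' + O * O')).
  { apply (has_sum_unique _ _ _ He).
    apply (plane_split 15 _
      (fun x y => (x mod 4 =? 2)%Z && ((x - 3 * y) mod 8 =? 0)%Z)%bool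
      (fun x y => (x mod 4 =? 0)%Z && (x =? y)%Z)%bool); [reflexivity | assumption |].
    apply (plane_split 15 _ (fun x y => (x =? 0)%Z && (y =? 0)%Z)%bool
                            (fun x y => (x =? 4)%Z && (y =? 4)%Z)%bool);
      [reflexivity | |]; now apply plane_prod. }
  assert (H2 : k = a + (E * O' + O * E')).
  { apply (has_sum_unique _ _ _ (plane_rotate k Hk)).
    apply (plane_split 15 _
      (fun x y => (x mod 4 =? 2)%Z && ((x + 3 * y) mod 8 =? 0)%Z)%bool
      (fun x y => ((x =? 0)%Z && (y =? 4)%Z) || ((x =? 4)%Z && (y =? 0)%Z))%bool);
      [reflexivity | |].
    - apply plane_flip with (2 := Ha). reflexivity.
    - apply (plane_split 15 _ (fun x y => (x =? 0)%Z && (y =? 4)%Z)%bool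
                              (fun x y => (x =? 4)%Z && (y =? 0)%Z)%bool);
      [reflexivity | |]; now apply plane_prod. }
  nra.
Qed.

(** With [q = t ^ 4]:
    [phi(q) phi(q^15) + phi(-q) phi(-q^15)
     = 4 q^4 psi(q^2) psi(q^30) + 2 phi(-q^6) phi(-q^10)].
    On the left side the even pairs with [x = y] modulo 4 remain, twice; they split
    into the even part of the class [x = 3 y] modulo 8 and the rotated set. *)
Lemma lattice_identity_1_15 :
  rphi (t ^ 4) * rphi (t ^ 60) + rphi (- t ^ 4) * rphi (- t ^ 60)
  = 4 * t ^ 16 * rpsi (t ^ 8) * rpsi (t ^ 120) + 2 * rphi (- t ^ 24) * rphi (- t ^ 40).
Proof.
  assert (C : forall c, (0 < c)%nat -> exists E O,
    rphi (t ^ (4 * c)) = E + O /\ rphi (- t ^ (4 * c)) = E - O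
    /\ has_sum (line c (fun x => x mod 4 =? 0)%Z) E
    /\ has_sum (line c (fun x => x mod 4 =? 2)%Z) O).
  { intros c Hc. exists (rphi (t ^ (16 * c))), (rphi (t ^ (4 * c)) - rphi (t ^ (16 * c))).
    split; [ring|]. split; [|split].
    - rewrite phi_dissect_neg, (phi_dissect_pos (4 * c)) by lia.
      replace (4 * (4 * c))%nat with (16 * c)%nat by lia. ring.
    - now apply line_multiple_4.
    - apply (line_diff c Z.even (fun x => x mod 4 =? 0)%Z);
        [reflexivity | now apply line_even | now apply line_multiple_4]. }
  destruct (C 1%nat) as [E [O [EOp [EO [HE HO]]]]]; [lia|].
  destruct (C 15%nat) as [E' [O' [EOp' [EO' [HE' HO']]]]]; [lia|]. clear C.
  change (4 * 1)%nat with 4%nat in EO, EOp. change (4 * 15)%nat with 60%nat in EO', EOp'.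
  rewrite EO, EO', EOp, EOp', Rmult_assoc with (r1 := 2), phi_3_5_neg. clear EO EO' EOp EOp'.
  pose proof plane_3_5_even as He. pose proof plane_3_5_odd as Ho.
  set (e := _ + _) in He |- *. set (o := _ + _) in Ho |- *. clearbody e o.
  destruct (plane_exists 15 (fun x y => Z.odd x && Z.odd y && (x =? y)%Z)%bool) as [k Hk]; [lia|].
  rewrite (plane_odd_classes o k Ho Hk).
  assert (H : E * E' + O * O' = e + k).
  { apply (has_sum_unique (plane 15 (fun x y => Z.even x && Z.even y
                                     && ((x - y) mod 4 =? 0)%Z)%bool)).
    - apply (plane_split 15 _ (fun x y => (x mod 4 =? 0)%Z && (y mod 4 =? 0)%Z)%bool
                              (fun x y => (x mod 4 =? 2)%Z && (y mod 4 =? 2)%Z)%bool);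
        [reflexivity | |]; apply (plane_prod 15 (fun x => x mod 4 =? _)%Z (fun x => x mod 4 =? _)%Z);
        assumption.
    - apply (plane_split 15 _ (fun x y => ((x - 3 * y) mod 8 =? 0)%Z && Z.even y)%bool
        (fun x y => Z.even x && Z.even y && ((x + y) mod 8 =? 4)%Z)%bool);
        [reflexivity | assumption | now apply plane_rotate]. }
  lra.
Qed.

End Lattice.


(** * Theta function identities in the nome *)

Lemma root_01 (n : nat) (q : R) : (0 < n)%nat -> 0 < q < 1 -> exists t, 0 < t < 1 /\ t ^ n = q.
Proof.
  intros Hn Hq. exists (Rpower q (/ INR n)).
  assert (Hn' : 0 < INR n) by now apply lt_0_INR.
  assert (E : Rpower q (/ INR n) ^ n = q).
  { rewrite <- Rpower_pow by apply exp_pos. rewrite Rpower_mult, Rinv_l, Rpower_1; lra. }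
  split; [split|exact E]; [apply exp_pos|].
  apply Rnot_le_lt. intro H.
  pose proof (pow_R1_Rle _ n H). lra.
Qed.

Section RealIdentities.

Variable q : R.
Hypothesis Hq : 0 < q < 1.

Lemma phi_split_pos : rphi q = rphi (q ^ 4) + 2 * q * rpsi (q ^ 8).
Proof.
  pose proof (phi_dissect_pos q Hq 1 Nat.lt_0_1) as H.
  rewrite pow_1 in H. exact H.
Qed.

Lemma phi_split_neg : rphi (- q) = rphi (q ^ 4) - 2 * q * rpsi (q ^ 8).
Proof.
  pose proof (phi_dissect_neg q Hq 1 Nat.lt_0_1) as H.
  rewrite pow_1 in H. exact H.
Qed.

Lemma phi_square : rphi q ^ 2 = rphi (q ^ 2) ^ 2 + 4 * q * rpsi (q ^ 4) ^ 2.
Proof.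
  destruct (root_01 2 q ltac:(lia) Hq) as [t [Ht E]].
  pose proof (square_identity t Ht) as H.
  rewrite <- E, <- !pow_mult. exact H.
Qed.

Lemma phi_3_5_identity :
  rphi (q ^ 3) * rphi (q ^ 5)
  = 2 * q ^ 2 * rpsi q * rpsi (q ^ 15) + rphi (- q ^ 2) * rphi (- q ^ 30).
Proof.
  destruct (root_01 8 q ltac:(lia) Hq) as [t [Ht E]].
  pose proof (lattice_identity_3_5 t Ht) as H.
  rewrite <- E, <- !pow_mult. exact H.
Qed.

Lemma phi_1_15_identity :
  rphi q * rphi (q ^ 15) + rphi (- q) * rphi (- q ^ 15)
  = 4 * q ^ 4 * rpsi (q ^ 2) * rpsi (q ^ 30) + 2 * rphi (- q ^ 6) * rphi (- q ^ 10).
Proof.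
  destruct (root_01 4 q ltac:(lia) Hq) as [t [Ht E]].
  pose proof (lattice_identity_1_15 t Ht) as H.
  rewrite <- E, <- !pow_mult. exact H.
Qed.

End RealIdentities.

(** Compare the dissection of [phi r], squared, with the formula for [phi r ^ 2],
    where [q = r ^ 4]: the cross terms must agree. *)
Lemma psi_square (q : R) : 0 < q < 1 -> rpsi q ^ 2 = rphi q * rpsi (q ^ 2).
Proof.
  intro Hq. destruct (root_01 4 q ltac:(lia) Hq) as [r [Hr E]].
  pose proof (phi_square r Hr) as H1.
  pose proof (phi_square (r ^ 2) (pow_in_01 r 2 ltac:(lia) Hr)) as H2.
  pose proof (phi_split_pos r Hr) as H3.
  rewrite <- !pow_mult in H2. simpl Nat.mul in H2.
  rewrite <- E, <- !pow_mult. simpl Nat.mul.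
  rewrite H3, H2 in H1.
  assert (H : 4 * r * (rpsi (r ^ 4) ^ 2 - rphi (r ^ 4) * rpsi (r ^ 8)) = 0).
  { replace (4 * r * (rpsi (r ^ 4) ^ 2 - rphi (r ^ 4) * rpsi (r ^ 8)))
      with ((rphi (r ^ 4) ^ 2 + 4 * r ^ 2 * rpsi (r ^ 8) ^ 2 + 4 * r * rpsi (r ^ 4) ^ 2)
            - (rphi (r ^ 4) + 2 * r * rpsi (r ^ 8)) ^ 2) by ring.
    rewrite H1. ring. }
  apply Rmult_integral in H. destruct H; lra.
Qed.

Lemma phi_mul_neg (q : R) : 0 < q < 1 -> rphi q * rphi (- q) = rphi (- q ^ 2) ^ 2.
Proof.
  intro Hq.
  pose proof (pow_in_01 q 2 ltac:(lia) Hq) as Hq2.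
  pose proof (pow_in_01 q 4 ltac:(lia) Hq) as Hq4.
  pose proof (pow_in_01 q 8 ltac:(lia) Hq) as Hq8.
  rewrite (phi_split_pos q Hq), (phi_split_neg q Hq), (phi_split_neg _ Hq2).
  pose proof (phi_square _ Hq4) as H1. pose proof (psi_square _ Hq8) as H2.
  rewrite <- !pow_mult in *. simpl Nat.mul in *.
  replace ((rphi (q ^ 4) + 2 * q * rpsi (q ^ 8)) * (rphi (q ^ 4) - 2 * q * rpsi (q ^ 8)))
    with (rphi (q ^ 4) ^ 2 - 4 * q ^ 2 * rpsi (q ^ 8) ^ 2) by ring.
  rewrite H1, H2. ring.
Qed.

Lemma phi_square_sum (q : R) : 0 < q < 1 -> rphi q ^ 2 + rphi (- q) ^ 2 = 2 * rphi (q ^ 2) ^ 2.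
Proof.
  intro Hq. rewrite (phi_split_pos q Hq), (phi_split_neg q Hq).
  pose proof (phi_square _ (pow_in_01 q 2 ltac:(lia) Hq)) as H.
  rewrite <- !pow_mult in H. simpl Nat.mul in H. rewrite H. ring.
Qed.

Lemma phi_square_diff (q : R) :
  0 < q < 1 -> rphi q ^ 2 - rphi (- q) ^ 2 = 8 * q * rpsi (q ^ 4) ^ 2.
Proof.
  intro Hq. pose proof (phi_square_sum q Hq). pose proof (phi_square q Hq). lra.
Qed.

Lemma phi_fourth_diff (q : R) :
  0 < q < 1 -> rphi q ^ 4 - rphi (- q) ^ 4 = 16 * q * rpsi (q ^ 2) ^ 4.
Proof.
  intro Hq. pose proof (phi_square_sum q Hq) as H1. pose proof (phi_square_diff q Hq) as H2.
  pose proof (psi_square _ (pow_in_01 q 2 ltac:(lia) Hq)) as H3.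
  rewrite <- !pow_mult in H3. simpl Nat.mul in H3.
  replace (rphi q ^ 4 - rphi (- q) ^ 4)
    with ((rphi q ^ 2 + rphi (- q) ^ 2) * (rphi q ^ 2 - rphi (- q) ^ 2)) by ring.
  rewrite H1, H2.
  replace (rpsi (q ^ 2) ^ 4) with ((rpsi (q ^ 2) ^ 2) ^ 2) by ring.
  rewrite H3. ring.
Qed.

(** ** Extension to the complex disc *)

Lemma disc_series_phi_neg : disc_series (fun z => phi (- z)%C).
Proof. apply disc_series_comp_opp, disc_series_phi. Qed.

Ltac disc :=
  lazymatch goal with
  | |- disc_series (fun z => Cminus (@?f z) (@?g z)) => apply (disc_series_minus f g); disc
  | |- disc_series (fun z => Cplus (@?f z) (@?g z)) => apply (disc_series_plus f g); disc
  | |- disc_series (fun z => Cmult (@?f z) (@?g z)) => apply (disc_series_mult f g); disc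
  | |- disc_series (fun z => phi z) => apply disc_series_phi
  | |- disc_series (fun z => psi z) => apply disc_series_psi
  | |- disc_series (fun z => phi (Copp z)) => apply disc_series_phi_neg
  | |- disc_series (fun z => phi (Cpow z ?k)) => apply (disc_series_comp_pow phi k); [lia | disc]
  | |- disc_series (fun z => psi (Cpow z ?k)) => apply (disc_series_comp_pow psi k); [lia | disc]
  | |- disc_series (fun z => phi (Copp (Cpow z ?k))) =>
      apply (disc_series_comp_pow (fun w => phi (Copp w)) k); [lia | disc]
  | |- disc_series (fun z => Cpow (@?f z) ?n) => apply (disc_series_pow f n); disc
  | |- disc_series (fun z => RtoC ?c) => apply (disc_series_const c)
  | |- disc_series phi => apply disc_series_phi
  | |- disc_series psi => apply disc_series_psi
  | |- disc_series (fun z => z) => apply disc_series_id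
  end.

Lemma Rabs_pos_lt_1 (x : R) : 0 < x < 1 -> Rabs x < 1.
Proof. intro H. rewrite Rabs_pos_eq; lra. Qed.

Lemma Rabs_neg_lt_1 (x : R) : 0 < x < 1 -> Rabs (- x) < 1.
Proof. intro H. rewrite Rabs_Ropp. now apply Rabs_pos_lt_1. Qed.

Ltac in_01 H := first [exact H | apply pow_in_01; [lia | exact H]].

Ltac real_theta H :=
  rewrite <- ?RtoC_pow, <- ?RtoC_opp;
  rewrite ?phi_real, ?psi_real
    by first [apply Rabs_pos_lt_1; in_01 H | apply Rabs_neg_lt_1; in_01 H].

Lemma phi_mul_neg_C (z : C) : Cmod z < 1 -> (phi z * phi (- z) = phi (- z ^ 2) ^ 2)%C.
Proof.
  intro Hz. apply Ceq_minus. revert z Hz.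
  refine (disc_series_identity (fun z => phi z * phi (- z) - phi (- z ^ 2) ^ 2)%C _ _); [disc|].
  intros x Hx. real_theta Hx.
  rewrite <- RtoC_mult, <- RtoC_pow, <- RtoC_minus, (phi_mul_neg x Hx). f_equal. ring.
Qed.

Lemma psi_square_C (z : C) : Cmod z < 1 -> (psi z ^ 2 = phi z * psi (z ^ 2))%C.
Proof.
  intro Hz. apply Ceq_minus. revert z Hz.
  refine (disc_series_identity (fun z => psi z ^ 2 - phi z * psi (z ^ 2))%C _ _); [disc|].
  intros x Hx. real_theta Hx.
  rewrite <- RtoC_mult, <- RtoC_pow, <- RtoC_minus, (psi_square x Hx). f_equal. ring.
Qed.

Lemma phi_3_5_identity_C (z : C) : Cmod z < 1 ->
  (phi (z ^ 3) * phi (z ^ 5)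
   = RtoC 2 * z ^ 2 * psi z * psi (z ^ 15) + phi (- z ^ 2) * phi (- z ^ 30))%C.
Proof.
  intro Hz. apply Ceq_minus. revert z Hz.
  refine (disc_series_identity (fun z => phi (z ^ 3) * phi (z ^ 5)
   - (RtoC 2 * z ^ 2 * psi z * psi (z ^ 15) + phi (- z ^ 2) * phi (- z ^ 30)))%C _ _); [disc|].
  intros x Hx. real_theta Hx.
  rewrite <- !RtoC_mult, <- RtoC_plus, <- RtoC_minus, (phi_3_5_identity x Hx). f_equal. ring.
Qed.

(** ** Nonvanishing and positivity *)

(** For [|z| < 1/3] the terms after the leading 1 are dominated by a geometric
    series of sum less than 1. *)
Lemma Re_phi_pos (z : C) : Cmod z < 1 / 3 -> 0 < Re (phi z).
Proof.
  intro Hz. pose proof (Cmod_ge_0 z) as H0.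
  rewrite phi_halves, re_plus.
  assert (D : forall e : nat -> nat, (forall j, (e j < e (S j))%nat) -> (1 <= e 0)%nat ->
     Rabs (Re (CSeries (fun n => z ^ e n)%C)) <= Cmod z / (1 - Cmod z)).
  { intros e He He0. unfold CSeries. cbn [Re fst].
    assert (G : is_series (fun n => Cmod z * Cmod z ^ n) (Cmod z * / (1 - Cmod z))).
    { apply (is_series_scal (Cmod z) (fun n => Cmod z ^ n)), is_series_geom.
      rewrite Rabs_pos_eq; lra. }
    assert (T : forall n, 0 <= Rabs (Re (z ^ e n)%C) <= Cmod z * Cmod z ^ n).
    { intro n. split; [apply Rabs_pos|]. apply Rle_trans with (1 := Re_le_Cmod _).
      rewrite Cmod_pow. change (Cmod z * Cmod z ^ n) with (Cmod z ^ S n).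
      assert (L : (S n <= e n)%nat).
      { induction n as [|n IH]; [assumption|]. specialize (He n). lia. }
      replace (e n) with (S n + (e n - S n))%nat by lia.
      rewrite pow_add. rewrite <- (Rmult_1_r (Cmod z ^ S n)) at 2.
      apply Rmult_le_compat_l; [now apply pow_le|].
      rewrite <- (pow1 (e n - S n)). apply pow_incr. lra. }
    unfold Rdiv. rewrite <- (is_series_unique _ _ G).
    apply Rle_trans with (Series (fun n => Rabs (Re (z ^ e n)%C))).
    - apply Series_Rabs. apply (ex_series_le (fun n => Rabs (Re (z ^ e n)%C))
        (fun n => Cmod z * Cmod z ^ n)); [|eexists; exact G].
      intro n. unfold norm; simpl; unfold abs; simpl. rewrite Rabs_Rabsolu. apply T.
    - apply Series_le; [exact T | eexists; exact G]. }
  assert (B : Cmod z / (1 - Cmod z) < 1 / 2).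
  { apply Rlt_div_l; lra. }
  pose proof (D (fun n => S n * S n)%nat ltac:(intro; cbv beta; lia) ltac:(cbv beta; lia)) as D2.
  assert (E : Re (CSeries (fun n => z ^ (n * n))%C)
              = 1 + Re (CSeries (fun n => z ^ (S n * S n))%C)).
  { unfold CSeries. cbn [Re fst]. rewrite Series_incr_1.
    - simpl. reflexivity.
    - destruct (csum_lacunary (fun n => (n * n)%nat) ltac:(intro; cbv beta; lia) z ltac:(lra)) as [H _].
      eexists; exact H. }
  rewrite E. pose proof (Rle_abs (- Re (CSeries (fun n => z ^ (S n * S n))%C))) as A.
  rewrite Rabs_Ropp in A. lra.
Qed.

(** By [phi z * phi (- z) = phi (- z ^ 2) ^ 2] a zero at [z] is followed by a zero at
    [- z ^ 2], hence by zeros that tend to 0, where [phi] is close to 1. *)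
Lemma phi_nonzero (z : C) : Cmod z < 1 -> phi z <> 0.
Proof.
  intros Hz E.
  assert (T : forall n, exists w, Cmod w = Cmod z ^ (2 ^ n) /\ phi w = 0).
  { induction n as [|n [w [Hw Ew]]].
    - exists z. simpl. split; [ring | assumption].
    - assert (Hw1 : Cmod w < 1).
      { rewrite Hw. apply pow_lt_1_compat; [split; [apply Cmod_ge_0 | assumption]|].
        apply Nat.neq_0_lt_0, Nat.pow_nonzero. lia. }
      exists (- w ^ 2)%C. split.
      + rewrite Cmod_opp, Cmod_pow, Hw, <- pow_mult. f_equal. simpl. lia.
      + pose proof (phi_mul_neg_C w Hw1) as H. rewrite Ew, Cmult_0_l in H.
        destruct (Ceq_dec (phi (- w ^ 2)%C) 0) as [Y|N]; [assumption|].
        exfalso. apply (Cpow_nz _ 2 N). now rewrite <- H. }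
  destruct (pow_lt_1_zero (Cmod z)) with (y := 1 / 3) as [N HN].
  { rewrite Rabs_pos_eq; [assumption | apply Cmod_ge_0]. }
  { lra. }
  destruct (T N) as [w [Hw Ew]].
  assert (P : 0 < Re (phi w)).
  { apply Re_phi_pos. rewrite Hw. specialize (HN (2 ^ N)%nat).
    rewrite Rabs_pos_eq in HN by apply pow_le, Cmod_ge_0. apply HN.
    apply Nat.lt_le_incl, Nat.pow_gt_lin_r. lia. }
  rewrite Ew in P. simpl in P. lra.
Qed.

Lemma rphi_ge_1 (q : R) : 0 < q < 1 -> 1 <= rphi q.
Proof.
  intro Hq. pose proof (has_sum_bound _ _ (0%Z :: nil) (phi_has_sum q Hq)) as H.
  simpl in H. specialize (H ltac:(repeat constructor; easy)). lra.
Qed.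

Lemma rpsi_ge_1 (q : R) : 0 < q < 1 -> 1 <= rpsi q.
Proof.
  intro Hq. pose proof (has_sum_bound _ _ (0%Z :: nil) (psi_has_sum q Hq)) as H.
  simpl in H. specialize (H ltac:(repeat constructor; easy)). lra.
Qed.

Lemma rphi_neg_pos (q : R) : 0 < q < 1 -> 0 < rphi (- q).
Proof.
  intro Hq. pose proof (rphi_ge_1 q Hq) as H1. pose proof (phi_mul_neg q Hq) as H.
  pose proof (pow_in_01 q 2 ltac:(lia) Hq) as Hq2.
  assert (N : rphi (- q ^ 2) <> 0).
  { intro E. apply (phi_nonzero (RtoC (- q ^ 2))).
    - rewrite Cmod_R. now apply Rabs_neg_lt_1.
    - rewrite phi_real by now apply Rabs_neg_lt_1. now rewrite E. }
  pose proof (pow2_gt_0 _ N). apply Rmult_lt_reg_l with (rphi q); lra.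
Qed.

(** ** Regularity on the real interval *)

Lemma disc_series_real_PSeries (f : C -> C) : disc_series f ->
  exists a, Rbar_le 1 (CV_radius a) /\ forall x, Rabs x < 1 -> Re (f x) = PSeries a x.
Proof.
  intros [a Ha]. exists a. split; [now apply (coef_radius a f)|].
  intros x Hx. now rewrite (coef_real a f Ha x Hx).
Qed.

Lemma disc_series_ex_derive (f : C -> C) (x : R) : disc_series f -> Rabs x < 1 ->
  ex_derive (fun y : R => Re (f y)) x.
Proof.
  intros Hf Hx. destruct (disc_series_real_PSeries f Hf) as [a [Hr Ha]].
  apply (ex_derive_ext_loc (PSeries a)).
  - apply locally_disc; [assumption|]. intros y Hy. symmetry. now apply Ha.
  - apply ex_derive_PSeries. apply Rbar_lt_le_trans with 1; assumption.
Qed.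

Lemma ex_derive_rphi (x : R) : Rabs x < 1 -> ex_derive rphi x.
Proof. apply (disc_series_ex_derive phi), disc_series_phi. Qed.

Lemma ex_derive_rpsi (x : R) : Rabs x < 1 -> ex_derive rpsi x.
Proof. apply (disc_series_ex_derive psi), disc_series_psi. Qed.

Lemma ex_derive_continuity_pt (f : R -> R) (x : R) : ex_derive f x -> continuity_pt f x.
Proof. intro H. apply continuity_pt_filterlim, (ex_derive_continuous f x H). Qed.

Lemma rpsi_0 : rpsi 0 = 1.
Proof.
  assert (H : Rabs 0 < 1) by (rewrite Rabs_R0; lra).
  unfold rpsi. rewrite psi_halves, re_plus.
  pose proof (is_series_lacunary
    (fun n => Z.to_nat (2 * Z.of_nat n * Z.of_nat n - Z.of_nat n)) 0 ltac:(intro; cbv beta; nia) H) as H1.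
  pose proof (is_series_lacunary
    (fun n => Z.to_nat (2 * Z.of_nat (S n) * Z.of_nat (S n) + Z.of_nat (S n))) 0
    psi_exponent_incr H) as H2.
  rewrite <- (is_series_unique _ _ H1), <- (is_series_unique _ _ H2).
  rewrite (is_series_unique _ 1), (is_series_unique _ 0); [ring| |].
  - apply is_series_head; [intro n|]; apply pow_i; lia.
  - apply is_series_head; [intro n; apply pow_i; nia | reflexivity].
Qed.

Lemma psi_square_neg (q : R) : 0 < q < 1 -> rpsi (- q) ^ 2 = rphi (- q) * rpsi (q ^ 2).
Proof.
  intro Hq. apply RtoC_inj. rewrite RtoC_mult, RtoC_pow.
  rewrite <- phi_real, <- psi_real by now apply Rabs_neg_lt_1.
  rewrite <- psi_real by (apply Rabs_pos_lt_1, pow_in_01; [lia | assumption]).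
  rewrite psi_square_C by (rewrite Cmod_R; now apply Rabs_neg_lt_1).
  do 2 f_equal. rewrite <- RtoC_pow. f_equal. ring.
Qed.

(** [psi] has no zero on (-1, 0], because [psi (- q) ^ 2 = phi (- q) psi (q ^ 2)], and
    it equals 1 at 0. *)
Lemma rpsi_neg_pos (q : R) : 0 < q < 1 -> 0 < rpsi (- q).
Proof.
  assert (NZ : forall x, 0 < x < 1 -> rpsi (- x) <> 0).
  { intros x Hx E. pose proof (psi_square_neg x Hx) as H. rewrite E in H.
    pose proof (rphi_neg_pos x Hx).
    pose proof (rpsi_ge_1 _ (pow_in_01 x 2 ltac:(lia) Hx)). nra. }
  intro Hq. destruct (Rlt_le_dec 0 (rpsi (- q))) as [P|P]; [assumption|exfalso].
  assert (P' : rpsi (- q) < 0) by (destruct P as [P|P]; [assumption | now apply NZ in P]).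
  destruct (IVT_interv rpsi (- q) 0) as [z [Hz Ez]].
  - intros x Hx. apply ex_derive_continuity_pt, ex_derive_rpsi. apply Rabs_def1; lra.
  - lra.
  - assumption.
  - rewrite rpsi_0. lra.
  - destruct (Req_dec z 0) as [->|N]; [rewrite rpsi_0 in Ez; lra|].
    apply (NZ (- z)); [lra | now rewrite Ropp_involutive].
Qed.

Lemma psi_mul_neg (q : R) : 0 < q < 1 -> rpsi q * rpsi (- q) = rpsi (q ^ 2) * rphi (- q ^ 2).
Proof.
  intro Hq. pose proof (pow_in_01 q 2 ltac:(lia) Hq) as Hq2.
  apply Rsqr_inj.
  - apply Rmult_le_pos; [pose proof (rpsi_ge_1 q Hq); lra|]. now apply Rlt_le, rpsi_neg_pos.
  - apply Rmult_le_pos; [pose proof (rpsi_ge_1 _ Hq2); lra|]. now apply Rlt_le, rphi_neg_pos.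
  - unfold Rsqr. pose proof (psi_square q Hq) as H1. pose proof (psi_square_neg q Hq) as H2.
    pose proof (phi_mul_neg q Hq) as H3.
    replace (rpsi q * rpsi (- q) * (rpsi q * rpsi (- q)))
      with (rpsi q ^ 2 * rpsi (- q) ^ 2) by ring.
    rewrite H1, H2.
    replace (rpsi (q ^ 2) * rphi (- q ^ 2) * (rpsi (q ^ 2) * rphi (- q ^ 2)))
      with (rpsi (q ^ 2) ^ 2 * rphi (- q ^ 2) ^ 2) by ring.
    rewrite <- H3. ring.
Qed.

Lemma phi_3_5_identity_neg (q : R) : 0 < q < 1 ->
  rphi (- q ^ 3) * rphi (- q ^ 5)
  = 2 * q ^ 2 * rpsi (- q) * rpsi (- q ^ 15) + rphi (- q ^ 2) * rphi (- q ^ 30).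
Proof.
  intro Hq. pose proof (phi_3_5_identity_C (RtoC (- q))) as H.
  rewrite Cmod_R in H. specialize (H (Rabs_neg_lt_1 q Hq)).
  rewrite <- !RtoC_pow, <- !RtoC_opp in H.
  replace ((- q) ^ 3) with (- q ^ 3) in H by ring.
  replace ((- q) ^ 5) with (- q ^ 5) in H by ring.
  replace ((- q) ^ 15) with (- q ^ 15) in H by ring.
  replace ((- q) ^ 2) with (q ^ 2) in H by ring.
  replace ((- q) ^ 30) with (q ^ 30) in H by ring.
  rewrite !phi_real, !psi_real in H
    by (apply Rabs_neg_lt_1; first [exact Hq | apply pow_in_01; [lia | exact Hq]]).
  rewrite <- !RtoC_mult, <- RtoC_plus in H. apply RtoC_inj in H. exact H.
Qed.


(** * The modular equation of degree 15 *)

Lemma psi_phi_swap (q : R) : 0 < q < 1 -> rpsi q * rphi (- q ^ 2) = rphi q * rpsi (- q).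
Proof.
  intro Hq. pose proof (psi_mul_neg q Hq) as H1. pose proof (psi_square q Hq) as H2.
  pose proof (rpsi_ge_1 _ (pow_in_01 q 2 ltac:(lia) Hq)) as H3.
  apply Rmult_eq_reg_l with (rpsi (q ^ 2)); [|lra].
  replace (rpsi (q ^ 2) * (rpsi q * rphi (- q ^ 2)))
    with (rpsi q * (rpsi (q ^ 2) * rphi (- q ^ 2))) by ring.
  rewrite <- H1.
  replace (rpsi q * (rpsi q * rpsi (- q))) with (rpsi q ^ 2 * rpsi (- q)) by ring.
  rewrite H2. ring.
Qed.

(** The square of the elliptic modulus as a function of the nome: the modular lambda
    function on the imaginary axis. *)
Definition modulus (q : R) : R := 1 - (rphi (- q) / rphi q) ^ 4.

Lemma modulus_psi (q : R) : 0 < q < 1 ->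
  modulus q = 16 * q * rpsi (q ^ 2) ^ 4 / rphi q ^ 4.
Proof.
  intro Hq. pose proof (rphi_ge_1 q Hq). unfold modulus.
  rewrite <- (phi_fourth_diff q Hq). field. lra.
Qed.

Lemma modulus_01 (q : R) : 0 < q < 1 -> 0 < modulus q < 1.
Proof.
  intro Hq. pose proof (rphi_ge_1 q Hq) as H1.
  pose proof (rphi_neg_pos q Hq) as H3. split.
  - rewrite modulus_psi by assumption.
    pose proof (rpsi_ge_1 _ (pow_in_01 q 2 ltac:(lia) Hq)) as H2.
    apply Rdiv_lt_0_compat; [|apply pow_lt; lra].
    apply Rmult_lt_0_compat; [lra | apply pow_lt; lra].
  - unfold modulus. assert (0 < (rphi (- q) / rphi q) ^ 4); [|lra].
    apply pow_lt, Rdiv_lt_0_compat; lra.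
Qed.

(** The eighth roots of [alpha beta] and [(1 - alpha)(1 - beta)] for the moduli
    [alpha], [beta] attached to the nomes [q], [q ^ 15]. *)
Definition mod_u (q : R) : R := 2 * q ^ 2 * (rpsi q * rpsi (q ^ 15)) / (rphi q * rphi (q ^ 15)).
Definition mod_v (q : R) : R := rphi (- q ^ 2) * rphi (- q ^ 30) / (rphi q * rphi (q ^ 15)).

Section Degree15.

Variable q : R.
Hypothesis Hq : 0 < q < 1.

Let Hq15 : 0 < q ^ 15 < 1 := pow_in_01 q 15 ltac:(lia) Hq.
Let P := rphi q.
Let Q := rphi (q ^ 15).

Lemma P_ge_1 : 1 <= P. Proof. now apply rphi_ge_1. Qed.
Lemma Q_ge_1 : 1 <= Q. Proof. now apply rphi_ge_1. Qed.

Lemma mod_u_pos : 0 < mod_u q.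
Proof.
  pose proof P_ge_1. pose proof Q_ge_1.
  pose proof (rpsi_ge_1 q Hq). pose proof (rpsi_ge_1 _ Hq15).
  unfold mod_u. fold P Q. apply Rdiv_lt_0_compat; [|nra].
  apply Rmult_lt_0_compat; [|nra]. apply Rmult_lt_0_compat; [lra | apply pow_lt; lra].
Qed.

Lemma mod_v_pos : 0 < mod_v q.
Proof.
  pose proof P_ge_1. pose proof Q_ge_1.
  unfold mod_v. fold P Q. apply Rdiv_lt_0_compat; [|nra].
  apply Rmult_lt_0_compat; apply rphi_neg_pos, pow_in_01; lia || assumption.
Qed.

Lemma mod_u_square : mod_u q ^ 2 = 4 * q ^ 4 * (rpsi (q ^ 2) * rpsi (q ^ 30)) / (P * Q).
Proof.
  pose proof P_ge_1. pose proof Q_ge_1.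
  pose proof (psi_square q Hq) as H1. pose proof (psi_square _ Hq15) as H2.
  rewrite <- pow_mult in H2. change (15 * 2)%nat with 30%nat in H2.
  unfold mod_u. fold P Q in H1, H2 |- *.
  replace ((2 * q ^ 2 * (rpsi q * rpsi (q ^ 15)) / (P * Q)) ^ 2)
    with (4 * q ^ 4 * (rpsi q ^ 2 * rpsi (q ^ 15) ^ 2) / (P * Q) ^ 2) by (field; lra).
  rewrite H1, H2. field. lra.
Qed.

Lemma mod_v_square : mod_v q ^ 2 = rphi (- q) * rphi (- q ^ 15) / (P * Q).
Proof.
  pose proof P_ge_1. pose proof Q_ge_1.
  pose proof (phi_mul_neg q Hq) as H1. pose proof (phi_mul_neg _ Hq15) as H2.
  rewrite <- pow_mult in H2. change (15 * 2)%nat with 30%nat in H2.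
  unfold mod_v. fold P Q in H1, H2 |- *.
  replace ((rphi (- q ^ 2) * rphi (- q ^ 30) / (P * Q)) ^ 2)
    with (rphi (- q ^ 2) ^ 2 * rphi (- q ^ 30) ^ 2 / (P * Q) ^ 2) by (field; lra).
  rewrite <- H1, <- H2. field. lra.
Qed.

Lemma mod_u_eighth : mod_u q ^ 8 = modulus q * modulus (q ^ 15).
Proof.
  pose proof P_ge_1. pose proof Q_ge_1.
  replace (mod_u q ^ 8) with ((mod_u q ^ 2) ^ 4) by ring.
  rewrite mod_u_square, !modulus_psi, <- pow_mult by assumption.
  change (15 * 2)%nat with 30%nat. fold P Q. field. lra.
Qed.

Lemma mod_v_eighth : mod_v q ^ 8 = (1 - modulus q) * (1 - modulus (q ^ 15)).
Proof.
  pose proof P_ge_1. pose proof Q_ge_1.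
  replace (mod_v q ^ 8) with ((mod_v q ^ 2) ^ 4) by ring.
  rewrite mod_v_square. unfold modulus. fold P Q. field. lra.
Qed.

Lemma lt_1_of_pow (a : R) (n : nat) : 0 <= a -> a ^ n < 1 -> a < 1.
Proof.
  intros Ha H. apply Rnot_le_lt. intro L. pose proof (pow_R1_Rle a n L). lra.
Qed.

(** Divide the two bilinear identities by [X = phi(q) phi(q^15)].  The first, at [q]
    and at [- q], gives [u + v] and [u v + v] for [phi(q^3) phi(q^5) / X] and
    [phi(-q^3) phi(-q^5) / X].  The second gives
    [1 + v^2 - u^2 = 2 phi(-q^6) phi(-q^10) / X], whose square is
    [4 (u + v) (u v + v)].  The resulting quartic is divisible by [1 + u + v]. *)
Lemma modular_equation_aux :
  (1 - mod_u q - mod_v q) * (1 - (mod_v q - mod_u q) ^ 2) = 4 * mod_u q * mod_v q.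
Proof.
  pose proof P_ge_1 as HP. pose proof Q_ge_1 as HQ.
  pose proof mod_u_square as U2. pose proof mod_v_square as V2.
  pose proof mod_u_pos as Hu. pose proof mod_v_pos as Hv.
  set (u := mod_u q) in *. set (v := mod_v q) in *.
  assert (HX : 0 < P * Q) by nra.
  assert (A1 : rphi (q ^ 3) * rphi (q ^ 5) = (u + v) * (P * Q)).
  { rewrite (phi_3_5_identity q Hq). unfold u, v, mod_u, mod_v. fold P Q. field. lra. }
  assert (A2 : rphi (- q ^ 3) * rphi (- q ^ 5) = (u * v + v) * (P * Q)).
  { rewrite (phi_3_5_identity_neg q Hq).
    pose proof (psi_phi_swap q Hq) as S1. pose proof (psi_phi_swap _ Hq15) as S2.
    rewrite <- pow_mult in S2. change (15 * 2)%nat with 30%nat in S2. fold P Q in S1, S2.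
    replace (u * v) with (2 * q ^ 2 * ((rpsi q * rphi (- q ^ 2)) * (rpsi (q ^ 15) * rphi (- q ^ 30)))
                          / (P * Q) ^ 2)
      by (unfold u, v, mod_u, mod_v; fold P Q; field; lra).
    rewrite S1, S2. unfold v, mod_v. fold P Q. field. lra. }
  assert (A3 : 1 + v ^ 2 - u ^ 2 = 2 * (rphi (- q ^ 6) * rphi (- q ^ 10)) / (P * Q)).
  { pose proof (phi_1_15_identity q Hq) as B. fold P Q in B. rewrite U2, V2.
    replace (1 + rphi (- q) * rphi (- q ^ 15) / (P * Q)
             - 4 * q ^ 4 * (rpsi (q ^ 2) * rpsi (q ^ 30)) / (P * Q))
      with ((P * Q + rphi (- q) * rphi (- q ^ 15) - 4 * q ^ 4 * rpsi (q ^ 2) * rpsi (q ^ 30))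
            / (P * Q)) by (field; lra).
    rewrite B. field. lra. }
  assert (A4 : (1 + v ^ 2 - u ^ 2) ^ 2 = 4 * (u + v) * (u * v + v)).
  { pose proof (phi_mul_neg _ (pow_in_01 q 3 ltac:(lia) Hq)) as D3.
    pose proof (phi_mul_neg _ (pow_in_01 q 5 ltac:(lia) Hq)) as D5.
    rewrite <- pow_mult in D3, D5.
    change (3 * 2)%nat with 6%nat in D3. change (5 * 2)%nat with 10%nat in D5.
    rewrite A3.
    replace ((2 * (rphi (- q ^ 6) * rphi (- q ^ 10)) / (P * Q)) ^ 2)
      with (4 * (rphi (- q ^ 6) ^ 2 * rphi (- q ^ 10) ^ 2) / (P * Q) ^ 2) by (field; lra).
    rewrite <- D3, <- D5.
    replace (rphi (q ^ 3) * rphi (- q ^ 3) * (rphi (q ^ 5) * rphi (- q ^ 5)))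
      with ((rphi (q ^ 3) * rphi (q ^ 5)) * (rphi (- q ^ 3) * rphi (- q ^ 5))) by ring.
    rewrite A1, A2. field. lra. }
  apply Rmult_eq_reg_l with (1 + u + v); [|lra].
  apply Rminus_diag_uniq. apply Rminus_diag_eq in A4. rewrite <- A4. ring.
Qed.

(** In the previous equation [|u - v| < 1] and [u v > 0], which decides the sign of
    the first factor. *)
Lemma mod_sum_lt_1 : mod_u q + mod_v q < 1.
Proof.
  pose proof mod_u_pos as Hu. pose proof mod_v_pos as Hv.
  pose proof (modulus_01 q Hq) as Ha. pose proof (modulus_01 _ Hq15) as Hb.
  assert (u1 : mod_u q < 1).
  { apply (lt_1_of_pow _ 8); [lra|]. rewrite mod_u_eighth. nra. }
  assert (v1 : mod_v q < 1).
  { apply (lt_1_of_pow _ 8); [lra|]. rewrite mod_v_eighth. nra. }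
  pose proof modular_equation_aux as H. set (u := mod_u q) in *. set (v := mod_v q) in *.
  assert (0 < 1 - (v - u) ^ 2) by nra. assert (0 < u * v) by nra. nra.
Qed.

(** A cubic relation of genus 1 between the eighth roots, equivalent to
    [modular_equation_aux]. *)
Theorem modular_equation :
  4 * mod_u q * mod_v q * (mod_u q + mod_v q)
  = (1 - (mod_u q + mod_v q)) ^ 2 * (1 + (mod_u q + mod_v q)).
Proof.
  pose proof modular_equation_aux as H. apply Rminus_diag_uniq.
  apply Rminus_diag_eq in H. apply Ropp_eq_compat in H. rewrite Ropp_0 in H.
  rewrite <- H. ring.
Qed.

End Degree15.


(** * The complete elliptic integral as a hypergeometric series *)

Definition ell_coef (n : nat) : R :=
  rising (1/2) n * rising (1/2) n / (rising 1 n * INR (fact n)).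

(** The complete elliptic integral of the first kind in the variable [k ^ 2], up to
    the factor [PI / 2]. *)
Definition ell (x : R) : R := hyp2F1 (1/2) (1/2) 1 x.

Lemma ell_PSeries (x : R) : ell x = PSeries ell_coef x.
Proof. reflexivity. Qed.

Lemma rising_1 (n : nat) : rising 1 n = INR (fact n).
Proof.
  induction n as [|n IH]; [reflexivity|].
  rewrite fact_simpl, mult_INR, S_INR, <- IH. simpl rising. ring.
Qed.

Lemma ell_coef_0 : ell_coef 0 = 1.
Proof. unfold ell_coef. simpl. field. Qed.

Lemma ell_coef_S (n : nat) :
  ell_coef (S n) = ell_coef n * ((INR n + 1 / 2) / (INR n + 1)) ^ 2.
Proof.
  unfold ell_coef. rewrite !rising_1. pose proof (INR_fact_neq_0 n).
  rewrite fact_simpl, mult_INR, S_INR. pose proof (pos_INR n). simpl rising.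
  field. lra.
Qed.

Lemma ell_coef_bound (n : nat) : 0 < ell_coef n <= 1.
Proof.
  induction n as [|n IH]; [rewrite ell_coef_0; lra|].
  rewrite ell_coef_S. pose proof (pos_INR n).
  set (y := (INR n + 1 / 2) / (INR n + 1)).
  assert (Hy : 0 < y < 1).
  { unfold y. split; [apply Rdiv_lt_0_compat; lra | apply Rlt_div_l; lra]. }
  assert (Hy2 : 0 < y ^ 2 <= 1) by (simpl; nra). nra.
Qed.

Lemma ell_ex (x : R) : Rabs x < 1 -> ex_pseries ell_coef x.
Proof.
  intro Hx. apply ex_pseries_R.
  apply (ex_series_le (fun n => ell_coef n * x ^ n) (fun n => Rabs x ^ n)).
  - intro n. unfold norm; simpl; unfold abs; simpl.
    rewrite Rabs_mult, RPow_abs. pose proof (ell_coef_bound n).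
    rewrite (Rabs_pos_eq (ell_coef n)) by lra.
    pose proof (Rabs_pos (x ^ n)). nra.
  - eexists. apply is_series_geom. now rewrite Rabs_Rabsolu.
Qed.

Lemma inside_of_radius (a : nat -> R) (x : R) :
  Rbar_le 1 (CV_radius a) -> Rabs x < 1 -> Rbar_lt (Rabs x) (CV_radius a).
Proof. intros H Hx. apply Rbar_lt_le_trans with 1; [exact Hx | exact H]. Qed.

Lemma ell_radius : Rbar_le 1 (CV_radius ell_coef).
Proof. apply CV_radius_ge_1. intros r Hr. apply ell_ex. rewrite Rabs_pos_eq; lra. Qed.

Lemma ell_ge_1 (x : R) : 0 <= x < 1 -> 1 <= ell x.
Proof.
  intro Hx. rewrite ell_PSeries.
  assert (Ha : Rabs x < 1) by (rewrite Rabs_pos_eq; lra).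
  rewrite PSeries_decr_1 by now apply ell_ex. rewrite ell_coef_0.
  assert (0 <= PSeries (PS_decr_1 ell_coef) x); [|nra].
  unfold PSeries.
  rewrite <- (is_series_unique (fun _ => 0) 0) by (now apply is_series_head).
  apply Series_le.
  - intro n. split; [lra|]. apply Rmult_le_pos; [apply Rlt_le, ell_coef_bound | now apply pow_le].
  - apply (ex_pseries_R (PS_decr_1 ell_coef) x), (CV_radius_inside (PS_decr_1 ell_coef) x).
    rewrite CV_radius_decr_1. apply inside_of_radius; [apply ell_radius | assumption].
Qed.

Lemma ell_le_geom (x : R) : 0 <= x < 1 -> ell x <= / (1 - x).
Proof.
  intro Hx. assert (Ha : Rabs x < 1) by (rewrite Rabs_pos_eq; lra).
  rewrite <- (is_series_unique _ _ (is_series_geom x Ha)).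
  rewrite ell_PSeries. unfold PSeries. apply Series_le.
  - intro n. pose proof (ell_coef_bound n). pose proof (pow_le x n (proj1 Hx)). nra.
  - eexists. now apply is_series_geom.
Qed.

(** The hypergeometric equation reads [(x (1 - x) y')' = y / 4]; with this flux it
    becomes a first-order system, for which Wronskians are easy to differentiate. *)
Definition ell_flux (x : R) : R := x * (1 - x) * PSeries (PS_derive ell_coef) x.

Lemma is_derive_ell (x : R) : 0 < x < 1 -> is_derive ell x (ell_flux x / (x * (1 - x))).
Proof.
  intro Hx. apply (is_derive_ext (PSeries ell_coef)); [intro; reflexivity|].
  replace (ell_flux x / (x * (1 - x))) with (PSeries (PS_derive ell_coef) x)
    by (unfold ell_flux; field; lra).
  apply is_derive_PSeries, inside_of_radius; [apply ell_radius | rewrite Rabs_pos_eq; lra].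
Qed.

Lemma continuous_ell (x : R) : Rabs x < 1 -> continuity_pt ell x.
Proof.
  intro Hx. apply (PSeries_continuity ell_coef).
  apply inside_of_radius; [apply ell_radius | assumption].
Qed.

Lemma derive_ex (x : R) : Rabs x < 1 -> ex_pseries (PS_derive ell_coef) x.
Proof.
  intro Hx. apply CV_radius_inside. rewrite CV_radius_derive.
  apply inside_of_radius; [apply ell_radius | assumption].
Qed.

Lemma derive_incr_ex (x : R) : Rabs x < 1 -> ex_pseries (PS_incr_1 (PS_derive ell_coef)) x.
Proof. intro Hx. now apply (@ex_pseries_incr_1 R_AbsRing R_NormedModule), derive_ex. Qed.

Lemma derive_incr2_ex (x : R) :
  Rabs x < 1 -> ex_pseries (PS_incr_1 (PS_incr_1 (PS_derive ell_coef))) x.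
Proof. intro Hx. now apply (@ex_pseries_incr_1 R_AbsRing R_NormedModule), derive_incr_ex. Qed.

Definition flux_coef : nat -> R :=
  PS_minus (PS_incr_1 (PS_derive ell_coef)) (PS_incr_1 (PS_incr_1 (PS_derive ell_coef))).

Lemma flux_PSeries (x : R) : Rabs x < 1 -> ell_flux x = PSeries flux_coef x.
Proof.
  intro Hx. unfold flux_coef.
  rewrite PSeries_minus by auto using derive_incr_ex, derive_incr2_ex.
  rewrite !PSeries_incr_1. unfold ell_flux. ring.
Qed.

Lemma flux_radius : Rbar_le 1 (CV_radius flux_coef).
Proof.
  apply CV_radius_ge_1. intros r Hr.
  assert (Ha : Rabs r < 1) by (rewrite Rabs_pos_eq; lra).
  apply (@ex_pseries_minus R_AbsRing R_NormedModule); auto using derive_incr_ex, derive_incr2_ex.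
Qed.

(** The recurrence [(n + 1)^2 c (n + 1) = (n + 1/2)^2 c n], in the form
    [(n + 1)^2 c (n + 1) - n (n + 1) c n = c n / 4]. *)
Lemma flux_derive_coef (n : nat) : PS_derive flux_coef n = / 4 * ell_coef n.
Proof.
  unfold flux_coef, PS_derive, PS_minus, PS_plus, PS_opp, PS_incr_1, plus, opp; simpl.
  pose proof (pos_INR n).
  destruct n as [|n]; [unfold zero; simpl; rewrite ell_coef_S, ell_coef_0; simpl; field|].
  change (match n with O => 1 | S _ => INR n + 1 end) with (INR (S n)).
  rewrite (ell_coef_S (S n)). field. lra.
Qed.

Lemma is_derive_flux (x : R) : Rabs x < 1 -> is_derive ell_flux x (ell x / 4).
Proof.
  intro Hx.
  apply (is_derive_ext_loc (PSeries flux_coef)).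
  - apply locally_disc; [assumption|]. intros y Hy. symmetry. now apply flux_PSeries.
  - replace (ell x / 4) with (PSeries (PS_derive flux_coef) x).
    + apply is_derive_PSeries, inside_of_radius; [apply flux_radius | assumption].
    + rewrite (PSeries_ext _ (PS_scal (/ 4) ell_coef)) by (intro n; apply flux_derive_coef).
      rewrite PSeries_scal. change (PSeries ell_coef x) with (ell x). lra.
Qed.

Lemma flux_0 : ell_flux 0 = 0.
Proof. unfold ell_flux. ring. Qed.

Lemma continuous_flux (x : R) : Rabs x < 1 -> continuity_pt ell_flux x.
Proof.
  intro Hx. apply continuity_pt_filterlim, (ex_derive_continuous ell_flux x).
  eexists. now apply is_derive_flux.
Qed.

(** ** Landen's transformation *)

Lemma constant_on (f : R -> R) (a b : R) :
  a < b -> (forall x, a < x < b -> is_derive f x 0) ->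
  (forall x, a <= x <= b -> continuity_pt f x) -> f a = f b.
Proof.
  intros Hab Hd Hc.
  destruct (MVT_gen f a b (fun _ => 0)) as [c [_ E]].
  - intros x Hx. rewrite Rmin_left, Rmax_right in Hx by lra. now apply Hd.
  - intros x Hx. rewrite Rmin_left, Rmax_right in Hx by lra. now apply Hc.
  - lra.
Qed.

(** Two solutions of the same self-adjoint equation, written as a first-order
    system [f' = f1 p], [f1' = f r]: their Wronskian has derivative zero, and it
    governs the derivative of the quotient of the two solutions. *)
Lemma wronskian_derive (f f1 g g1 : R -> R) (p r x : R) :
  is_derive f x (f1 x * p) -> is_derive f1 x (f x * r) ->
  is_derive g x (g1 x * p) -> is_derive g1 x (g x * r) ->
  is_derive (fun y => f1 y * g y - g1 y * f y) x 0.
Proof.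
  intros H1 H2 H3 H4. auto_derive.
  - repeat split; eexists; eassumption.
  - rewrite (is_derive_unique (fun y : R => f y) _ _ H1), (is_derive_unique (fun y : R => f1 y) _ _ H2),
      (is_derive_unique (fun y : R => g y) _ _ H3), (is_derive_unique (fun y : R => g1 y) _ _ H4). ring.
Qed.

Lemma quotient_derive (f f1 g g1 : R -> R) (p x : R) :
  is_derive f x (f1 x * p) -> is_derive g x (g1 x * p) -> g x <> 0 ->
  is_derive (fun y => f y / g y) x (p * (f1 x * g x - g1 x * f x) / g x ^ 2).
Proof.
  intros H1 H2 Hg. auto_derive.
  - repeat split; try (eexists; eassumption). assumption.
  - rewrite (is_derive_unique (fun y : R => f y) _ _ H1), (is_derive_unique (fun y : R => g y) _ _ H2).
    now field.
Qed.

Definition landen_arg (k : R) : R := 4 * k / (1 + k) ^ 2.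

Lemma landen_arg_01 (k : R) : 0 < k < 1 -> 0 < landen_arg k < 1.
Proof.
  intro Hk. unfold landen_arg. split.
  - apply Rdiv_lt_0_compat; [lra | apply pow_lt; lra].
  - apply Rlt_div_l; [apply Rlt_gt, pow_lt; lra|]. nra.
Qed.

Lemma is_derive_landen_arg (k : R) :
  0 < k < 1 -> is_derive landen_arg k (4 * (1 - k) / (1 + k) ^ 3).
Proof.
  intro Hk. unfold landen_arg. auto_derive.
  - assert (0 < (1 + k) * ((1 + k) * 1)) by nra. lra.
  - field. lra.
Qed.

(** The flux of [(1 + k) * ell (k ^ 2)] for the equation in [k] that
    [ell (landen_arg k)] satisfies. *)
Definition landen_flux (k : R) : R :=
  k * (1 - k) / (1 + k) * ell (k ^ 2) + 2 * ell_flux (k ^ 2) / (1 + k).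

Lemma landen_system (k : R) : 0 < k < 1 ->
  let p := (1 + k) / (k * (1 - k)) in
  let r := (1 - k) / (1 + k) ^ 3 in
  is_derive (fun k => ell (landen_arg k)) k (ell_flux (landen_arg k) * p) /\
  is_derive (fun k => ell_flux (landen_arg k)) k (ell (landen_arg k) * r) /\
  is_derive (fun k => (1 + k) * ell (k ^ 2)) k (landen_flux k * p) /\
  is_derive landen_flux k ((1 + k) * ell (k ^ 2) * r).
Proof.
  intros Hk p r. pose proof (landen_arg_01 k Hk) as Hy.
  pose proof (is_derive_landen_arg k Hk) as Dy.
  assert (Hk2 : 0 < k ^ 2 < 1) by (split; simpl; nra).
  pose proof (is_derive_ell _ Hk2) as De.
  assert (Df : is_derive ell_flux (k ^ 2) (ell (k ^ 2) / 4)).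
  { apply is_derive_flux. rewrite Rabs_pos_eq; lra. }
  split; [|split; [|split]].
  - pose proof (is_derive_comp _ _ _ _ _ (is_derive_ell _ Hy) Dy) as H.
    replace (ell_flux (landen_arg k) * p)
      with (scal (4 * (1 - k) / (1 + k) ^ 3)
              (ell_flux (landen_arg k) / (landen_arg k * (1 - landen_arg k)))); [exact H|].
    unfold scal; simpl; unfold mult; simpl. unfold p, landen_arg at 2 3. field.
    repeat split; try lra. nra.
  - assert (Dg : is_derive ell_flux (landen_arg k) (ell (landen_arg k) / 4)).
    { apply is_derive_flux. rewrite Rabs_pos_eq; lra. }
    pose proof (is_derive_comp _ _ _ _ _ Dg Dy) as H.
    replace (ell (landen_arg k) * r)
      with (scal (4 * (1 - k) / (1 + k) ^ 3) (ell (landen_arg k) / 4)); [exact H|].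
    unfold scal; simpl; unfold mult; simpl. unfold r. field. lra.
  - auto_derive; [eexists; exact De|].
    change (k * (k * 1)) with (k ^ 2). rewrite (is_derive_unique (fun y : R => ell y) _ _ De).
    unfold landen_flux, p. field. repeat split; try lra; nra.
  - unfold landen_flux. auto_derive.
    + repeat split; try (eexists; first [exact De | exact Df]); lra.
    + change (k * (k * 1)) with (k ^ 2).
      rewrite (is_derive_unique (fun y : R => ell y) _ _ De), (is_derive_unique (fun y : R => ell_flux y) _ _ Df).
      unfold r. field. repeat split; try lra; nra.
Qed.

Lemma landen_continuity (k : R) : 0 <= k < 1 ->
  continuity_pt (fun k => ell (landen_arg k)) k /\
  continuity_pt (fun k => ell_flux (landen_arg k)) k /\
  continuity_pt (fun k => (1 + k) * ell (k ^ 2)) k /\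
  continuity_pt landen_flux k.
Proof.
  intro Hk.
  assert (Hy : Rabs (landen_arg k) < 1).
  { destruct (Req_dec k 0) as [->|N].
    - replace (landen_arg 0) with 0 by (unfold landen_arg; field). rewrite Rabs_R0. lra.
    - rewrite Rabs_pos_eq; apply landen_arg_01 || apply Rlt_le, landen_arg_01; lra. }
  assert (Hk2 : Rabs (k ^ 2) < 1) by (rewrite Rabs_pos_eq; simpl; nra).
  assert (Cy : continuity_pt landen_arg k).
  { apply continuity_pt_filterlim, (ex_derive_continuous landen_arg k).
    unfold landen_arg. auto_derive. assert (0 < (1 + k) * ((1 + k) * 1)) by nra. lra. }
  assert (C2 : continuity_pt (fun k => k ^ 2) k).
  { apply continuity_pt_filterlim, (ex_derive_continuous (fun k => k ^ 2) k). auto_derive. easy. }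
  assert (CE : continuity_pt (fun k => ell (k ^ 2)) k)
    by (apply (continuity_pt_comp (fun k => k ^ 2) ell); [assumption | now apply continuous_ell]).
  assert (CF : continuity_pt (fun k => ell_flux (k ^ 2)) k)
    by (apply (continuity_pt_comp (fun k => k ^ 2) ell_flux); [assumption | now apply continuous_flux]).
  assert (CP : forall f : R -> R, ex_derive f k -> continuity_pt f k).
  { intros f Hf. now apply continuity_pt_filterlim, (ex_derive_continuous f k). }
  split; [|split; [|split]].
  - apply (continuity_pt_comp landen_arg ell); [assumption | now apply continuous_ell].
  - apply (continuity_pt_comp landen_arg ell_flux); [assumption | now apply continuous_flux].
  - apply (continuity_pt_mult (fun k => 1 + k)); [|assumption]. apply CP. auto_derive. easy.
  - apply (continuity_pt_plus (fun k => k * (1 - k) / (1 + k) * ell (k ^ 2))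
             (fun k => 2 * ell_flux (k ^ 2) / (1 + k))).
    + apply (continuity_pt_mult (fun k => k * (1 - k) / (1 + k))); [|assumption].
      apply CP. auto_derive. lra.
    + apply (continuity_pt_mult (fun k => 2 * ell_flux (k ^ 2)) (fun k => / (1 + k))).
      * apply (continuity_pt_mult (fun _ => 2)); [apply CP; auto_derive; easy | assumption].
      * apply CP. auto_derive. lra.
Qed.

(** Landen's transformation: both sides solve the same second-order equation in [k]
    and have the same value at [k = 0], where the equation is singular. *)
Theorem landen (k : R) : 0 <= k < 1 -> ell (landen_arg k) = (1 + k) * ell (k ^ 2).
Proof.
  intro Hk.
  assert (Z0 : landen_arg 0 = 0) by (unfold landen_arg; field).
  assert (P2 : 0 ^ 2 = 0) by ring.
  assert (E0 : 1 <= ell 0) by (apply ell_ge_1; lra).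
  destruct (Req_dec k 0) as [->|Nk]; [rewrite Z0, P2; ring|].
  set (wr := fun k => ell_flux (landen_arg k) * ((1 + k) * ell (k ^ 2))
                      - landen_flux k * ell (landen_arg k)).
  assert (W : forall x, 0 < x < 1 -> wr x = 0).
  { intros x Hx. transitivity (wr 0).
    - symmetry. apply constant_on; [lra | |].
      + intros y Hy. destruct (landen_system y ltac:(lra)) as [D1 [D2 [D3 D4]]].
        exact (wronskian_derive _ _ _ _ _ _ _ D1 D2 D3 D4).
      + intros y Hy. destruct (landen_continuity y ltac:(lra)) as [C1 [C2 [C3 C4]]].
        apply continuity_pt_minus; now apply continuity_pt_mult.
    - unfold wr, landen_flux. rewrite Z0, P2, flux_0. field. }
  assert (PV : forall x, 0 <= x < 1 -> 0 < (1 + x) * ell (x ^ 2)).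
  { intros x Hx. pose proof (ell_ge_1 (x ^ 2) ltac:(simpl; nra)). nra. }
  set (h := fun k => ell (landen_arg k) / ((1 + k) * ell (k ^ 2))).
  assert (H : h 0 = h k).
  { apply constant_on; [lra | |].
    - intros y Hy. destruct (landen_system y ltac:(lra)) as [D1 [D2 [D3 D4]]].
      pose proof (PV y ltac:(lra)) as Py.
      pose proof (quotient_derive (fun k => ell (landen_arg k))
        (fun k => ell_flux (landen_arg k)) (fun k => (1 + k) * ell (k ^ 2)) landen_flux
        _ _ D1 D3 ltac:(lra)) as D. cbv beta in D.
      pose proof (W y ltac:(lra)) as Wy. unfold wr in Wy. rewrite Wy in D.
      replace 0 with ((1 + y) / (y * (1 - y)) * 0 / ((1 + y) * ell (y ^ 2)) ^ 2)
        by (unfold Rdiv; ring).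
      exact D.
    - intros y Hy. destruct (landen_continuity y ltac:(lra)) as [C1 [C2 [C3 C4]]].
      apply continuity_pt_div; [assumption | assumption |].
      pose proof (PV y ltac:(lra)). lra. }
  unfold h in H. rewrite Z0, P2 in H. pose proof (PV k Hk) as Pk.
  replace (ell 0 / ((1 + 0) * ell 0)) with 1 in H by (field; lra).
  apply Rmult_eq_reg_r with (/ ((1 + k) * ell (k ^ 2))); [|apply Rinv_neq_0_compat; lra].
  rewrite Rinv_r by lra. symmetry. exact H.
Qed.

(** ** The complementary integral *)

Definition ell_ratio (x : R) : R := ell (1 - x) / ell x.

Definition legendre_const : R := 2 * (ell_flux (1 / 2) * ell (1 / 2)).

Lemma complementary_system (x : R) : 0 < x < 1 ->
  let p := / (x * (1 - x)) in
  is_derive (fun x => ell (1 - x)) x (- ell_flux (1 - x) * p) /\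
  is_derive (fun x => - ell_flux (1 - x)) x (ell (1 - x) * / 4) /\
  is_derive ell x (ell_flux x * p) /\
  is_derive ell_flux x (ell x * / 4).
Proof.
  intros Hx p.
  assert (D1 : is_derive ell (1 - x) (ell_flux (1 - x) / ((1 - x) * (1 - (1 - x)))))
    by (apply is_derive_ell; lra).
  assert (D2 : is_derive ell_flux (1 - x) (ell (1 - x) / 4))
    by (apply is_derive_flux; rewrite Rabs_pos_eq; lra).
  split; [|split; [|split]].
  - auto_derive; [eexists; exact D1|].
    change (1 + - x) with (1 - x). rewrite (is_derive_unique (fun y : R => ell y) _ _ D1).
    unfold p. field. lra.
  - auto_derive; [eexists; exact D2|].
    change (1 + - x) with (1 - x). rewrite (is_derive_unique (fun y : R => ell_flux y) _ _ D2). field.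
  - now apply is_derive_ell.
  - apply is_derive_flux. rewrite Rabs_pos_eq; lra.
Qed.

(** The Wronskian of [ell x] and [ell (1 - x)]; this is Legendre's relation, with the
    value of the constant left undetermined because only its sign matters. *)
Lemma legendre_relation (x : R) : 0 < x < 1 ->
  ell_flux (1 - x) * ell x + ell_flux x * ell (1 - x) = legendre_const.
Proof.
  intro Hx.
  set (wr := fun x => - ell_flux (1 - x) * ell x - ell_flux x * ell (1 - x)).
  assert (D : forall y, 0 < y < 1 -> is_derive wr y 0).
  { intros y Hy. destruct (complementary_system y Hy) as [D1 [D2 [D3 D4]]].
    exact (wronskian_derive _ _ _ _ _ _ _ D1 D2 D3 D4). }
  assert (C : forall a b, 0 < a -> a < b -> b < 1 -> wr a = wr b).
  { intros a b Ha Hab Hb. apply constant_on; [assumption | intros; apply D; lra |].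
    intros y Hy. apply continuity_pt_filterlim, (ex_derive_continuous wr y).
    eexists. apply D. lra. }
  assert (E : wr x = wr (1 / 2)).
  { destruct (Rtotal_order x (1 / 2)) as [L|[->|L]]; [|reflexivity|symmetry]; apply C; lra. }
  unfold wr in E. replace (1 - 1 / 2) with (1 / 2) in E by field.
  unfold legendre_const. lra.
Qed.

Lemma is_derive_ell_ratio (x : R) : 0 < x < 1 ->
  is_derive ell_ratio x (- legendre_const / (x * (1 - x) * ell x ^ 2)).
Proof.
  intro Hx. destruct (complementary_system x Hx) as [D1 [D2 [D3 D4]]].
  pose proof (ell_ge_1 x ltac:(lra)) as H1.
  pose proof (quotient_derive (fun x => ell (1 - x)) (fun x => - ell_flux (1 - x)) ell ell_flux
    _ _ D1 D3 ltac:(lra)) as D. cbv beta in D.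
  rewrite <- (legendre_relation x Hx).
  replace (- (ell_flux (1 - x) * ell x + ell_flux x * ell (1 - x)) / (x * (1 - x) * ell x ^ 2))
    with (/ (x * (1 - x)) * (- ell_flux (1 - x) * ell x - ell_flux x * ell (1 - x)) / ell x ^ 2)
    by (field; lra).
  exact D.
Qed.

(** The derivative of [ell_ratio x + legendre_const * ln x] is bounded by
    [2 * Rabs legendre_const] near 0: its singular part [1 / x] is multiplied by
    [1 - 1 / ((1 - x) ell x ^ 2)], which is O(x) since [1 <= ell x <= 1 / (1 - x)]. *)
Lemma ell_ratio_log (x : R) : 0 < x <= 1 / 2 ->
  Rabs (ell_ratio x + legendre_const * ln x
        - (ell_ratio (1 / 2) + legendre_const * ln (1 / 2))) <= Rabs legendre_const.
Proof.
  intro Hx. set (W := legendre_const).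
  set (h := fun y => ell_ratio y + W * ln y).
  set (dh := fun y => W / y * (1 - / ((1 - y) * ell y ^ 2))).
  assert (Dh : forall y, 0 < y < 1 -> is_derive h y (dh y)).
  { intros y Hy. pose proof (is_derive_ell_ratio y Hy) as D.
    pose proof (ell_ge_1 y ltac:(lra)).
    unfold h. auto_derive.
    - split; [eexists; exact D | split; [lra | easy]].
    - rewrite (is_derive_unique (fun y : R => ell_ratio y) _ _ D). unfold dh, W. field. lra. }
  assert (B : forall y, 0 < y <= 1 / 2 -> Rabs (dh y) <= 2 * Rabs W).
  { intros y Hy. pose proof (ell_ge_1 y ltac:(lra)) as L1.
    pose proof (ell_le_geom y ltac:(lra)) as L2.
    set (e := ell y) in *.
    assert (P : 0 < (1 - y) * e ^ 2) by (simpl; nra).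
    assert (Q1 : / ((1 - y) * e ^ 2) <= / (1 - y)).
    { apply Rinv_le_contravar; [lra|]. assert (1 <= e * e) by nra.
      replace ((1 - y) * e ^ 2) with ((1 - y) * (e * e)) by ring. nra. }
    assert (Q2 : / (1 - y) <= 1 + 2 * y).
    { apply Rmult_le_reg_l with (1 - y); [lra|]. rewrite Rinv_r by lra. nra. }
    assert (M : (1 - y) * e <= 1).
    { apply Rmult_le_reg_r with (/ (1 - y)); [apply Rinv_0_lt_compat; lra|].
      replace ((1 - y) * e * / (1 - y)) with e by (field; lra). lra. }
    assert (Q3 : 1 - y <= / ((1 - y) * e ^ 2)).
    { apply Rmult_le_reg_r with ((1 - y) * e ^ 2); [assumption|].
      rewrite Rinv_l by lra.
      replace ((1 - y) * ((1 - y) * e ^ 2)) with (((1 - y) * e) * ((1 - y) * e)) by ring.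
      assert (0 <= (1 - y) * e) by nra. nra. }
    unfold dh, Rdiv. rewrite !Rabs_mult.
    rewrite (Rabs_pos_eq (/ y)) by (apply Rlt_le, Rinv_0_lt_compat; lra).
    assert (A : Rabs (1 - / ((1 - y) * e ^ 2)) <= 2 * y).
    { apply Rabs_le. lra. }
    apply Rle_trans with (Rabs W * / y * (2 * y)).
    - apply Rmult_le_compat_l; [|assumption].
      apply Rmult_le_pos; [apply Rabs_pos | apply Rlt_le, Rinv_0_lt_compat; lra].
    - apply Req_le. field. lra. }
  destruct (MVT_gen h x (1 / 2) dh) as [c [Hc E]].
  - intros y Hy. rewrite Rmin_left, Rmax_right in Hy by lra. apply Dh. lra.
  - intros y Hy. rewrite Rmin_left, Rmax_right in Hy by lra.
    apply continuity_pt_filterlim, (ex_derive_continuous h y). eexists. apply Dh. lra.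
  - rewrite Rmin_left, Rmax_right in Hc by lra.
    change (Rabs (h x - h (1 / 2)) <= Rabs W).
    rewrite Rabs_minus_sym, E, Rabs_mult. specialize (B c ltac:(lra)).
    rewrite (Rabs_pos_eq (1 / 2 - x)) by lra.
    pose proof (Rabs_pos W). pose proof (Rabs_pos (dh c)). nra.
Qed.


(** * Jacobi inversion *)

Lemma rphi_0 : rphi 0 = 1.
Proof.
  assert (H : Rabs 0 < 1) by (rewrite Rabs_R0; lra).
  destruct (phi_series 0 H) as [l1 [l2 [E [H1 H2]]]]. rewrite E.
  rewrite <- (is_series_unique _ _ H1), <- (is_series_unique _ _ H2).
  rewrite (is_series_unique _ 1), (is_series_unique _ 0); [ring| |].
  - apply is_series_head; [intro n|]; apply pow_i; lia.
  - apply is_series_head; [intro n; apply pow_i; lia | reflexivity].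
Qed.

Lemma rphi_pos (q : R) : 0 <= q < 1 -> 0 < rphi q.
Proof.
  intro Hq. destruct (Req_dec q 0) as [->|N]; [rewrite rphi_0; lra|].
  pose proof (rphi_ge_1 q ltac:(lra)). lra.
Qed.

Lemma ex_derive_modulus (q : R) : 0 <= q < 1 -> ex_derive modulus q.
Proof.
  intro Hq. pose proof (rphi_pos q Hq) as P.
  assert (D1 : ex_derive rphi q) by (apply ex_derive_rphi; rewrite Rabs_pos_eq; lra).
  assert (D2 : ex_derive rphi (- q))
    by (apply ex_derive_rphi; rewrite Rabs_Ropp, Rabs_pos_eq; lra).
  unfold modulus. auto_derive. repeat split; try assumption. lra.
Qed.

Lemma modulus_0 : modulus 0 = 0.
Proof. unfold modulus. rewrite Ropp_0, rphi_0. field. Qed.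

(** The passage from [q] to [q ^ 2] is Landen's transformation, with
    [k = (phi(q)^2 - phi(-q)^2) / (phi(q)^2 + phi(-q)^2)]. *)
Lemma modulus_double (q : R) : 0 < q < 1 -> exists k, 0 < k < 1 /\
  modulus (q ^ 2) = k ^ 2 /\ modulus q = landen_arg k /\
  1 - modulus q = ((1 - k) / (1 + k)) ^ 2 /\
  1 + k = rphi q ^ 2 / rphi (q ^ 2) ^ 2.
Proof.
  intro Hq.
  pose proof (pow_in_01 q 2 ltac:(lia) Hq) as Hq2.
  pose proof (rphi_ge_1 q Hq) as P1. pose proof (rphi_neg_pos q Hq) as P2.
  pose proof (rphi_ge_1 _ Hq2) as P3.
  pose proof (phi_square_sum q Hq) as S. pose proof (phi_mul_neg q Hq) as M.
  pose proof (phi_square_diff q Hq) as D.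
  assert (Dp : 0 < rphi q ^ 2 - rphi (- q) ^ 2).
  { rewrite D. apply Rmult_lt_0_compat; [lra|].
    pose proof (rpsi_ge_1 _ (pow_in_01 q 4 ltac:(lia) Hq)). apply pow_lt. lra. }
  assert (Np : 0 < rphi (- q) ^ 2) by now apply pow_lt.
  assert (E1 : modulus (q ^ 2)
     = ((rphi q ^ 2 - rphi (- q) ^ 2) / (rphi q ^ 2 + rphi (- q) ^ 2)) ^ 2).
  { unfold modulus.
    replace ((rphi (- q ^ 2) / rphi (q ^ 2)) ^ 4)
      with (4 * (rphi (- q ^ 2) ^ 2) ^ 2 / (2 * rphi (q ^ 2) ^ 2) ^ 2) by (field; lra).
    rewrite <- S, <- M. field. lra. }
  assert (E2 : 2 * rphi q ^ 2 / (rphi q ^ 2 + rphi (- q) ^ 2)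
               = rphi q ^ 2 / rphi (q ^ 2) ^ 2).
  { rewrite S. field. lra. }
  assert (E3 : forall a b, 0 < a -> 0 < b -> 
     1 - (b / a) ^ 4 = landen_arg ((a ^ 2 - b ^ 2) / (a ^ 2 + b ^ 2))
     /\ 1 - (1 - (b / a) ^ 4)
        = ((1 - (a ^ 2 - b ^ 2) / (a ^ 2 + b ^ 2)) / (1 + (a ^ 2 - b ^ 2) / (a ^ 2 + b ^ 2))) ^ 2).
  { intros a b Ha Hb. assert (0 < a ^ 2) by now apply pow_lt. assert (0 < b ^ 2) by now apply pow_lt.
    assert (K : 1 + (a ^ 2 - b ^ 2) / (a ^ 2 + b ^ 2) = 2 * a ^ 2 / (a ^ 2 + b ^ 2)) by (field; lra).
    unfold landen_arg. rewrite K. split; field; repeat split; lra. }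
  destruct (E3 (rphi q) (rphi (- q)) ltac:(lra) P2) as [E4 E5].
  exists ((rphi q ^ 2 - rphi (- q) ^ 2) / (rphi q ^ 2 + rphi (- q) ^ 2)).
  split; [|split; [exact E1 | split; [exact E4 | split; [exact E5|]]]].
  - split; [apply Rdiv_lt_0_compat; lra | apply Rlt_div_l; lra].
  - rewrite <- E2. field. lra.
Qed.

Lemma square_iter (q : R) (n : nat) : q ^ (2 ^ S n) = (q ^ (2 ^ n)) ^ 2.
Proof. rewrite <- pow_mult. f_equal. simpl. lia. Qed.

Lemma square_iter_01 (q : R) (n : nat) : 0 < q < 1 -> 0 < q ^ (2 ^ n) < 1.
Proof.
  apply pow_in_01. apply Nat.neq_0_lt_0, Nat.pow_nonzero. lia.
Qed.

Lemma square_iter_lim (q : R) : 0 < q < 1 -> is_lim_seq (fun n => q ^ (2 ^ n)) 0.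
Proof.
  intro Hq. apply (is_lim_seq_le_le (fun _ => 0) _ (fun n => q ^ n)).
  - intro n. split; [apply Rlt_le, square_iter_01, Hq|].
    assert (L : (n <= 2 ^ n)%nat) by (apply Nat.lt_le_incl, Nat.pow_gt_lin_r; lia).
    replace (2 ^ n)%nat with (n + (2 ^ n - n))%nat by lia. rewrite pow_add.
    pose proof (pow_le q n ltac:(lra)). pose proof (pow_le q (2 ^ n - n) ltac:(lra)).
    assert (q ^ (2 ^ n - n) <= 1).
    { rewrite <- (pow1 (2 ^ n - n)). apply pow_incr. lra. }
    nra.
  - apply is_lim_seq_const.
  - apply is_lim_seq_geom. rewrite Rabs_pos_eq; lra.
Qed.

(** By Landen's transformation [ell (modulus q) / phi(q)^2] is unchanged when [q] is
    replaced by [q ^ 2], so it equals its limit 1 at 0. *)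
Theorem ell_modulus (q : R) : 0 < q < 1 -> ell (modulus q) = rphi q ^ 2.
Proof.
  intro Hq. set (rho := fun x => ell (modulus x) / rphi x ^ 2).
  assert (Step : forall x, 0 < x < 1 -> rho (x ^ 2) = rho x).
  { intros x Hx. destruct (modulus_double x Hx) as [k [Hk [K1 [K2 [_ K3]]]]].
    unfold rho. rewrite K1, K2, landen, K3 by lra.
    pose proof (rphi_ge_1 x Hx). pose proof (rphi_ge_1 _ (pow_in_01 x 2 ltac:(lia) Hx)).
    field. lra. }
  assert (Iter : forall n, rho (q ^ (2 ^ n)) = rho q).
  { induction n as [|n IH]; [simpl; now rewrite Rmult_1_r|].
    rewrite square_iter, (Step _ (square_iter_01 q n Hq)). exact IH. }
  assert (C : continuity_pt rho 0).
  { apply continuity_pt_div.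
    - apply (continuity_pt_comp modulus ell).
      + apply ex_derive_continuity_pt, ex_derive_modulus. lra.
      + rewrite modulus_0. apply continuous_ell. rewrite Rabs_R0. lra.
    - assert (D : ex_derive rphi 0) by (apply ex_derive_rphi; rewrite Rabs_R0; lra).
      apply (ex_derive_continuity_pt (fun x => rphi x ^ 2)). auto_derive. exact D || (split; [exact D | exact I]).
    - rewrite rphi_0. lra. }
  pose proof (is_lim_seq_continuous rho _ 0 C (square_iter_lim q Hq)) as L.
  assert (R0 : rho 0 = 1).
  { unfold rho. rewrite modulus_0, rphi_0, ell_PSeries, PSeries_0, ell_coef_0. field. }
  rewrite R0 in L. apply (is_lim_seq_ext _ (fun _ => rho q)) in L; [|exact Iter].
  pose proof (is_lim_seq_unique _ _ L) as U. rewrite Lim_seq_const in U.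
  injection U as U. unfold rho in U. pose proof (rphi_ge_1 q Hq).
  apply Rmult_eq_reg_r with (/ rphi q ^ 2).
  - replace (rphi q ^ 2 * / rphi q ^ 2) with 1 by (field; lra). exact U.
  - apply Rinv_neq_0_compat, pow_nonzero. lra.
Qed.

(** Landen's transformation, applied at [k] in the denominator and at
    [(1 - k) / (1 + k)] in the numerator. *)
Lemma ell_ratio_double (q : R) : 0 < q < 1 ->
  ell_ratio (modulus (q ^ 2)) = 2 * ell_ratio (modulus q).
Proof.
  intro Hq. destruct (modulus_double q Hq) as [k [Hk [K1 [K2 [K3 _]]]]].
  unfold ell_ratio. rewrite K1, K3, K2, landen by lra.
  assert (Hj : 0 < (1 - k) / (1 + k) < 1).
  { split; [apply Rdiv_lt_0_compat; lra | apply Rlt_div_l; lra]. }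
  pose proof (landen ((1 - k) / (1 + k)) ltac:(lra)) as L.
  replace (landen_arg ((1 - k) / (1 + k))) with (1 - k ^ 2) in L.
  - rewrite L. pose proof (ell_ge_1 (k ^ 2) ltac:(simpl; nra)). field. lra.
  - unfold landen_arg. field. lra.
Qed.

(** [modulus q / q] tends to 16, so [ln (modulus q)] and [ln q] differ by a bounded
    amount. *)
Lemma ell_ratio_near_0 : exists d B, 0 < d /\
  forall q, 0 < q < 1 -> q < d -> Rabs (ell_ratio (modulus q) + legendre_const * ln q) <= B.
Proof.
  set (m := fun q => rpsi (q ^ 2) ^ 4 / rphi q ^ 4).
  assert (C : continuity_pt m 0).
  { apply ex_derive_continuity_pt. unfold m.
    assert (D1 : ex_derive rphi 0) by (apply ex_derive_rphi; rewrite Rabs_R0; lra).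
    assert (D2 : ex_derive rpsi (0 * (0 * 1))).
    { apply ex_derive_rpsi. replace (0 * (0 * 1)) with 0 by ring. rewrite Rabs_R0; lra. }
    auto_derive. rewrite rphi_0. repeat split; try assumption. lra. }
  assert (M0 : m 0 = 1).
  { unfold m. replace (0 ^ 2) with 0 by ring. rewrite rpsi_0, rphi_0. field. }
  destruct (C (1 / 2)) as [d [Hd Hm]]; [lra|].
  set (A := ell_ratio (1 / 2) + legendre_const * ln (1 / 2)).
  exists (Rmin d (1 / 64)), (Rabs legendre_const * (1 + ln 32) + Rabs A). split.
  { apply Rmin_pos; lra. }
  intros q Hq Hqd.
  assert (Q1 : q < d) by (apply Rlt_le_trans with (1 := Hqd), Rmin_l).
  assert (Q2 : q < 1 / 64) by (apply Rlt_le_trans with (1 := Hqd), Rmin_r).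
  assert (Mq : 1 / 2 < m q < 3 / 2).
  { specialize (Hm q). simpl in Hm. unfold R_dist in Hm. rewrite M0, Rminus_0_r in Hm.
    assert (Rabs (m q - 1) < 1 / 2).
    { apply Hm. split; [split; [exact I | lra] | rewrite Rabs_pos_eq; lra]. }
    apply Rabs_def2 in H. lra. }
  assert (Eq : modulus q = q * (16 * m q)).
  { rewrite modulus_psi by assumption. unfold m, Rdiv. ring. }
  assert (Ln : ln (modulus q) = ln q + ln (16 * m q)) by (rewrite Eq; apply ln_mult; lra).
  assert (L1 : 0 <= ln (16 * m q) <= ln 32).
  { split; [rewrite <- ln_1|]; apply ln_le; lra. }
  assert (Hx : 0 < modulus q <= 1 / 2).
  { split; [now apply modulus_01|]. rewrite Eq. nra. }
  pose proof (ell_ratio_log _ Hx) as G. fold A in G. rewrite Ln in G.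
  replace (ell_ratio (modulus q) + legendre_const * ln q)
    with ((ell_ratio (modulus q) + legendre_const * (ln q + ln (16 * m q)) - A)
          + (A - legendre_const * ln (16 * m q))) by ring.
  apply Rle_trans with (1 := Rabs_triang _ _).
  pose proof (Rabs_triang A (- (legendre_const * ln (16 * m q)))) as T.
  rewrite Rabs_Ropp, Rabs_mult, (Rabs_pos_eq (ln _)) in T by lra.
  pose proof (Rabs_pos legendre_const). unfold Rminus in *. nra.
Qed.

(** The nome recovers the ratio of the periods: the defect [h] satisfies
    [h (q ^ 2) = 2 h q] and stays bounded near [0]. *)
Theorem ell_ratio_nome (q : R) : 0 < q < 1 ->
  ell_ratio (modulus q) = - legendre_const * ln q.
Proof.
  intro Hq. set (h := fun q => ell_ratio (modulus q) + legendre_const * ln q).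
  destruct ell_ratio_near_0 as [d [B [Hd HB]]].
  assert (Iter : forall n, h (q ^ (2 ^ n)) = 2 ^ n * h q).
  { induction n as [|n IH]; [simpl; rewrite Rmult_1_r; ring|].
    pose proof (square_iter_01 q n Hq) as Hn.
    unfold h. rewrite square_iter, ell_ratio_double by assumption.
    replace (ln ((q ^ (2 ^ n)) ^ 2)) with (2 * ln (q ^ (2 ^ n))).
    - unfold h in IH. simpl (2 ^ S n). rewrite Rmult_assoc with (r1 := 2), <- IH. ring.
    - simpl. rewrite Rmult_1_r, ln_mult by lra. ring. }
  assert (Z : h q = 0).
  { destruct (Req_dec (h q) 0) as [E|E]; [assumption|exfalso].
    pose proof (Rabs_pos_lt _ E) as Ph.
    pose proof (square_iter_lim q Hq) as L. apply is_lim_seq_spec in L.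
    destruct (L (mkposreal d Hd)) as [N1 HN1].
    destruct (Pow_x_infinity 2 ltac:(rewrite Rabs_pos_eq; lra) ((B + 1) / Rabs (h q))) as [N2 HN2].
    set (n := Nat.max N1 N2).
    specialize (HN1 n ltac:(lia)). specialize (HN2 n ltac:(lia)). cbn [pos] in HN1.
    pose proof (square_iter_01 q n Hq) as Hn.
    rewrite Rminus_0_r, Rabs_pos_eq in HN1 by lra.
    specialize (HB _ Hn HN1). fold (h (q ^ (2 ^ n))) in HB. rewrite Iter, Rabs_mult in HB.
    apply Rge_le in HN2. apply Rle_div_l in HN2; [|assumption]. lra. }
  unfold h in Z. lra.
Qed.

(** The ratio of the periods and [- ln q] are both positive. *)
Lemma legendre_const_pos : 0 < legendre_const.
Proof.
  pose proof (ell_ratio_nome (1 / 2) ltac:(lra)) as E.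
  pose proof (modulus_01 (1 / 2) ltac:(lra)) as H.
  assert (P : 0 < ell_ratio (modulus (1 / 2))).
  { unfold ell_ratio. pose proof (ell_ge_1 (modulus (1/2)) ltac:(lra)).
    pose proof (ell_ge_1 (1 - modulus (1/2)) ltac:(lra)). apply Rdiv_lt_0_compat; lra. }
  assert (L : ln (1 / 2) < 0) by (rewrite <- ln_1; apply ln_increasing; lra).
  nra.
Qed.

(** Replacing the nome by its square root at least squares [1 - modulus]. *)
Lemma modulus_near_1 (n : nat) : exists q, 0 < q < 1 /\
  1 - modulus q <= (1 - modulus (1 / 2)) ^ (2 ^ n).
Proof.
  induction n as [|n [q [Hq E]]].
  - exists (1 / 2). simpl. lra.
  - destruct (root_01 2 q ltac:(lia) Hq) as [p [Hp Ep]].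
    exists p. split; [assumption|].
    destruct (modulus_double p Hp) as [k [Hk [K1 [_ [K3 _]]]]].
    rewrite Ep in K1. rewrite square_iter, K3.
    pose proof (modulus_01 q Hq). rewrite K1 in E.
    apply Rle_trans with ((1 - k ^ 2) ^ 2).
    + apply pow_incr. split; [apply Rlt_le, Rdiv_lt_0_compat; lra|].
      apply Rle_div_l; [lra|]. simpl. nra.
    + apply pow_incr. rewrite <- K1 in *. lra.
Qed.

Theorem modulus_surjective (a : R) : 0 < a < 1 -> exists q, 0 < q < 1 /\ modulus q = a.
Proof.
  intro Ha.
  pose proof (modulus_01 (1 / 2) ltac:(lra)) as Hh.
  pose proof (square_iter_lim (1 - modulus (1 / 2)) ltac:(lra)) as L.
  apply is_lim_seq_spec in L.
  assert (Hd : 0 < 1 - a) by lra.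
  destruct (L (mkposreal _ Hd)) as [N HN]. specialize (HN N (le_n N)). cbn [pos] in HN.
  rewrite Rminus_0_r in HN.
  destruct (modulus_near_1 N) as [p [Hp Ep]].
  assert (Lt : a < modulus p) by (pose proof (Rle_abs ((1 - modulus (1 / 2)) ^ (2 ^ N))); lra).
  destruct (IVT_interv (fun q => modulus q - a) 0 p) as [q [Hq E]].
  - intros x Hx. apply ex_derive_continuity_pt.
    assert (D : ex_derive modulus x) by (apply ex_derive_modulus; lra).
    auto_derive. assumption.
  - lra.
  - rewrite modulus_0. lra.
  - lra.
  - exists q. split; [|lra]. destruct (Req_dec q 0) as [->|N0]; [rewrite modulus_0 in E; lra | lra].
Qed.

(** ** The derivative of the modulus *)

Lemma locally_01 (q : R) (P : R -> Prop) :
  0 < q < 1 -> (forall y, 0 < y < 1 -> P y) -> locally q P.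
Proof.
  intros Hq H. assert (Hd : 0 < Rmin q (1 - q)) by (apply Rmin_pos; lra).
  exists (mkposreal _ Hd). intros y Hy. apply H.
  unfold ball in Hy; simpl in Hy; unfold AbsRing_ball in Hy; simpl in Hy.
  unfold abs, minus, plus, opp in Hy; simpl in Hy.
  pose proof (Rmin_l q (1 - q)). pose proof (Rmin_r q (1 - q)).
  apply Rabs_def2 in Hy. lra.
Qed.

(** Differentiate [ell_ratio (modulus q) = - legendre_const * ln q]: the constant
    cancels. *)
Theorem is_derive_modulus (q : R) : 0 < q < 1 ->
  is_derive modulus q (modulus q * (1 - modulus q) * rphi q ^ 4 / q).
Proof.
  intro Hq. pose proof (modulus_01 q Hq) as Hx. pose proof legendre_const_pos as HW.
  destruct (ex_derive_modulus q ltac:(lra)) as [D HD].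
  pose proof (is_derive_comp _ _ _ _ _ (is_derive_ell_ratio _ Hx) HD) as H1.
  assert (H2 : is_derive (fun q => ell_ratio (modulus q)) q (- legendre_const / q)).
  { apply (is_derive_ext_loc (fun q => - legendre_const * ln q)).
    - apply (locally_01 q _ Hq). intros y Hy. symmetry. now apply ell_ratio_nome.
    - auto_derive; [lra | field; lra]. }
  pose proof (is_derive_unique _ _ _ H1) as U.
  rewrite (is_derive_unique _ _ _ H2) in U.
  unfold scal in U; simpl in U; unfold mult in U; simpl in U.
  rewrite (ell_modulus q Hq) in U. pose proof (rphi_ge_1 q Hq).
  replace (modulus q * (1 - modulus q) * rphi q ^ 4 / q) with D; [exact HD|].
  apply Rmult_eq_reg_r with (- legendre_const / (modulus q * (1 - modulus q) * (rphi q ^ 2) ^ 2)).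
  - etransitivity; [symmetry; exact U|]. field. lra.
  - apply Rmult_integral_contrapositive. split; [lra|].
    apply Rinv_neq_0_compat. apply Rmult_integral_contrapositive. split; [nra|].
    apply pow_nonzero, pow_nonzero. lra.
Qed.


(** * The multiplier of degree 15 *)

(** On the modular curve every symmetric function of [u], [v] is rational in
    [s = u + v], and so is [d ^ 2 = (u - v) ^ 2]: the computations below happen in the
    field generated by [s] and [d]. *)
Section Curve.

Variables u v : R.
Hypothesis u_pos : 0 < u.
Hypothesis v_pos : 0 < v.
Hypothesis sum_lt_1 : u + v < 1.
Hypothesis on_curve : 4 * u * v * (u + v) = (1 - (u + v)) ^ 2 * (1 + (u + v)).

Let s := u + v.
Let d := u - v.
Let S0 := 1 - s + 3 * s ^ 2 + s ^ 3.
Let T := 3 + 5 * s + 5 * s ^ 2 + s ^ 3.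
Let Rr := (1 - s) ^ 2 * (1 + s) ^ 3 * S0 / (16 * s ^ 2).

Lemma s_01 : 0 < s < 1. Proof. unfold s. lra. Qed.

Lemma curve_S0_pos : 0 < S0.
Proof.
  pose proof s_01. unfold S0. assert (0 < s ^ 2) by (apply pow_lt; lra).
  assert (0 < s ^ 3) by (apply pow_lt; lra). lra.
Qed.

Lemma curve_prod : u * v = (1 - s) ^ 2 * (1 + s) / (4 * s).
Proof.
  pose proof s_01. apply Rmult_eq_reg_r with (4 * s); [|lra].
  replace (u * v * (4 * s)) with (4 * u * v * (u + v)) by (unfold s; ring).
  rewrite on_curve. fold s. field. lra.
Qed.

Lemma curve_diff_square : d ^ 2 = (s ^ 2 + s - 1) / s.
Proof.
  pose proof s_01.
  replace (d ^ 2) with (s ^ 2 - 4 * (u * v)) by (unfold d, s; ring).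
  rewrite curve_prod. field. lra.
Qed.

Lemma curve_square_sum : u ^ 2 + v ^ 2 = (s ^ 3 + s ^ 2 + s - 1) / (2 * s).
Proof.
  pose proof s_01.
  replace (u ^ 2 + v ^ 2) with (s ^ 2 - 2 * (u * v)) by (unfold s; ring).
  rewrite curve_prod. field. lra.
Qed.

Lemma curve_fourth_sum : u ^ 4 + v ^ 4 = S0 ^ 2 / (8 * s ^ 2) - 1.
Proof.
  pose proof s_01.
  replace (u ^ 4 + v ^ 4) with ((u ^ 2 + v ^ 2) ^ 2 - 2 * (u * v) ^ 2) by ring.
  rewrite curve_square_sum, curve_prod. unfold S0. field. lra.
Qed.

(** On the curve the radicand of part (ii) is the square of the rational function
    [S0 / (4 s)], which is positive. *)
Lemma curve_root : sqrt (1 / 2 * (1 + u ^ 4 + v ^ 4)) = S0 / (4 * s).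
Proof.
  pose proof s_01. pose proof curve_S0_pos.
  replace (1 / 2 * (1 + u ^ 4 + v ^ 4)) with ((S0 / (4 * s)) ^ 2).
  - apply sqrt_pow2. apply Rlt_le, Rdiv_lt_0_compat; lra.
  - replace (1 + u ^ 4 + v ^ 4) with (1 + (u ^ 4 + v ^ 4)) by ring.
    rewrite curve_fourth_sum. field. lra.
Qed.

Lemma form_i : 2 * (u - v) * (1 + 3 * (u + v) + 3 * (u ^ 2 + v ^ 2)
    + 2 * (u * v) * (3 + u + v)) = d * T.
Proof.
  pose proof s_01.
  replace (2 * (u - v) * (1 + 3 * (u + v) + 3 * (u ^ 2 + v ^ 2) + 2 * (u * v) * (3 + u + v)))
    with (2 * d * (1 + 3 * s + 3 * s ^ 2 + 2 * (u * v) * s)) by (unfold d, s; ring).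
  rewrite curve_prod. unfold T. field. lra.
Qed.

Lemma form_ii : 2 * (u ^ 2 - v ^ 2) * (4 * (S0 / (4 * s)) + 4 - (u ^ 2 + v ^ 2)) = d * T.
Proof.
  pose proof s_01.
  rewrite curve_square_sum.
  replace (u ^ 2 - v ^ 2) with (d * s) by (unfold d, s; ring).
  unfold T, S0. field. lra.
Qed.

(** These are [u P_u] and [v P_v] for the polynomial
    [P = 4 u v (u + v) - (1 - u - v)^2 (1 + u + v)]. *)
Let c1 := u * (4 * v * (2 * u + v) + (1 - s) * (1 + 3 * s)).
Let c2 := v * (4 * u * (2 * v + u) + (1 - s) * (1 + 3 * s)).

Lemma gradient_sum : c1 + c2 = (1 - s) * (3 + s).
Proof.
  pose proof s_01.
  replace (c1 + c2) with (12 * (u * v) * s + s * ((1 - s) * (1 + 3 * s)))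
    by (unfold c1, c2, s; ring).
  rewrite curve_prod. field. lra.
Qed.

Lemma gradient_diff : c1 - c2 = d * ((1 - s) * (1 + s + 2 * s ^ 2) / s).
Proof.
  pose proof s_01.
  replace (c1 - c2) with (d * (4 * (u * v) + (1 - s) * (1 + 3 * s)))
    by (unfold c1, c2, d, s; ring).
  rewrite curve_prod. field. lra.
Qed.

(** The hypothesis on the gradient says [m^2 p = - 15 r] with [p = c1 - c a] and
    [r = c1 - c b].  On the curve [p + r = d T Rr] and [p r = - 15 Rr^2], so that
    [m p = - 15 Rr] and [r = m Rr], and the sum of [p] and [r] is [Rr (m - 15 / m)].
    The order [b < a] gives [p < 0 < r] and thereby selects the root. *)
Theorem multiplier_of_gradient (a b m : R) :
  0 < m -> b < a ->
  u ^ 8 = a * b -> v ^ 8 = (1 - a) * (1 - b) ->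
  c1 * ((1 - a) * m ^ 2 + 15 * (1 - b)) = c2 * (a * m ^ 2 + 15 * b) ->
  m - 15 / m = d * T.
Proof.
  intros Hm Hab Hu Hv Hc.
  pose proof s_01 as Hs. pose proof curve_S0_pos as HS.
  assert (RP : 0 < Rr).
  { unfold Rr. apply Rdiv_lt_0_compat; [|apply Rmult_lt_0_compat; [lra | apply pow_lt; lra]].
    apply Rmult_lt_0_compat; [|assumption]. apply Rmult_lt_0_compat; apply pow_lt; lra. }
  set (c := c1 + c2). set (p := c1 - c * a). set (r := c1 - c * b).
  assert (Hpr : m ^ 2 * p = - 15 * r).
  { unfold p, r, c. lra. }
  assert (Esum : a + b = 1 + u ^ 8 - v ^ 8) by (rewrite Hu, Hv; ring).
  assert (Delta : u ^ 8 - v ^ 8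
    = d * ((s ^ 3 + s ^ 2 + s - 1) / 2 * (S0 ^ 2 / (8 * s ^ 2) - 1))).
  { replace (u ^ 8 - v ^ 8) with (d * (s * (u ^ 2 + v ^ 2) * (u ^ 4 + v ^ 4)))
      by (unfold d, s; ring).
    rewrite curve_square_sum, curve_fourth_sum. field. lra. }
  assert (Sigma : u ^ 8 + v ^ 8
    = (S0 ^ 2 / (8 * s ^ 2) - 1) ^ 2 - 2 * ((1 - s) ^ 2 * (1 + s) / (4 * s)) ^ 4).
  { rewrite <- curve_fourth_sum, <- curve_prod. ring. }
  assert (Hsum : p + r = d * T * Rr).
  { replace (p + r) with ((c1 - c2) - c * (u ^ 8 - v ^ 8))
      by (replace (u ^ 8 - v ^ 8) with (a + b - 1) by lra; unfold p, r, c; ring).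
    unfold c. rewrite gradient_sum, gradient_diff, Delta. unfold Rr, T, S0. field. lra. }
  (* [a] and [b] enter through [a + b] and [a b] only: [(a - b)^2] is the polynomial in
     [u^8], [v^8] below. *)
  assert (Hprod : p * r = - 15 * Rr ^ 2).
  { assert (Q : 4 * (p * r) = (p + r) ^ 2 - c ^ 2 * (1 + (u ^ 8 - v ^ 8) ^ 2 - 2 * (u ^ 8 + v ^ 8))).
    { replace (1 + (u ^ 8 - v ^ 8) ^ 2 - 2 * (u ^ 8 + v ^ 8)) with ((a - b) ^ 2)
        by (rewrite Hu, Hv; ring).
      unfold p, r. ring. }
    assert (Q' : (p + r) ^ 2 - c ^ 2 * (1 + (u ^ 8 - v ^ 8) ^ 2 - 2 * (u ^ 8 + v ^ 8))
                 = - 60 * Rr ^ 2); [|lra].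
    rewrite Hsum, Delta, Sigma. unfold c. rewrite gradient_sum.
    rewrite !Rpow_mult_distr, curve_diff_square. unfold Rr, T, S0. field. lra. }
  assert (Hc0 : 0 < c) by (unfold c; rewrite gradient_sum; nra).
  assert (Hrp : p < r) by (unfold p, r; nra).
  assert (Hp : p < 0).
  { destruct (Rlt_le_dec p 0) as [L|L]; [assumption|exfalso].
    assert (0 <= p * r) by nra. assert (0 < Rr ^ 2) by now apply pow_lt. lra. }
  assert (Hmp : m * p = - (15 * Rr)).
  { assert (E : (m * p - 15 * Rr) * (m * p + 15 * Rr) = 0).
    { replace ((m * p - 15 * Rr) * (m * p + 15 * Rr)) with (m ^ 2 * p * p - 225 * Rr ^ 2) by ring.
      rewrite Hpr. replace (- 15 * r * p) with (- 15 * (p * r)) by ring. rewrite Hprod. ring. }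
    apply Rmult_integral in E. destruct E as [E|E]; [|lra].
    assert (m * p < 0) by nra. lra. }
  assert (Hr : r = m * Rr).
  { assert (m ^ 2 * p = m * (m * p)) by ring. rewrite Hmp in H. lra. }
  assert (Hp' : p = - (15 * Rr) / m) by (rewrite <- Hmp; field; lra).
  apply Rmult_eq_reg_r with Rr; [|lra].
  rewrite <- Hsum, Hr, Hp'. field. lra.
Qed.

End Curve.


(** * Differentiating the modular equation *)

Lemma is_derive_modulus_15 (q : R) : 0 < q < 1 ->
  is_derive (fun q => modulus (q ^ 15)) q
    (15 * (modulus (q ^ 15) * (1 - modulus (q ^ 15)) * rphi (q ^ 15) ^ 4) / q).
Proof.
  intro Hq. pose proof (pow_in_01 q 15 ltac:(lia) Hq) as Hq15.
  assert (D : is_derive (fun q => q ^ 15) q (15 * q ^ 14)).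
  { auto_derive; [easy | simpl; ring]. }
  pose proof (is_derive_comp _ _ _ _ _ (is_derive_modulus _ Hq15) D) as H.
  match type of H with is_derive _ _ ?l =>
    replace (15 * (modulus (q ^ 15) * (1 - modulus (q ^ 15)) * rphi (q ^ 15) ^ 4) / q) with l
  end; [exact H|].
  unfold scal; simpl scal; unfold mult; cbn -[pow modulus rphi].
  change (q ^ 15) with (q * q ^ 14) at 4.
  assert (0 < q ^ 14) by (apply pow_lt; lra).
  field. lra.
Qed.

(** The modulus increases with the nome, having a positive derivative. *)
Lemma modulus_decr_15 (q : R) : 0 < q < 1 -> modulus (q ^ 15) < modulus q.
Proof.
  intro Hq. pose proof (pow_in_01 q 15 ltac:(lia) Hq) as Hq15.
  assert (L : q ^ 15 < q).
  { change (q ^ 15) with (q * q ^ 14). pose proof (pow_in_01 q 14 ltac:(lia) Hq). nra. }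
  destruct (MVT_gen modulus (q ^ 15) q
    (fun x => modulus x * (1 - modulus x) * rphi x ^ 4 / x)) as [c [Hc E]].
  - intros x Hx. rewrite Rmin_left, Rmax_right in Hx by lra. apply is_derive_modulus. lra.
  - intros x Hx. rewrite Rmin_left, Rmax_right in Hx by lra.
    apply ex_derive_continuity_pt, ex_derive_modulus. lra.
  - rewrite Rmin_left, Rmax_right in Hc by lra.
    pose proof (modulus_01 c ltac:(lra)). pose proof (rphi_ge_1 c ltac:(lra)).
    assert (P : 0 < modulus c * (1 - modulus c) * rphi c ^ 4 / c).
    { apply Rdiv_lt_0_compat; [|lra]. apply Rmult_lt_0_compat; [nra | apply pow_lt; lra]. }
    assert (0 < modulus c * (1 - modulus c) * rphi c ^ 4 / c * (q - q ^ 15)) by nra. lra.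
Qed.

(** Logarithmic differentiation of [f ^ 8 = g]. *)
Lemma eighth_root_derive (f g : R -> R) (x g' : R) :
  0 < f x -> ex_derive f x -> is_derive g x g' ->
  locally x (fun y => f y ^ 8 = g y) -> is_derive f x (f x * g' / (8 * g x)).
Proof.
  intros Hf [f' Df] Dg E.
  assert (D8 : is_derive (fun y => f y ^ 8) x (8 * f x ^ 7 * f')).
  { auto_derive; [eexists; exact Df|].
    rewrite (is_derive_unique (fun y : R => f y) _ _ Df). simpl. ring. }
  assert (D8' : is_derive g x (8 * f x ^ 7 * f')).
  { exact (is_derive_ext_loc _ _ _ _ E D8). }
  pose proof (is_derive_unique _ _ _ D8') as U. rewrite (is_derive_unique _ _ _ Dg) in U.
  rewrite U, <- (locally_singleton _ _ E).
  assert (K : f x * (8 * f x ^ 7 * f') / (8 * f x ^ 8) = f') by (field; lra).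
  rewrite K. exact Df.
Qed.

Section Multiplier.

Variable q : R.
Hypothesis Hq : 0 < q < 1.

Let Hq15 : 0 < q ^ 15 < 1 := pow_in_01 q 15 ltac:(lia) Hq.
Let P := rphi q.
Let Q := rphi (q ^ 15).
Let a := modulus q.
Let b := modulus (q ^ 15).

Lemma theta_ex_derive (n : nat) : (0 < n)%nat ->
  ex_derive rphi (q ^ n) /\ ex_derive rphi (- q ^ n) /\ ex_derive rpsi (q ^ n).
Proof.
  intro Hn. pose proof (pow_in_01 q n Hn Hq).
  split; [|split]; [apply ex_derive_rphi | apply ex_derive_rphi | apply ex_derive_rpsi];
    rewrite ?Rabs_Ropp, Rabs_pos_eq; lra.
Qed.

Lemma theta_ex_derive_1 : ex_derive rphi q /\ ex_derive rpsi q.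
Proof. split; [apply ex_derive_rphi | apply ex_derive_rpsi]; rewrite Rabs_pos_eq; lra. Qed.

Lemma ex_derive_mod_u : ex_derive mod_u q.
Proof.
  destruct theta_ex_derive_1 as [D1 D2].
  destruct (theta_ex_derive 15 ltac:(lia)) as [D3 [_ D4]].
  pose proof (P_ge_1 q Hq). pose proof (Q_ge_1 q Hq).
  assert (N : rphi q * rphi (q ^ 15) <> 0) by nra.
  unfold mod_u. auto_derive.
  repeat split; first [exact D1 | exact D2 | exact D3 | exact D4 | exact N].
Qed.

Lemma ex_derive_mod_v : ex_derive mod_v q.
Proof.
  destruct theta_ex_derive_1 as [D1 _].
  destruct (theta_ex_derive 15 ltac:(lia)) as [D2 _].
  destruct (theta_ex_derive 2 ltac:(lia)) as [_ [D3 _]].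
  destruct (theta_ex_derive 30 ltac:(lia)) as [_ [D4 _]].
  pose proof (P_ge_1 q Hq). pose proof (Q_ge_1 q Hq).
  assert (N : rphi q * rphi (q ^ 15) <> 0) by nra.
  unfold mod_v. auto_derive.
  repeat split; first [exact D1 | exact D2 | exact D3 | exact D4 | exact N].
Qed.

Lemma is_derive_mod_u :
  is_derive mod_u q (mod_u q * ((1 - a) * P ^ 4 + 15 * (1 - b) * Q ^ 4) / (8 * q)).
Proof.
  pose proof (is_derive_modulus q Hq) as Da. pose proof (is_derive_modulus_15 q Hq) as Db.
  pose proof (modulus_01 q Hq) as Ha. pose proof (modulus_01 _ Hq15) as Hb.
  fold a b P Q in Da, Db, Ha, Hb.
  assert (D : is_derive (fun q => modulus q * modulus (q ^ 15)) q
    (a * (1 - a) * P ^ 4 / q * b + a * (15 * (b * (1 - b) * Q ^ 4) / q))).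
  { exact (is_derive_mult modulus (fun q => modulus (q ^ 15)) q _ _ Da Db Rmult_comm). }
  pose proof (eighth_root_derive mod_u (fun q => modulus q * modulus (q ^ 15)) q _
    (mod_u_pos q Hq) ex_derive_mod_u D
    (locally_01 q _ Hq (fun y Hy => mod_u_eighth y Hy))) as H.
  cbv beta in H. fold a b in H.
  replace (mod_u q * ((1 - a) * P ^ 4 + 15 * (1 - b) * Q ^ 4) / (8 * q))
    with (mod_u q * (a * (1 - a) * P ^ 4 / q * b + a * (15 * (b * (1 - b) * Q ^ 4) / q))
          / (8 * (a * b))); [exact H|].
  field. lra.
Qed.

Lemma is_derive_mod_v :
  is_derive mod_v q (- (mod_v q * (a * P ^ 4 + 15 * b * Q ^ 4) / (8 * q))).
Proof.
  pose proof (is_derive_modulus q Hq) as Da. pose proof (is_derive_modulus_15 q Hq) as Db.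
  pose proof (modulus_01 q Hq) as Ha. pose proof (modulus_01 _ Hq15) as Hb.
  fold a b P Q in Da, Db, Ha, Hb.
  assert (D : is_derive (fun q => (1 - modulus q) * (1 - modulus (q ^ 15))) q
    (- (a * (1 - a) * P ^ 4 / q) * (1 - b) + (1 - a) * - (15 * (b * (1 - b) * Q ^ 4) / q))).
  { assert (Da' : is_derive (fun q => 1 - modulus q) q (- (a * (1 - a) * P ^ 4 / q))).
    { auto_derive; [eexists; exact Da|].
      rewrite (is_derive_unique (fun y : R => modulus y) _ _ Da). ring. }
    assert (Db' : is_derive (fun q => 1 - modulus (q ^ 15)) q
                    (- (15 * (b * (1 - b) * Q ^ 4) / q))).
    { pose proof (is_derive_minus (fun _ => 1) (fun q => modulus (q ^ 15)) q _ _
        (is_derive_const 1 q) Db) as M.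
      unfold minus in M. rewrite plus_zero_l in M. exact M. }
    exact (is_derive_mult (fun q => 1 - modulus q) (fun q => 1 - modulus (q ^ 15)) q _ _
             Da' Db' Rmult_comm). }
  pose proof (eighth_root_derive mod_v (fun q => (1 - modulus q) * (1 - modulus (q ^ 15))) q _
    (mod_v_pos q Hq) ex_derive_mod_v D
    (locally_01 q _ Hq (fun y Hy => mod_v_eighth y Hy))) as H.
  cbv beta in H. fold a b in H.
  replace (- (mod_v q * (a * P ^ 4 + 15 * b * Q ^ 4) / (8 * q)))
    with (mod_v q * (- (a * (1 - a) * P ^ 4 / q) * (1 - b)
                     + (1 - a) * - (15 * (b * (1 - b) * Q ^ 4) / q))
          / (8 * ((1 - a) * (1 - b)))); [exact H|].
  field. lra.
Qed.

(** The derivative of the modular equation along [q], multiplied by [8 q]. *)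
Lemma gradient_relation :
  let u := mod_u q in let v := mod_v q in let s := u + v in
  u * (4 * v * (2 * u + v) + (1 - s) * (1 + 3 * s)) * ((1 - a) * P ^ 4 + 15 * (1 - b) * Q ^ 4)
  = v * (4 * u * (2 * v + u) + (1 - s) * (1 + 3 * s)) * (a * P ^ 4 + 15 * b * Q ^ 4).
Proof.
  intros u v s.
  set (F := fun y => 4 * mod_u y * mod_v y * (mod_u y + mod_v y)
                     - (1 - (mod_u y + mod_v y)) ^ 2 * (1 + (mod_u y + mod_v y))).
  pose proof is_derive_mod_u as Du. pose proof is_derive_mod_v as Dv.
  set (u' := mod_u q * _ / _) in Du. set (v' := - _) in Dv.
  assert (D0 : is_derive F q 0).
  { apply (is_derive_ext_loc (fun _ => 0)); [|exact (is_derive_const 0 q)].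
    apply (locally_01 q _ Hq). intros y Hy. symmetry. exact (Rminus_diag_eq _ _ (modular_equation y Hy)). }
  assert (D1 : is_derive F q ((4 * v * (2 * u + v) + (1 - s) * (1 + 3 * s)) * u'
                              + (4 * u * (2 * v + u) + (1 - s) * (1 + 3 * s)) * v')).
  { unfold F. auto_derive.
    - repeat split; eexists; first [exact Du | exact Dv].
    - rewrite (is_derive_unique (fun y : R => mod_u y) _ _ Du),
        (is_derive_unique (fun y : R => mod_v y) _ _ Dv). fold u v. unfold s. ring. }
  pose proof (is_derive_unique _ _ _ D1) as U. rewrite (is_derive_unique _ _ _ D0) in U.
  unfold u', v' in U. fold u v in U.
  apply Rminus_diag_uniq.
  apply Rmult_eq_reg_r with (/ (8 * q)); [|apply Rinv_neq_0_compat; lra].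
  rewrite Rmult_0_l, U. field. lra.
Qed.

Theorem theta_multiplier :
  let u := mod_u q in let v := mod_v q in let s := u + v in
  let m := P ^ 2 / Q ^ 2 in
  m - 15 / m = (u - v) * (3 + 5 * s + 5 * s ^ 2 + s ^ 3).
Proof.
  intros u v s m.
  pose proof (P_ge_1 q Hq) as HP. pose proof (Q_ge_1 q Hq) as HQ. fold P in HP. fold Q in HQ.
  apply (multiplier_of_gradient u v (mod_u_pos q Hq) (mod_v_pos q Hq) (mod_sum_lt_1 q Hq)
           (modular_equation q Hq) a b m).
  - apply Rdiv_lt_0_compat; apply pow_lt; lra.
  - now apply modulus_decr_15.
  - now apply mod_u_eighth.
  - now apply mod_v_eighth.
  - pose proof gradient_relation as G. cbv zeta in G. fold u v in G.
    apply Rmult_eq_reg_r with (Q ^ 4); [|apply pow_nonzero; lra].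
    replace (m ^ 2) with (P ^ 4 / Q ^ 4) by (unfold m; field; lra).
    etransitivity; [|etransitivity; [exact G|]]; field; lra.
Qed.

(** ** The theta function identity on the real interval *)

(** Square both sides and write [phi(q^2)^2], [psi(q^4)^2] and
    [psi(q^2)^2 = phi(q^2) psi(q^4)] in terms of [phi(q)], [phi(-q)], [psi(q^2)]. *)
Lemma theta_root :
  rphi (q ^ 2) * rphi (q ^ 30) + 4 * q ^ 8 * (rpsi (q ^ 4) * rpsi (q ^ 60))
  = P * Q * sqrt (1 / 2 * (1 + mod_u q ^ 4 + mod_v q ^ 4)).
Proof.
  pose proof (P_ge_1 q Hq) as HP. pose proof (Q_ge_1 q Hq) as HQ. fold P in HP. fold Q in HQ.
  pose proof (pow_in_01 q 2 ltac:(lia) Hq) as H2. pose proof (pow_in_01 q 30 ltac:(lia) Hq) as H30.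
  pose proof (rphi_ge_1 _ H2). pose proof (rphi_ge_1 _ H30).
  pose proof (rpsi_ge_1 _ (pow_in_01 q 4 ltac:(lia) Hq)).
  pose proof (rpsi_ge_1 _ (pow_in_01 q 60 ltac:(lia) Hq)).
  assert (Q8 : 0 < q ^ 8) by (apply pow_lt; lra).
  set (Y := _ + _). assert (HY : 0 < Y).
  { unfold Y. apply Rplus_lt_0_compat; [nra|].
    apply Rmult_lt_0_compat; [lra|nra]. }
  replace (1 / 2 * (1 + mod_u q ^ 4 + mod_v q ^ 4)) with ((Y / (P * Q)) ^ 2).
  { rewrite sqrt_pow2 by (apply Rlt_le, Rdiv_lt_0_compat; nra). field. lra. }
  pose proof (phi_square_sum q Hq) as S1. pose proof (phi_square_sum _ Hq15) as S2.
  pose proof (phi_square_diff q Hq) as D1. pose proof (phi_square_diff _ Hq15) as D2.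
  pose proof (psi_square _ H2) as E1. pose proof (psi_square _ H30) as E2.
  rewrite <- !pow_mult in S2, D2, E1, E2.
  change (15 * 2)%nat with 30%nat in S2. change (15 * 4)%nat with 60%nat in D2.
  change (2 * 2)%nat with 4%nat in E1. change (30 * 2)%nat with 60%nat in E2.
  fold P in S1, D1. fold Q in S2, D2.
  replace (mod_u q ^ 4) with ((mod_u q ^ 2) ^ 2) by ring.
  replace (mod_v q ^ 4) with ((mod_v q ^ 2) ^ 2) by ring.
  rewrite (mod_u_square q Hq), (mod_v_square q Hq). fold P Q.
  assert (X : Y ^ 2 = 1 / 2 * ((P * Q) ^ 2 + (rphi (- q) * rphi (- q ^ 15)) ^ 2
                     + (4 * q ^ 4 * (rpsi (q ^ 2) * rpsi (q ^ 30))) ^ 2)).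
  { replace (Y ^ 2) with (1 / 4 * ((2 * rphi (q ^ 2) ^ 2) * (2 * rphi (q ^ 30) ^ 2)
        + (8 * q * rpsi (q ^ 4) ^ 2) * (8 * q ^ 15 * rpsi (q ^ 60) ^ 2))
        + 8 * q ^ 8 * ((rphi (q ^ 2) * rpsi (q ^ 4)) * (rphi (q ^ 30) * rpsi (q ^ 60))))
      by (unfold Y; field).
    rewrite <- S1, <- S2, <- D1, <- D2, <- E1, <- E2. field. }
  replace ((Y / (P * Q)) ^ 2) with (Y ^ 2 / (P * Q) ^ 2) by (field; lra).
  rewrite X. field. lra.
Qed.

(** Multiply the formula for [m - 15 / m] by [(phi(q) phi(q^15))^2], using the form of
    its right-hand side that appears in part (ii). *)
Theorem theta_identity :
  P ^ 4 - 15 * Q ^ 4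
  = 2 * (4 * q ^ 4 * (rpsi (q ^ 2) * rpsi (q ^ 30)) - rphi (- q) * rphi (- q ^ 15))
    * (4 * (rphi (q ^ 2) * rphi (q ^ 30) + 4 * q ^ 8 * (rpsi (q ^ 4) * rpsi (q ^ 60)))
       + 4 * (P * Q)
       - (4 * q ^ 4 * (rpsi (q ^ 2) * rpsi (q ^ 30)) + rphi (- q) * rphi (- q ^ 15))).
Proof.
  pose proof (P_ge_1 q Hq) as HP. pose proof (Q_ge_1 q Hq) as HQ. fold P in HP. fold Q in HQ.
  pose proof theta_multiplier as M. cbv zeta in M.
  pose proof (mod_u_square q Hq) as U2. pose proof (mod_v_square q Hq) as V2.
  fold P in U2, V2. fold Q in U2, V2.
  rewrite theta_root.
  rewrite (curve_root _ _ (mod_u_pos q Hq) (mod_v_pos q Hq) (mod_sum_lt_1 q Hq)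
             (modular_equation q Hq)).
  pose proof (form_ii _ _ (mod_u_pos q Hq) (mod_v_pos q Hq) (mod_sum_lt_1 q Hq)
                (modular_equation q Hq)) as F.
  rewrite <- F in M. set (S := _ / (4 * _)) in M |- *.
  replace (4 * q ^ 4 * (rpsi (q ^ 2) * rpsi (q ^ 30))) with (P * Q * mod_u q ^ 2)
    by (rewrite U2; field; lra).
  replace (rphi (- q) * rphi (- q ^ 15)) with (P * Q * mod_v q ^ 2)
    by (rewrite V2; field; lra).
  replace (P ^ 4 - 15 * Q ^ 4) with ((P * Q) ^ 2 * (P ^ 2 / Q ^ 2 - 15 / (P ^ 2 / Q ^ 2)))
    by (field; lra).
  rewrite M. ring.
Qed.

End Multiplier.


(** * The degree 15 relation and its consequences *)

Lemma Rpower_root (x y : R) (n : nat) :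
  (0 < n)%nat -> 0 < y -> y ^ n = x -> Rpower x (1 / INR n) = y.
Proof.
  intros Hn Hy <-. assert (0 < INR n) by now apply lt_0_INR.
  rewrite <- Rpower_pow, Rpower_mult by assumption.
  replace (INR n * (1 / INR n)) with 1 by (field; lra). now apply Rpower_1.
Qed.

(** By inversion both moduli come from nomes, and the ratio of the periods is a nonzero
    multiple of the logarithm of the nome: multiplying the ratio by 15 raises the nome
    to the power 15. *)
Lemma degree_15_nome (a b : R) : 0 < a < 1 -> 0 < b < 1 -> has_degree_over 15 b a ->
  exists q, 0 < q < 1 /\ a = modulus q /\ b = modulus (q ^ 15).
Proof.
  intros Ha Hb H.
  destruct (modulus_surjective a Ha) as [q [Hq Eq]].
  destruct (modulus_surjective b Hb) as [p [Hp Ep]].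
  pose proof legendre_const_pos as HW.
  exists q. split; [assumption|]. split; [now symmetry|].
  rewrite <- Ep. f_equal.
  apply ln_inv; [lra | apply pow_lt; lra |].
  rewrite ln_pow by lra.
  unfold has_degree_over in H.
  change (15 * ell_ratio a = ell_ratio b) in H.
  rewrite <- Eq, <- Ep, !ell_ratio_nome in H by assumption.
  apply Rmult_eq_reg_l with (- legendre_const); [|lra].
  rewrite <- H. simpl INR. ring.
Qed.

Lemma theta_identity_C (q : C) : Cmod q < 1 ->
  (phi q ^ 4 - RtoC 15 * phi (q ^ 15) ^ 4
   = RtoC 2 * (RtoC 4 * q ^ 4 * (psi (q ^ 2) * psi (q ^ 30)) - phi (- q) * phi (- q ^ 15))
     * (RtoC 4 * (phi (q ^ 2) * phi (q ^ 30) + RtoC 4 * q ^ 8 * (psi (q ^ 4) * psi (q ^ 60)))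
        + RtoC 4 * (phi q * phi (q ^ 15))
        - (RtoC 4 * q ^ 4 * (psi (q ^ 2) * psi (q ^ 30)) + phi (- q) * phi (- q ^ 15))))%C.
Proof.
  intro Hq. apply Ceq_minus. revert q Hq.
  refine (disc_series_identity (fun q => phi q ^ 4 - RtoC 15 * phi (q ^ 15) ^ 4
   - RtoC 2 * (RtoC 4 * q ^ 4 * (psi (q ^ 2) * psi (q ^ 30)) - phi (- q) * phi (- q ^ 15))
     * (RtoC 4 * (phi (q ^ 2) * phi (q ^ 30) + RtoC 4 * q ^ 8 * (psi (q ^ 4) * psi (q ^ 60)))
        + RtoC 4 * (phi q * phi (q ^ 15))
        - (RtoC 4 * q ^ 4 * (psi (q ^ 2) * psi (q ^ 30)) + phi (- q) * phi (- q ^ 15))))%C _ _);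
    [disc|].
  intros x Hx. real_theta Hx.
  rewrite <- !RtoC_pow, <- !RtoC_mult, <- ?RtoC_plus, <- ?RtoC_minus, <- ?RtoC_mult,
    <- ?RtoC_plus, <- ?RtoC_minus, <- ?RtoC_mult, <- ?RtoC_minus.
  rewrite (theta_identity x Hx). f_equal. ring.
Qed.

Theorem theorem2p1 :
  (forall alpha beta : R,
     0 < alpha < 1 -> 0 < beta < 1 ->
     has_degree_over 15 beta alpha ->
     let z1 := hyp2F1 (1/2) (1/2) 1 alpha in
     let z15 := hyp2F1 (1/2) (1/2) 1 beta in
     let m := z1 / z15 in
     (m - 15 / m =
        2 * (Rpower (alpha * beta) (1/8)
             - Rpower ((1 - alpha) * (1 - beta)) (1/8))
        * (1
           + 3 * (Rpower (alpha * beta) (1/8)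
                  + Rpower ((1 - alpha) * (1 - beta)) (1/8))
           + 3 * (Rpower (alpha * beta) (1/4)
                  + Rpower ((1 - alpha) * (1 - beta)) (1/4))
           + 2 * Rpower (alpha * beta * (1 - alpha) * (1 - beta)) (1/8)
             * (3 + Rpower (alpha * beta) (1/8)
                + Rpower ((1 - alpha) * (1 - beta)) (1/8))))
     /\
     (m - 15 / m =
        2 * (Rpower (alpha * beta) (1/4)
             - Rpower ((1 - alpha) * (1 - beta)) (1/4))
        * (4 * sqrt (1/2 * (1 + sqrt (alpha * beta)
                            + sqrt ((1 - alpha) * (1 - beta))))
           + 4
           - (Rpower (alpha * beta) (1/4)
              + Rpower ((1 - alpha) * (1 - beta)) (1/4)))))
  /\
  (forall q : C, Cmod q < 1 ->
     (phi q ^ 2 / phi (q ^ 15) ^ 2 - 15 * (phi (q ^ 15) ^ 2 / phi q ^ 2) =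
        2 * (4 * q ^ 4 * (psi (q ^ 2) * psi (q ^ 30) / (phi q * phi (q ^ 15)))
             - phi (- q) * phi (- q ^ 15) / (phi q * phi (q ^ 15)))
        * (4 * (phi (q ^ 2) * phi (q ^ 30) / (phi q * phi (q ^ 15))
                + 4 * q ^ 8
                  * (psi (q ^ 4) * psi (q ^ 60) / (phi q * phi (q ^ 15))))
           + 4
           - (4 * q ^ 4 * (psi (q ^ 2) * psi (q ^ 30) / (phi q * phi (q ^ 15)))
              + phi (- q) * phi (- q ^ 15) / (phi q * phi (q ^ 15)))))%C).
Proof.
  split.
  - intros a b Ha Hb Hdeg z1 z15 m.
    destruct (degree_15_nome a b Ha Hb Hdeg) as [q [Hq [Ea Eb]]].
    pose proof (pow_in_01 q 15 ltac:(lia) Hq) as Hq15.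
    pose proof (mod_u_pos q Hq) as Hu. pose proof (mod_v_pos q Hq) as Hv.
    pose proof (mod_sum_lt_1 q Hq) as Hs. pose proof (modular_equation q Hq) as Hc.
    pose proof (mod_u_eighth q Hq) as U8. pose proof (mod_v_eighth q Hq) as V8.
    pose proof (theta_multiplier q Hq) as M. cbv zeta in M.
    rewrite <- (ell_modulus q Hq), <- (ell_modulus _ Hq15) in M.
    rewrite <- Ea, <- Eb in U8, V8, M.
    change (ell a / ell b) with m in M.
    set (u := mod_u q) in *. set (v := mod_v q) in *. clearbody u v.
    assert (PU : 0 < u ^ 2 /\ 0 < v ^ 2 /\ 0 < u ^ 4 /\ 0 < v ^ 4)
      by (repeat split; now apply pow_lt).
    assert (R8 : forall x y, 0 < y -> y ^ 8 = x -> Rpower x (1 / 8) = y).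
    { intros x y Hy E. rewrite <- (Rpower_root x y 8); auto with arith.
      do 2 f_equal. simpl. ring. }
    assert (R4 : forall x y, 0 < y -> y ^ 4 = x -> Rpower x (1 / 4) = y).
    { intros x y Hy E. rewrite <- (Rpower_root x y 4); auto with arith.
      do 2 f_equal. simpl. ring. }
    rewrite M, (R8 (a * b) u), (R8 ((1 - a) * (1 - b)) v), (R4 (a * b) (u ^ 2)),
      (R4 ((1 - a) * (1 - b)) (v ^ 2)), (R8 (a * b * (1 - a) * (1 - b)) (u * v)).
    + split.
      * rewrite <- (form_i u v Hu Hv Hs Hc). ring.
      * rewrite <- (form_ii u v Hu Hv Hs Hc), <- (curve_root u v Hu Hv Hs Hc).
        replace (sqrt (a * b)) with (u ^ 4)
          by (rewrite <- U8; replace (u ^ 8) with ((u ^ 4) ^ 2) by ring; rewrite sqrt_pow2; lra).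
        replace (sqrt ((1 - a) * (1 - b))) with (v ^ 4)
          by (rewrite <- V8; replace (v ^ 8) with ((v ^ 4) ^ 2) by ring; rewrite sqrt_pow2; lra).
        ring.
    + now apply Rmult_lt_0_compat.
    + rewrite Rpow_mult_distr, U8, V8. ring.
    + tauto.
    + rewrite <- V8. ring.
    + tauto.
    + rewrite <- U8. ring.
    + assumption.
    + assumption.
    + assumption.
    + assumption.
  - intros q Hq.
    pose proof (phi_nonzero q Hq) as N1.
    pose proof (phi_nonzero _ (Cmod_pow_lt_1 q 15 ltac:(lia) Hq)) as N15.
    pose proof (theta_identity_C q Hq) as H.
    set (P := phi q) in *. set (Q := phi (q ^ 15)%C) in *.
    replace (P ^ 2 / Q ^ 2 - 15 * (Q ^ 2 / P ^ 2))%C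
      with ((P ^ 4 - RtoC 15 * Q ^ 4) / (P * Q) ^ 2)%C
      by (field; repeat split; try apply Cpow_nz; assumption).
    rewrite H. field. now split.
Qed.
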